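(* Let $(Y,X),(Y_1,X_1),(Y_2,X_2),\ldots$ be i.i.d. random vectors in $\mathbb{R}\times\mathbb{R}^d$ ($d\ge1$) such that the regression function $m(x)=\mathbb{E}[Y|X=x]$ exists. Let $I$ be a compact subset of $\mathbb{R}^d$ and let the kernel $K$ satisfy conditions (K.i), (K.ii), (K.iii), (K.iv) listed in the context and have support contained in $[-1/2,1/2]^d$. Assume that the distribution of $(Y,X)$ has a Lebesgue density $(y,x)\mapsto p_{Y,X}(y,x)$, so that the marginal density of $X$ is $f(x)=\int_{-\infty}^\infty p_{Y,X}(y,x)\,dy$, $x\in\mathbb{R}^d$. Suppose further that there exists an $\varepsilon>0$ such that $f$ is continuous and strictly positive on $J:=I^\varepsilon$ and that for all $z\in J$, $$\lim_{z'\to z}p_{Y,X}(y,z')=p_{Y,X}(y,z)\quad\text{for almost every }y\in\mathbb{R}.$$ (1) If there exists an $M>0$ such that $|Y|\,\mathbf{1}\{X\in J\}\le M$ almost surely, then for all sequences $0<a_n<b_n<1$ satisfying $b_n\to0$ and $na_n/\log n\to\infty$, $$\lim_{n\to\infty}\ \sup_{a_n\le h\le b_n}\|\widehat m_{n,h}-m(\cdot)\|_I=0\qquad\text{almost surely.}$$ (2) If for some $p>2$, $\sup_{z\in J}\mathbb{E}(|Y|^p\,|\,X=z)<\infty$, then with $\gamma=1-2/p$, for $c>0$ and $0<c(\log n/n)^\gamma<b_n<1$ satisfying $b_n\to0$, $$\lim_{n\to\infty}\ \sup_{c(\log n/n)^\gamma\le h\le b_n}\|\widehat m_{n,h}-m(\cdot)\|_I=0\qquad\text{almost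 surely.}$$
   Context: For $0<h<1$ the Nadaraya–Watson estimator is $$\widehat m_{n,h}(x)=\frac{\sum_{i=1}^nY_iK((x-X_i)/h^{1/d})}{\sum_{i=1}^nK((x-X_i)/h^{1/d})}.$$ For $I\subset\mathbb{R}^d$, $I^\varepsilon$ is the closed $\varepsilon$-neighborhood of $I$ with respect to the maximum norm $|x|_+=\max_{1\le i\le d}|x_i|$; $\|\psi\|_I=\sup_{x\in I}|\psi(x)|$. A kernel is a measurable function $K:\mathbb{R}^d\to\mathbb{R}$. Conditions on $K$: (K.i) $\int_{\mathbb{R}^d}K(s)\,ds=1$. (K.ii) $\|K\|_\infty=\sup_{x\in\mathbb{R}^d}|K(x)|=\kappa<\infty$. Let $\mathcal{K}=\{K((x-\cdot)/h^{1/d}): h>0,\ x\in\mathbb{R}^d\}$. For $\varepsilon>0$ let $N(\varepsilon,\mathcal{K})=\sup_Q N(\kappa\varepsilon,\mathcal{K},d_Q)$, the supremum being over all probability measures $Q$ on the Borel sets of $\mathbb{R}^d$, where $d_Q$ is the $L_2(Q)$-metric and $N(\delta,\mathcal{K},d_Q)$ is the minimal number of balls $\{g: d_Q(g,g')<\delta\}$ of $d_Q$-radius $\delta$ needed to cover $\mathcal{K}$. (K.iii) For some $C>0$ and $\nu>0$, $N(\varepsilon,\mathcal{K})\le C\varepsilon^{-\nu}$ for all $0<\varepsilon<1$. (K.iv) $\mathcal{K}$ is a pointwise measurable class: there is a countable subclass $\mathcal{K}_0\subset\mathcal{K}$ such that for every $g\in\mathcal{K}$ there is a sequence $\{g_m\}$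 in $\mathcal{K}_0$ with $g_m(z)\to g(z)$ for all $z\in\mathbb{R}^d$. *)

(* Defs.v *)
From HB Require Import structures.
From mathcomp Require Import all_boot all_order all_algebra.
From mathcomp Require Import all_classical all_reals all_analysis.
From mathcomp Require Import measurable_realfun.

Set Implicit Arguments.
Unset Strict Implicit.
Unset Printing Implicit Defensive.

Import Order.TTheory GRing.Theory Num.Theory.
Import numFieldTopology.Exports numFieldNormedType.Exports.

Local Open Scope classical_set_scope.
Local Open Scope ring_scope.

(* R^d is 'rV[R]_d; its library norm `|x| is the maximum norm. *)

Section borel_rV.
Variables (R : realType) (n : nat).

Let borel : set (set 'rV[R]_n) := <<s @open 'rV[R]_n >>.

Let borel0 : borel set0.
Proof. exact: sigma_algebra0. Qed.

Let borelC A : borel A -> borel (~` A).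
Proof. exact: sigma_algebraC. Qed.

Let borel_bigcup (F : (set 'rV[R]_n)^nat) :
  (forall i, borel (F i)) -> borel (\bigcup_i F i).
Proof. exact: sigma_algebra_bigcup. Qed.

HB.instance Definition _ := @isMeasurable.Build default_measure_display
  'rV[R]_n borel borel0 borelC borel_bigcup.

End borel_rV.

Section measurable_rV.
Variables (R : realType) (n : nat).

Lemma open_measurable_rV (U : set 'rV[R]_n) : open U -> measurable U.
Proof. exact: sub_sigma_algebra. Qed.

Lemma measurable_coord_rV (i : 'I_n) :
  measurable_fun [set: 'rV[R]_n] (fun x => x ord0 i).
Proof.
apply: (measurability _ (RGenOpens.measurableE R)) => //.
move=> _ [_ [a [b ->]] <-]; rewrite setTI; apply: open_measurable_rV.
apply: open_comp; last exact: interval_open.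
by move=> x _; exact: coord_continuous.
Qed.

Lemma measurable_fun_rVP d (T : measurableType d) (f : T -> 'rV[R]_n) :
  (forall i, measurable_fun setT (fun t => f t ord0 i)) -> measurable_fun setT f.
Proof.
move=> mf; apply: (@measurability _ _ _ _ _ _ (@open 'rV[R]_n)) => //.
move=> _ [U oU <-]; rewrite setTI.
pose box (c : {ffun 'I_n -> rat} * rat) : set 'rV[R]_n :=
  [set x | forall i, `|x ord0 i - ratr (c.1 i)| < ratr c.2].
have mbox c : measurable (f @^-1` box c).
  rewrite (_ : _ @^-1` _ = \bigcap_(i in [set: 'I_n])
      [set t | `|f t ord0 i - ratr (c.1 i)| < ratr c.2]); last first.
    by apply/seteqP; split => [t /= h i _|t /= h i]; [exact: h|exact: (h i)].
  apply: fin_bigcap_measurable; first exact: finite_finset.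
  move=> i _.
  have : measurable_fun setT (fun t => `|f t ord0 i - ratr (c.1 i)|).
    by apply: measurableT_comp => //; exact: measurable_funB.
  move=> /(_ measurableT `]-oo, ratr c.2[%classic (measurable_itv _)).
  by rewrite setTI set_itvE.
rewrite (_ : f @^-1` U = \bigcup_(c in [set c | box c `<=` U]) (f @^-1` box c)).
  rewrite bigcup_mkcond; apply: countable_bigcupT_measurable => // c.
  by case: ifP.
apply/seteqP; split => [t Ut|t [c cU] /cU//].
have /nbhs_ballP[e /= e0 eU] := oU _ Ut.
have [r /andP[r0 re]] : exists r : rat, 0 < (ratr r : R) < e / 2.
  have [r] := rat_in_itvoo (divr_gt0 e0 (ltr0n R 2)).
  by rewrite in_itv /=; exists r.
have cE i : exists q : rat, `|f t ord0 i - ratr q| < ratr r.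
  have [q] : exists q : rat, ratr q \in `](f t ord0 i - ratr r), (f t ord0 i)[.
    by apply: rat_in_itvoo; rewrite ltrBlDr ltrDl.
  rewrite in_itv /= => /andP[q1 q2]; exists q.
  by rewrite gtr0_norm ?subr_gt0// ltrBlDr addrC -ltrBlDr.
exists ([ffun i => sval (cid (cE i))], r) => /=; last first.
  by move=> i /=; rewrite ffunE; case: cid.
move=> y yb; apply: eU; split => // i j; rewrite (ord1 i).
have := yb j => /=; rewrite ffunE; case: cid => q /= hq yq.
rewrite -ball_normE /= (_ : _ - _ = (f t ord0 j - ratr q) - (y ord0 j - ratr q)).
  rewrite (le_lt_trans (ler_normB _ _))// (splitr e).
  by rewrite ltrD// (lt_trans _ re).
by rewrite opprB addrA subrK.
Qed.

End measurable_rV.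

Section lebesgue_rV.
Variable R : realType.

Definition cons_rV n (p : measurableTypeR R * 'rV[R]_n) : 'rV[R]_n.+1 :=
  \row_i if unlift ord0 i is Some j then p.2 ord0 j else p.1.

Definition uncons_rV n (x : 'rV[R]_n.+1) : measurableTypeR R * 'rV[R]_n :=
  (x ord0 ord0, \row_i x ord0 (lift ord0 i)).

Lemma cons_rVK n : cancel (@cons_rV n) (@uncons_rV n).
Proof.
move=> [a x]; rewrite /uncons_rV /cons_rV !mxE unlift_none; congr pair.
by apply/rowP => i; rewrite !mxE liftK.
Qed.

Lemma uncons_rVK n : cancel (@uncons_rV n) (@cons_rV n).
Proof.
move=> x; apply/rowP => i; rewrite !mxE.
by case: unliftP => [j ->|->] /=; rewrite ?mxE.
Qed.

Lemma measurable_cons_rV n : measurable_fun setT (@cons_rV n).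
Proof.
apply: measurable_fun_rVP => i; rewrite /cons_rV.
under eq_fun do rewrite mxE; case: unliftP => [j _|_] //.
exact: (measurableT_comp (measurable_coord_rV j) measurable_snd).
exact: measurable_fst.
Qed.

Lemma measurable_uncons_rV n : measurable_fun setT (@uncons_rV n).
Proof.
apply: measurable_fun_pair; first exact: measurable_coord_rV.
apply: measurable_fun_rVP => i; under eq_fun do rewrite mxE.
exact: measurable_coord_rV.
Qed.

Section step.
Variables (n : nat) (mu : {sigma_finite_measure set 'rV[R]_n -> \bar R}).

Definition lebesgue_rV_step : set 'rV[R]_n.+1 -> \bar R :=
  pushforward (@lebesgue_measure R \x mu)%E (@cons_rV n).

Let step0 : lebesgue_rV_step set0 = 0%E.
Proof. by rewrite /lebesgue_rV_step /pushforward preimage_set0 measure0. Qed.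

Let step_ge0 A : (0 <= lebesgue_rV_step A)%E.
Proof. by rewrite /lebesgue_rV_step /pushforward measure_ge0. Qed.

Let step_sigma_additive : semi_sigma_additive lebesgue_rV_step.
Proof.
move=> F mF tF mUF; rewrite /lebesgue_rV_step /pushforward preimage_bigcup.
apply: measure_semi_sigma_additive.
- move=> k; rewrite -[X in measurable X]setTI; exact: measurable_cons_rV.
- apply/trivIsetP => /= i j _ _ ij; rewrite -preimage_setI.
  by move/trivIsetP : tF => /(_ _ _ _ _ ij) ->//; rewrite preimage_set0.
- rewrite -preimage_bigcup -[X in measurable X]setTI.
  exact: measurable_cons_rV.
Qed.

HB.instance Definition _ := isMeasure.Build _ _ _ lebesgue_rV_step
  step0 step_ge0 step_sigma_additive.

Let step_sigma_finite : sigma_finite setT lebesgue_rV_step.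
Proof.
have /sigma_finiteP[F [FT ndF Ffin]] := sigma_finiteT (@lebesgue_measure R).
have /sigma_finiteP[G [GT ndG Gfin]] := sigma_finiteT mu.
exists (fun k => @uncons_rV n @^-1` (F k `*` G k)).
  rewrite -preimage_bigcup -[LHS](preimage_setT (@uncons_rV n)); congr preimage.
  rewrite -setXTT FT GT predeqE => -[x y]; split.
    move=> [/= [i _ Fix] [j _ Gjy]]; exists (maxn i j) => //; split.
    - by move: x Fix; exact/subsetPset/ndF/leq_maxl.
    - by move: y Gjy; exact/subsetPset/ndG/leq_maxr.
  by move=> [i _ []/= ? ?]; split; exists i.
move=> k; have [mFk Fk] := Ffin k; have [mGk Gk] := Gfin k.
have mF : measurable (F k `*` G k) by exact: measurableX.
split.
  by rewrite -[X in measurable X]setTI; exact: measurable_uncons_rV.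
rewrite /lebesgue_rV_step /pushforward -comp_preimage.
rewrite (_ : _ \o _ = id); last by apply/funext => p /=; rewrite cons_rVK.
by rewrite preimage_id product_measure1E// lte_mul_pinfty// ge0_fin_numE.
Qed.

HB.instance Definition _ := Measure_isSigmaFinite.Build _ _ _ lebesgue_rV_step
  step_sigma_finite.

End step.

Fixpoint lebesgue_rV n : {sigma_finite_measure set 'rV[R]_n -> \bar R} :=
  match n with
  | 0 => dirac (0 : 'rV[R]_0)
  | n'.+1 => lebesgue_rV_step (lebesgue_rV n')
  end.

(* with sigma-finiteness, this characterizes Lebesgue measure *)
Lemma lebesgue_rV_box n (A : 'I_n -> set R) :
  (forall i, measurable (A i)) ->
  lebesgue_rV n [set x | forall i, A i (x ord0 i)] =
  (\prod_(i < n) lebesgue_measure (A i))%E.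
Proof.
elim: n A => [|n ih] A mA /=.
  by rewrite big_ord0 diracE mem_set// => -[].
rewrite big_ord_recl -ih; last by move=> i; exact: mA.
have mB : measurable [set x : 'rV[R]_n | forall i, A (lift ord0 i) (x ord0 i)].
  rewrite [X in measurable X](_ : _ = \bigcap_(i in [set: 'I_n])
      ((fun x : 'rV[R]_n => x ord0 i) @^-1` A (lift ord0 i))); last first.
    by apply/seteqP; split => [x /= h i _|x /= h i]; [exact: h|exact: (h i)].
  apply: fin_bigcap_measurable; first exact: finite_finset.
  by move=> i _; rewrite -[X in measurable X]setTI; exact: measurable_coord_rV.
rewrite -product_measure1E//; last exact: mA.
rewrite /lebesgue_rV_step /pushforward.
congr ((_ \x _)%E _); apply/seteqP; split => [[a x] /= h|[a x] /= [h0 h] i].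
  split=> [|i].
    by have := h ord0; rewrite mxE unlift_none.
  by have := h (lift ord0 i); rewrite mxE liftK.
by rewrite mxE; case: unliftP => [j ->|->].
Qed.

End lebesgue_rV.

(* The supremum is taken in [0, +oo], so that it is 0 on the empty set. *)
Definition sup_norm {T : Type} {R : realType} (I : set T) (psi : T -> R)
    : \bar R :=
  ereal_sup (0%E |` [set `|psi x|%:E | x in I]).

Definition closed_neighborhood {R : realType} {d : nat} (eps : R)
    (I : set 'rV[R]_d) : set 'rV[R]_d :=
  [set x | exists2 y, I y & `|x - y| <= eps].

Section kernel.
Context {R : realType} {d : nat}.
Implicit Types (K g : 'rV[R]_d -> R) (cls : set ('rV[R]_d -> R)).

Definition rescaled_kernel K (h : R) (u : 'rV[R]_d) : R :=
  K ((h `^ d%:R^-1)^-1 *: u).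

Definition kernel_class K : set ('rV[R]_d -> R) :=
  [set g | exists h x, 0 < h /\ g = (fun z => rescaled_kernel K h (x - z))].

Definition L2_dist (Q : probability 'rV[R]_d R) g g' : \bar R :=
  'N[Q]_(2%:E)[EFin \o (g \- g')%R]%E.

(* Balls may be centered at any function of L2(Q); a measurable center at
   finite distance from a bounded function is in L2(Q). *)
Definition covered_by_balls (Q : probability 'rV[R]_d R) cls (delta : R)
    (k : nat) : Prop :=
  exists2 c : 'I_k -> 'rV[R]_d -> R,
    (forall i, measurable_fun setT (c i)) &
    forall g, cls g -> exists i, (L2_dist Q g (c i) < delta%:E)%E.

(* +oo when no finite number of balls covers the class *)
Definition covering_number (Q : probability 'rV[R]_d R) cls (delta : R)
    : \bar R :=
  ereal_inf [set k%:R%:E | k in covered_by_balls Q cls delta].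

Definition uniform_covering_number cls (delta : R) : \bar R :=
  ereal_sup [set covering_number Q cls delta | Q in setT].

Definition polynomial_uniform_entropy K : Prop :=
  exists C nu : R, [/\ 0 < C, 0 < nu & forall eps, 0 < eps < 1 ->
    (uniform_covering_number (kernel_class K) (fine (sup_norm setT K) * eps)
       <= (C * eps `^ (- nu))%:E)%E].

Definition pointwise_measurable_class cls : Prop :=
  exists cls0, [/\ cls0 `<=` cls, countable cls0 &
    forall g, cls g -> exists2 g_ : nat -> 'rV[R]_d -> R,
      (forall m, cls0 (g_ m)) &
      forall z, g_ m z @[m --> \oo] --> g z].

(* The sample is indexed from 1. *)
Definition nadaraya_watson K (Y : nat -> R) (X : nat -> 'rV[R]_d)
    (n : nat) (h : R) (x : 'rV[R]_d) : R :=
  (\sum_(1 <= i < n.+1) Y i * rescaled_kernel K h (x - X i)) /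
  (\sum_(1 <= i < n.+1) rescaled_kernel K h (x - X i)).

End kernel.

Section iid.
Context {disp disp'} {Omega : measurableType disp} {T : measurableType disp'}
  {R : realType} (P : probability Omega R).

Definition mutually_independent (Z : nat -> {RV P >-> T}) : Prop :=
  forall (s : seq nat) (A : nat -> set T), uniq s ->
    (forall i, measurable (A i)) ->
    P (\big[setI/setT]_(i <- s) (Z i @^-1` A i)) =
    (\prod_(i <- s) P (Z i @^-1` A i))%E.

Definition identically_distributed (Z : nat -> {RV P >-> T}) : Prop :=
  forall i (A : set T), measurable A ->
    distribution P (Z i) A = distribution P (Z 0%N) A.

Definition iid (Z : nat -> {RV P >-> T}) : Prop :=
  mutually_independent Z /\ identically_distributed Z.

Definition has_density (mu : {measure set T -> \bar R}) (Z : {RV P >-> T})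
    (p : T -> R) : Prop :=
  [/\ measurable_fun setT p, forall z, 0 <= p z &
    forall A, measurable A ->
      distribution P Z A = (\int[mu]_(z in A) (p z)%:E)%E].

End iid.

Section conditional.
Context {R : realType} {d : nat}.
Variable p : measurableTypeR R * 'rV[R]_d -> R.

(* This is the real-valued integral, which is 0 where the integral is +oo: a
   positive value entails integrability. *)
Definition marginal_density (x : 'rV[R]_d) : R :=
  \int[lebesgue_measure]_y p (y, x).

Definition conditional_density (x : 'rV[R]_d) (y : R) : R :=
  p (y, x) / marginal_density x.

(* E(phi(Y) | X = x), computed with the conditional density of Y given X = x.
   The version matters: it is evaluated pointwise on sets that may be
   Lebesgue negligible. *)
Definition conditional_expectation (phi : R -> R) (x : 'rV[R]_d) : \bar R :=
  (\int[lebesgue_measure]_y (phi y * conditional_density x y)%:E)%E.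

Definition regression (x : 'rV[R]_d) : R :=
  fine (conditional_expectation id x).

Definition regression_exists : Prop :=
  {ae lebesgue_rV R d, forall x, 0 < marginal_density x ->
    (@lebesgue_measure R).-integrable setT
      (fun y => (y * conditional_density x y)%:E)}.

End conditional.

(* Main.v *)
Require Import Defs.
From HB Require Import structures.
From mathcomp Require Import all_boot all_order all_algebra.
From mathcomp Require Import all_classical all_reals all_analysis.
From mathcomp Require Import ring lra measurable_realfun.
Set Implicit Arguments.
Unset Strict Implicit.
Unset Printing Implicit Defensive.
Import Order.TTheory GRing.Theory Num.Theory.
Import numFieldTopology.Exports numFieldNormedType.Exports.
Local Open Scope classical_set_scope.
Local Open Scope ring_scope.

(** The estimator is the ratio of sum_i Y_i K_h(x - X_i) and sum_i K_h(x - X_i),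
where K_h(u) = K(u / h^(1/d)). Divided by n h, these two sums are shown to be
uniformly close, over h and over x in I, to r(x) = int y p(y, x) dy and to the
marginal density f(x). As f is bounded away from 0 on the compact set I, the
ratio is uniformly close to r / f = m ([uniform_consistency]).

The responses are first truncated, Y = Y 1{|Y| <= tau} + Y 1{|Y| > tau}. For a
bounded function phi of the response, [uniform_law] says that
(n h)^-1 sum_i phi(Y_i) K_h(x - X_i) is close to int phi(y) p(y, x) dy.

- The bias is handled by Scheffe's lemma: pointwise convergence of the sections
  p(., z) together with continuity of f makes z |-> p(., z) continuous in L1
  ([scheffe]), uniformly on I ([L1_uniform_continuity]), and the kernel only
  looks at a ball of radius h^(1/d) around x ([local_expectation_bias]).

- The deviation from the mean ([uniform_deviation]) needs only a fixed relative
  accuracy eps, and this is why a single covering suffices, without chaining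
  and without concentration inequalities for suprema. The bandwidths are cut
  into n blocks, on each of which h is comparable to a level eta. There the
  functions g = K_h(x - .) satisfy E g(X)^2 <= c1 eta, and almost surely
  sum_i g(X_i)^2 <= c2 n eta: the latter sum is at most the number of sample
  points near x, up to a constant, which is controlled by a union bound over a
  grid of mesh 1/n ([local_sums_bound]). Under these two constraints
  [class_deviation] compares the sample with an independent copy, exchanges
  the two coordinate by coordinate, and, the sample being fixed, replaces the
  class by the centers of a covering for the empirical measure, of radius
  proportional to eta. The entropy condition bounds their number by a power of
  n, while a fixed center deviates with probability at most exp(-c n eta). As
  n a_n / ln n -> oo the total is eventually below n^-2, and the Borel-Cantelli
  lemma concludes. The pointwise measurability of the class replaces it by a
  sequence.

It remains to control the part Y 1{|Y| > tau}, in mean and almost surely.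

- When |Y| <= M on J, this part vanishes almost surely for tau = M. That the
  conditional law at every single point of I lives on [-M, M], and not only at
  almost every point, follows from L1-continuity ([excess_mass_eq0]).

- When the conditional moments of order q are at most S, the conditional mean
  of |Y| 1{|Y| > tau} is at most S / tau ([tail_moment]). Moreover
  |Y_i| <= n^(1/q) eventually, for all i <= n with X_i near I
  ([sample_growth]), so that the sums of |Y_i| 1{tau < |Y_i| <= n^(1/q)} over
  the sample points near x are bounded by [local_sums_bound] again
  ([truncated_tail_sums]). That bound asks for n a_n / n^(1/q) to grow faster
  than ln n, and a_n = c (ln n / n)^(1 - 2/q) gives it the order
  n^(1/q) (ln n)^(1 - 2/q) ([moment_bandwidth_growth]). *)

(** * Independence of disjoint blocks of an i.i.d. sequence *)

Section independent_pair.
Context d0 d1 d2 {Omega : measurableType d0} {T1 : measurableType d1}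
  {T2 : measurableType d2} {R : realType} (P : probability Omega R).
Implicit Types (U : {RV P >-> T1}) (V : {RV P >-> T2}).
Local Open Scope ereal_scope.

Definition independent_pair U V := forall A B, measurable A -> measurable B ->
  P (U @^-1` A `&` V @^-1` B) = P (U @^-1` A) * P (V @^-1` B).

Lemma preimage_RV_measurable d (T : measurableType d) (U : {RV P >-> T}) A :
  measurable A -> measurable (U @^-1` A).
Proof. by move=> mA; rewrite -[X in measurable X]setTI; exact: measurable_funP. Qed.

(** Both sides are finite measures in the event of U with the same total mass,
so they agree as soon as they agree on a generating pi-system. *)
Lemma independent_event_pi d (T : measurableType d) (U : {RV P >-> T})
    (G : set (set T)) (E : set Omega) :
  measurable = <<s G >> -> setI_closed G -> G setT -> measurable E ->
  (forall A, G A -> P (U @^-1` A `&` E) = P (U @^-1` A) * P E) ->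
  forall A, measurable A -> P (U @^-1` A `&` E) = P (U @^-1` A) * P E.
Proof.
move=> mG GI GT mE GE A mA.
have PE0 : (0 <= fine (P E))%R by exact: fine_ge0.
pose m1_ : {measure set T -> \bar R} := pushforward (mrestr P mE) U.
have mU : measurable_fun setT U by exact: measurable_funP.
pose m1 := m1_ mU.
pose m2 : {measure set T -> \bar R} := mscale (NngNum PE0) (distribution P U).
have PEfin : P E = (fine (P E))%:E by rewrite fineK// fin_num_measure.
have m2E B : m2 B = P (U @^-1` B) * P E.
  by rewrite /m2/= /mscale /= /pushforward -PEfin muleC.
rewrite -m2E -[LHS]/(m1 A).
apply: (measure_unique G (fun=> setT)) => //.
- by rewrite bigcup_const.
- by move=> B GB; rewrite m2E; exact: GE.
- move=> _; rewrite /m1/= /pushforward /= /mrestr preimage_setT setTI.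
  exact: le_lt_trans (probability_le1 _ mE) (ltry _).
Qed.

Lemma independent_pair_pi U V (G1 : set (set T1)) (G2 : set (set T2)) :
  measurable = <<s G1 >> -> setI_closed G1 -> G1 setT ->
  measurable = <<s G2 >> -> setI_closed G2 -> G2 setT ->
  (forall A B, G1 A -> G2 B ->
    P (U @^-1` A `&` V @^-1` B) = P (U @^-1` A) * P (V @^-1` B)) ->
  independent_pair U V.
Proof.
move=> mG1 GI1 GT1 mG2 GI2 GT2 GE A B mA mB.
apply: (independent_event_pi mG1) => //; first exact: preimage_RV_measurable.
move=> {mA}A GA; rewrite setIC muleC.
have mA : measurable A by rewrite mG1; exact: sub_sigma_algebra.
apply: (independent_event_pi mG2) => //; first exact: preimage_RV_measurable.
by move=> {mB}B GB; rewrite setIC muleC; exact: GE.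
Qed.

(** Independence means that the law of the pair is the product of the laws;
Tonelli's theorem does the rest. *)
Lemma independent_pair_expectation U V (f : T1 -> R) (g : T2 -> R) :
  independent_pair U V ->
  measurable_fun setT f -> measurable_fun setT g ->
  (forall x, (0 <= f x)%R) -> (forall x, (0 <= g x)%R) ->
  \int[P]_w (f (U w) * g (V w))%:E =
    (\int[P]_w (f (U w))%:E) * (\int[P]_w (g (V w))%:E).
Proof.
move=> UV mf mg f0 g0.
have mUV : measurable_fun setT (fun w => (U w, V w)).
  by apply: measurable_fun_pair; exact: measurable_funP.
pose W : {RV P >-> (T1 * T2)%type} := HB.pack (fun w => (U w, V w))
  (isMeasurableFun.Build _ _ _ _ _ mUV).
pose F (p : T1 * T2) := (f p.1 * g p.2)%:E.
have mF : measurable_fun setT F.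
  by apply/measurable_EFinP; apply: measurable_funM;
    exact: measurableT_comp.
have F0 p : 0 <= F p by rewrite lee_fin mulr_ge0.
transitivity (\int[distribution P W]_p F p).
  by rewrite ge0_integral_distribution.
pose m1 := distribution P U; pose m2 := distribution P V.
rewrite (eq_measure_integral (m1 \x m2)); last first.
  by move=> A mA _; apply/esym/(@product_measure_unique _ _ _ _ _ m1 m2).
rewrite fubini_tonelli1//= /fubini_F/= /F/=.
have mf' : measurable_fun setT (EFin \o f) by exact/measurable_EFinP.
have mg' : measurable_fun setT (EFin \o g) by exact/measurable_EFinP.
have f0' x : 0 <= (EFin \o f) x by rewrite lee_fin.
have g0' x : 0 <= (EFin \o g) x by rewrite lee_fin.
transitivity (\int[m1]_x ((EFin \o f) x * \int[m2]_y (EFin \o g) y)).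
  apply: eq_integral => x _; rewrite -(ge0_integralZl _ _ mg' (fun y _ => g0' y) (f0' x))//.
rewrite (ge0_integralZr _ _ mf' (fun y _ => f0' y))//; last exact: integral_ge0.
by rewrite !ge0_integral_distribution.
Qed.

End independent_pair.

Section iid_sample.
Context d0 d {Omega : measurableType d0} {T : measurableType d} {R : realType}
  (P : probability Omega R).
Variable Z : nat -> {RV P >-> T}.
Hypothesis iidZ : iid Z.
Local Open Scope ereal_scope.

Definition sample n (s : n.-tuple nat) (w : Omega) : n.-tuple T :=
  [tuple Z (tnth s i) w | i < n].

Lemma measurable_sample n (s : n.-tuple nat) : measurable_fun setT (sample s).
Proof.
apply/measurable_fun_tnthP => i; rewrite (_ : _ \o _ = Z (tnth s i)).
  exact: measurable_funP.
by apply/funext => w /=; rewrite tnth_mktuple.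
Qed.

HB.instance Definition _ n (s : n.-tuple nat) :=
  isMeasurableFun.Build _ _ _ _ (sample s) (measurable_sample s).

(** The pi-system on which the law of a finite sample is given by the product
rule. *)
Definition boxes n : set (set (n.-tuple T)) :=
  [set [set t : n.-tuple T | forall i, A i (tnth t i)] |
    A in [set A : 'I_n -> set T | forall i, measurable (A i)]].

Lemma measurable_box n : @boxes n `<=` measurable.
Proof.
move=> _ [A /= mA <-].
rewrite (_ : [set t | _] = \bigcap_(i in [set: 'I_n]) ((fun t => tnth t i) @^-1` A i)).
  apply: fin_bigcap_measurable; first exact: finite_finset.
  by move=> i _; rewrite -[X in measurable X]setTI; exact: measurable_tnth.
by apply/seteqP; split => [t /= h i _|t /= h i]; [exact: h|exact: (h i)].
Qed.

Lemma boxes_generate n : @measurable _ (n.-tuple T) = <<s @boxes n >>.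
Proof.
apply/seteqP; split; last first.
  apply: smallest_sub; first exact: sigma_algebra_measurable.
  exact: measurable_box.
rewrite /measurable /=; apply: smallest_sub; first exact: smallest_sigma_algebra.
move=> B; rewrite -bigcup_seq => -[i _ [C mC <-]]; apply: sub_sigma_algebra.
exists (fun j => if j == i then C else setT) => /=.
  by move=> j; case: ifP.
apply/seteqP; split => [t /= /(_ i)|t [_ Ct] j].
  by rewrite eqxx.
by case: eqP => // ->.
Qed.

Lemma boxes_setI n : setI_closed (@boxes n).
Proof.
move=> _ _ [A mA <-] [B mB <-]; exists (fun i => A i `&` B i) => /=.
  by move=> i; exact: measurableI.
by apply/seteqP; split => [t h|t [hA hB] i]; [split => i; apply h|split].
Qed.

Lemma boxes_setT n : @boxes n setT.
Proof. by exists (fun=> setT) => //; apply/seteqP. Qed.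

Lemma sample_box n (s : n.-tuple nat) (A : 'I_n -> set T) :
  uniq s -> (forall i, measurable (A i)) ->
  P (sample s @^-1` [set t | forall i, A i (tnth t i)]) =
  \prod_(i < n) distribution P (Z 0%N) (A i).
Proof.
move=> us mA; have [indZ idZ] := iidZ.
case: n s A us mA => [|n] s A us mA.
  rewrite big_ord0 (_ : _ @^-1` _ = setT) ?probability_setT//.
  by apply/seteqP; split => // w _ [].
pose B k := A (inord (index k s)).
have BE i : B (tnth s i) = A i.
  rewrite /B (tnth_nth 0%N) index_uniq ?size_tuple//; congr A.
  exact: inord_val.
have mB k : measurable (B k) by exact: mA.
have -> : sample s @^-1` [set t | forall i, A i (tnth t i)] =
    \big[setI/setT]_(i <- s) (Z i @^-1` B i).
  rewrite -bigcap_seq; apply/seteqP; split => [w /= h k ks|w /= h i].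
    have /tnthP[i ->] := ks.
    by rewrite BE; have := h i; rewrite tnth_mktuple.
  by rewrite tnth_mktuple -BE; apply: h => /=; exact: mem_tnth.
rewrite indZ// big_tuple; apply: eq_bigr => i _.
by rewrite BE; exact: idZ.
Qed.

(** Exchangeability: this is what allows single coordinates of a sample and of
its ghost copy to be swapped. *)
Lemma sample_law n (s s' : n.-tuple nat) (A : set (n.-tuple T)) :
  uniq s -> uniq s' -> measurable A ->
  P (sample s @^-1` A) = P (sample s' @^-1` A).
Proof.
move=> us us' mA.
pose D t : {measure set (n.-tuple T) -> \bar R} := distribution P (sample t).
rewrite -[LHS]/(D s A) -[RHS]/(D s' A).
apply: (measure_unique (@boxes n) (fun=> setT)) => //.
- exact: boxes_generate.
- exact: boxes_setI.
- by move=> _; exact: boxes_setT.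
- by rewrite bigcup_const.
- by move=> _ [B mB <-]; rewrite /D /= /distribution /pushforward !sample_box.
- by move=> _; rewrite /D /= probability_setT ltry.
Qed.

Lemma sample_independent n m (s : n.-tuple nat) (s' : m.-tuple nat) :
  uniq (s ++ s') -> independent_pair (P:=P) (sample s) (sample s').
Proof.
move=> uss'; have := uss'; rewrite cat_uniq => /and3P[us ss' us'].
apply: independent_pair_pi.
- exact: boxes_generate.
- exact: boxes_setI.
- exact: boxes_setT.
- exact: boxes_generate.
- exact: boxes_setI.
- exact: boxes_setT.
move=> _ _ [A mA <-] [B mB <-].
rewrite !sample_box//.
pose C (k : 'I_(n + m)) := match fintype.split k with inl i => A i | inr j => B j end.
have mC k : measurable (C k) by rewrite /C; case: fintype.split.
have := @sample_box _ [tuple of s ++ s'] C uss' mC.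
rewrite big_split_ord/=.
under eq_bigr do rewrite /C (unsplitK (inl _)).
under [X in _ * X]eq_bigr do rewrite /C (unsplitK (inr _)).
move=> <-; congr (P _); apply/seteqP; split => [w [/= h1 h2] k|w /= h].
  rewrite tnth_mktuple /C; case: (split_ordP k) => i ->.
    by rewrite tnth_lshift; have := h1 i; rewrite tnth_mktuple.
  by rewrite tnth_rshift; have := h2 i; rewrite tnth_mktuple.
split => i /=.
  have := h (lshift m i).
  by rewrite !tnth_mktuple tnth_lshift /C (unsplitK (inl _)).
have := h (rshift n i).
by rewrite !tnth_mktuple tnth_rshift /C (unsplitK (inr _)).
Qed.

Lemma expectation_prod_iid (f : T -> R) (s : seq nat) :
  uniq s -> measurable_fun setT f -> (forall x, (0 <= f x)%R) ->
  \int[P]_w (\prod_(i <- s) f (Z i w))%:E =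
  \prod_(i <- s) \int[P]_w (f (Z 0%N w))%:E.
Proof.
move=> + mf f0; have mEf : measurable_fun setT (EFin \o f) by exact/measurable_EFinP.
have idf i : \int[P]_w (f (Z i w))%:E = \int[P]_w (f (Z 0%N w))%:E.
  have /= <- := ge0_integral_distribution (Z i) mEf.
    have /= <- := ge0_integral_distribution (Z 0%N) mEf.
      by apply: eq_measure_integral => A mA _; have [_] := iidZ; exact.
    by move=> y; rewrite lee_fin.
  by move=> y; rewrite lee_fin.
elim: s => [_|i s ih uis].
  rewrite big_nil; under eq_integral do rewrite big_nil.
  by rewrite integral_cst// mul1e; exact: probability_setT.
rewrite big_cons -ih; last by case/andP: uis.
rewrite -(idf i).
pose F (t : 1.-tuple T) := f (thead t).
pose G (t : (size s).-tuple T) := (\prod_(j < size s) f (tnth t j))%R.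
have mF : measurable_fun setT F.
  by apply: (measurableT_comp mf); exact: measurable_tnth.
have mG : measurable_fun setT G.
  by apply: measurable_prod => j _; apply: (measurableT_comp mf); exact: measurable_tnth.
have uis' : uniq ([tuple i] ++ in_tuple s) by [].
have F0 t : (0 <= F t)%R by exact: f0.
have G0 t : (0 <= G t)%R by apply: prodr_ge0 => j _; exact: f0.
have FE w : F (sample [tuple i] w) = f (Z i w) by rewrite /F /thead tnth_mktuple.
have GE w : G (sample (in_tuple s) w) = (\prod_(j <- s) f (Z j w))%R.
  by rewrite [RHS]big_tnth; apply: eq_bigr => j _; rewrite tnth_mktuple.
have := independent_pair_expectation (sample_independent uis') mF mG F0 G0.
under eq_integral do rewrite FE GE -(big_cons _ _ i s xpredT).
under [X in _ = X * _]eq_integral do rewrite FE.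
by under [X in _ = _ * X]eq_integral do rewrite GE.
Qed.

End iid_sample.

(** * Exponential tail bounds *)

Section exponential_inequalities.
Context {R : realType}.
Implicit Types x : R.

(** From exp(-x) >= 1 - x; the constant 2 pays for the range x <= 1/2. *)
Lemma expR_le_quadratic x : x <= 2^-1 -> expR x <= 1 + x + 2 * x ^+ 2.
Proof.
move=> x2; have x1 : 0 < 1 - x by lra.
rewrite -[x in expR x]opprK expRN.
apply: (@le_trans _ _ (1 - x)^-1).
  by rewrite lef_pV2 ?posrE ?expR_gt0// expR_ge1Dx.
rewrite -[leLHS]mul1r ler_pdivrMr//.
have : 0 <= x ^+ 2 * (1 - 2 * x) by apply: mulr_ge0; [exact: sqr_ge0|lra].
nra.
Qed.

(** For |x| <= 1/2 the linear terms of the quadratic bounds cancel; beyond,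
|x| <= 2 x^2. *)
Lemma cosh_le_gaussian x : expR x + expR (- x) <= 2 * expR (2 * x ^+ 2).
Proof.
have h y : 2^-1 < y -> expR y + expR (- y) <= 2 * expR (2 * y ^+ 2).
  move=> y2; have e1 : expR y <= expR (2 * y ^+ 2) by rewrite ler_expR; nra.
  have e2 : expR (- y) <= expR (2 * y ^+ 2) by rewrite ler_expR; nra.
  lra.
have [x2|/h//] := leP x 2^-1.
have [x2'|] := leP (- x) 2^-1; last first.
  by move=> /h; rewrite opprK addrC sqrrN.
have := expR_le_quadratic x2; have := expR_le_quadratic x2'.
by have := expR_ge1Dx (2 * x ^+ 2); rewrite sqrrN; lra.
Qed.

End exponential_inequalities.

Section bounded_on_probability.
Context d {T : measurableType d} {R : realType} (Q : probability T R).

Lemma prob_bounded_integrable (f : T -> R) (B : R) :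
  measurable_fun setT f -> (forall x, `|f x| <= B) ->
  Q.-integrable setT (EFin \o f).
Proof.
move=> mf fB; apply: measurable_bounded_integrable => //.
  exact: le_lt_trans (probability_le1 Q measurableT) (ltry 1).
exists B; split; first exact: num_real.
by move=> M BM x _ /=; rewrite (le_trans (fB x))// ltW.
Qed.

Lemma Rintegral_prob_cst (c : R) : \int[Q]_x c = c.
Proof.
rewrite Rintegral_cst// -[RHS]mulr1; congr (_ * _).
by rewrite -[RHS]/(fine 1%E); congr fine; exact: probability_setT.
Qed.

Lemma EFin_Rintegral_prob (f : T -> R) : Q.-integrable setT (EFin \o f) ->
  (\int[Q]_x (f x)%:E = (\int[Q]_x f x)%:E)%E.
Proof. by move=> fi; rewrite fineK//; exact: integrable_fin_num. Qed.

End bounded_on_probability.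

Section measurable_comparison.
Context d {T : measurableType d} {R : realType} (f g : T -> R).
Hypotheses (mf : measurable_fun setT f) (mg : measurable_fun setT g).

Lemma measurable_set_le : measurable [set x | f x <= g x].
Proof.
rewrite -[X in measurable X]setTI -(preimage_true (fun x => f x <= g x)).
exact: (measurable_fun_ler mf mg).
Qed.

Lemma measurable_set_lt : measurable [set x | f x < g x].
Proof.
rewrite -[X in measurable X]setTI -(preimage_true (fun x => f x < g x)).
exact: (measurable_fun_ltr mf mg).
Qed.

End measurable_comparison.

Section exponential_tails.
Context d0 d {Omega : measurableType d0} {T : measurableType d} {R : realType}
  (P : probability Omega R).
Variable Z : nat -> {RV P >-> T}.
Hypothesis iidZ : iid Z.
Let mu := distribution P (Z 0%N).

Lemma measurable_sum_sample (f : T -> R) (s : seq nat) :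
  measurable_fun setT f -> measurable_fun setT (fun w => \sum_(i <- s) f (Z i w)).
Proof.
by move=> mf; apply: measurable_sum => i; apply: measurableT_comp.
Qed.

(** Markov's inequality for the exponential of the sum. *)
Lemma chernoff_iid (f : T -> R) (s : seq nat) (t M : R) :
  uniq s -> measurable_fun setT f ->
  (\int[mu]_z (expR (f z))%:E <= M%:E)%E ->
  (P [set w | (t <= \sum_(i <- s) f (Z i w))%R] <=
    (expR (- t) * M ^+ size s)%:E)%E.
Proof.
move=> us mf fM.
have mef : measurable_fun setT (fun z => expR (f z)) by exact: measurableT_comp.
have mS := measurable_sum_sample s mf.
set A := [set w | _].
have mA : measurable A.
  exact: measurable_set_le.
have fE : (\int[P]_w (expR (f (Z 0%N w)))%:E = \int[mu]_z (expR (f z))%:E)%E.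
  by rewrite ge0_integral_distribution//; exact/measurable_EFinP.
rewrite -[A]setIT -integral_indic//.
apply: (@le_trans _ _ (\int[P]_w ((expR (- t))%:E * (\prod_(i <- s) expR (f (Z i w)))%:E))%E).
  apply: ge0_le_integral; first exact: measurableT.
  - by move=> w _; rewrite lee_fin.
  - exact/measurable_EFinP.
  - apply/measurable_EFinP; apply: measurable_funM => //.
    by apply: measurable_prod => i _; apply: (measurableT_comp mef).
  - move=> w _; rewrite -expR_sum -EFinM -expRD lee_fin indicE.
    have [|] := boolP (w \in A); last by rewrite expR_ge0.
    rewrite inE /A /= => tS; rewrite -[leLHS]expR0 ler_expR.
    by rewrite addrC subr_ge0.
have mprod : measurable_fun setT (fun w => (\prod_(i <- s) expR (f (Z i w)))%:E).
  by apply/measurable_EFinP; apply: measurable_prod => i _; apply: (measurableT_comp mef).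
have prod0 w : setT w -> (0 <= (\prod_(i <- s) expR (f (Z i w)))%:E)%E.
  by move=> _; rewrite lee_fin prodr_ge0// => *; exact: expR_ge0.
rewrite (ge0_integralZl _ _ mprod prod0)// ?lee_fin ?expR_ge0//.
rewrite EFinM lee_pmul2l ?lte_fin ?expR_gt0//.
rewrite (expectation_prod_iid iidZ us mef); last by move=> *; exact: expR_ge0.
rewrite fE; have I0 : (0 <= \int[mu]_z (expR (f z))%:E)%E.
  by apply: integral_ge0 => z _; rewrite lee_fin expR_ge0.
have -> : (\int[mu]_z (expR (f z))%:E = (fine (\int[mu]_z (expR (f z))%:E))%:E)%E.
  by rewrite fineK// ge0_fin_numE// (le_lt_trans fM)// ltry.
rewrite prodEFin lee_fin big_const_seq count_predT iter_mulr_1 lerXn2r ?nnegrE//.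
- exact: fine_ge0.
- by rewrite -lee_fin (le_trans I0).
- by rewrite -lee_fin fineK// ge0_fin_numE// (le_lt_trans fM)// ltry.
Qed.

(** Chernoff's bound at the scale 1 / (2 B), where exp(t) <= 1 + 2 t for the
values t = psi / (2 B) of [0, 1/2]. It is useful for u larger than twice the
mean n v. *)
Lemma nonneg_sum_upper_tail (psi : T -> R) (s : seq nat) (B v u : R) :
  uniq s -> measurable_fun setT psi -> 0 < B ->
  (forall z, 0 <= psi z <= B) -> \int[mu]_z psi z <= v ->
  (P [set w | (u <= \sum_(i <- s) psi (Z i w))%R] <=
    (expR ((size s)%:R * v / B - u / (2 * B)))%:E)%E.
Proof.
move=> us mpsi B0 psiB psiv.
pose f z := psi z / (2 * B).
have mf : measurable_fun setT f by apply: measurable_funM.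
have f01 z : 0 <= f z <= 2^-1.
  have /andP[? ?] := psiB z; rewrite /f divr_ge0 ?mulr_ge0 ?(ltW B0)//=.
  by rewrite ler_pdivrMr ?mulr_gt0// mulrA mulVf// mul1r.
have ipsi : mu.-integrable setT (EFin \o psi).
  by apply: (@prob_bounded_integrable _ _ _ _ _ B) => // z; have /andP[? ?] := psiB z; rewrite ger0_norm.
have fM : (\int[mu]_z (expR (f z))%:E <= (expR (v / B))%:E)%E.
  apply: (@le_trans _ _ (\int[mu]_z (1 + psi z / B)%:E)%E).
    apply: ge0_le_integral; first exact: measurableT.
    - by move=> z _; rewrite lee_fin expR_ge0.
    - by apply/measurable_EFinP; apply: measurableT_comp.
    - by apply/measurable_EFinP; apply: measurable_funD => //; apply: measurable_funM.
    move=> z _; rewrite lee_fin.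
    have /andP[f0 f1] := f01 z; apply: le_trans (expR_le_quadratic f1) _.
    have -> : psi z / B = 2 * f z by rewrite /f; field; rewrite gt_eqF.
    nra.
  rewrite EFin_Rintegral_prob; last first.
    apply: (@prob_bounded_integrable _ _ _ _ (fun z => 1 + psi z / B) 2).
      by apply: measurable_funD => //; apply: measurable_funM.
    move=> z; have /andP[? ?] := psiB z; rewrite ger0_norm.
      have h : psi z / B <= 1 by rewrite ler_pdivrMr ?mul1r.
      lra.
    by rewrite addr_ge0// divr_ge0 ?(ltW B0).
  rewrite lee_fin.
  apply: le_trans (expR_ge1Dx _).
  rewrite RintegralD//; last 2 first.
  - by apply: (@prob_bounded_integrable _ _ _ _ _ 1) => // z; rewrite normr1.
  - rewrite (_ : _ \o _ = fun z => (psi z)%:E * (B^-1)%:E)%E; last by apply/funext.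
    exact: integrableZr.
  rewrite Rintegral_prob_cst RintegralZr// lerD2l ler_pM2r ?invr_gt0//.
have -> : [set w | u <= \sum_(i <- s) psi (Z i w)] =
    [set w | u / (2 * B) <= \sum_(i <- s) f (Z i w)].
  apply/seteqP; split=> w /=; rewrite -mulr_suml ler_pM2r// invr_gt0 mulr_gt0//.
apply: (le_trans (chernoff_iid _ us mf fM)).
rewrite lee_fin -expRM_natl -expRD ler_expR.
by rewrite addrC mulrA.
Qed.

(** Bernstein's inequality before the choice of lam: centering does not increase
the second moment, and the condition on lam keeps lam (psi - E psi) in
[-1/2, 1/2]. *)
Lemma sum_deviation_upper (psi : T -> R) (s : seq nat) (B v t lam : R) :
  uniq s -> measurable_fun setT psi -> (forall z, `|psi z| <= B) ->
  \int[mu]_z (psi z ^+ 2) <= v -> 0 < lam -> 4 * B * lam <= 1 ->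
  (P [set w | (t <= \sum_(i <- s) psi (Z i w) - (size s)%:R * \int[mu]_z psi z)%R] <=
    (expR (2 * (size s)%:R * lam ^+ 2 * v - lam * t))%:E)%E.
Proof.
move=> us mpsi psiB psiv lam0 Blam.
set e := \int[mu]_z psi z.
have ipsi : mu.-integrable setT (EFin \o psi) by exact: prob_bounded_integrable psiB.
have eB : `|e| <= B.
  apply: le_trans (le_normr_Rintegral _ _) _ => //.
  rewrite -[leRHS](Rintegral_prob_cst mu B); apply: le_Rintegral => //.
  - apply: (@prob_bounded_integrable _ _ _ _ _ B) => [|z]; first exact: measurableT_comp.
    by rewrite normr_id.
  - exact: (@prob_bounded_integrable _ _ _ _ _ `|B|).
pose f z := lam * (psi z - e).
have mf : measurable_fun setT f.
  by apply: measurable_funM => //; apply: measurable_funB.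
have fle z : `|f z| <= 2^-1.
  rewrite normrM gtr0_norm//; have := ler_normB (psi z) e; have := psiB z.
  have := normr_ge0 (psi z - e); nra.
have isq : mu.-integrable setT (EFin \o (fun z => psi z ^+ 2)).
  apply: (@prob_bounded_integrable _ _ _ _ _ (B ^+ 2)) => [|z].
    exact: measurable_funX.
  by rewrite normrX ler_pXn2r ?nnegrE// (le_trans _ (psiB z)).
have fM : (\int[mu]_z (expR (f z))%:E <= (expR (2 * lam ^+ 2 * v))%:E)%E.
  pose g z := (1 - lam * e + 2 * lam ^+ 2 * e ^+ 2) +
    ((lam - 4 * lam ^+ 2 * e) * psi z + 2 * lam ^+ 2 * psi z ^+ 2).
  have mg : measurable_fun setT g.
    by apply: measurable_funD => //; apply: measurable_funD; apply: measurable_funM => //; exact: measurable_funX.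
  have gE z : 1 + f z + 2 * f z ^+ 2 = g z by rewrite /g /f; ring.
  have g0 z : 0 <= g z.
    by rewrite -gE; have /ler_normlP[? ?] := fle z; nra.
  have i1 (c : R) : mu.-integrable setT (EFin \o (fun z => c * psi z)).
    rewrite (_ : _ \o _ = fun z => c%:E * (psi z)%:E)%E; last by apply/funext.
    exact: integrableZl.
  have i2 (c : R) : mu.-integrable setT (EFin \o (fun z => c * psi z ^+ 2)).
    rewrite (_ : _ \o _ = fun z => c%:E * (psi z ^+ 2)%:E)%E; last by apply/funext.
    exact: integrableZl.
  have i3 : mu.-integrable setT (EFin \o (fun z => (lam - 4 * lam ^+ 2 * e) * psi z + 2 * lam ^+ 2 * psi z ^+ 2)).
    rewrite (_ : _ \o _ = fun z => ((lam - 4 * lam ^+ 2 * e) * psi z)%:E + (2 * lam ^+ 2 * psi z ^+ 2)%:E)%E; last by apply/funext.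
    exact: (integrableD measurableT (i1 _) (i2 _)).
  have i4 (c : R) : mu.-integrable setT (EFin \o (fun=> c)).
    exact: (@prob_bounded_integrable _ _ _ _ _ `|c|).
  have ig : mu.-integrable setT (EFin \o g).
    rewrite (_ : _ \o _ = fun z => (1 - lam * e + 2 * lam ^+ 2 * e ^+ 2)%:E + ((lam - 4 * lam ^+ 2 * e) * psi z + 2 * lam ^+ 2 * psi z ^+ 2)%:E)%E; last by apply/funext.
    exact: (integrableD measurableT (i4 _) i3).
  apply: (@le_trans _ _ (\int[mu]_z (g z)%:E)%E).
    apply: ge0_le_integral; first exact: measurableT.
    - by move=> z _; rewrite lee_fin expR_ge0.
    - by apply/measurable_EFinP; apply: measurableT_comp.
    - exact/measurable_EFinP.
    move=> z _; rewrite lee_fin -gE; apply: expR_le_quadratic.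
    by have /ler_normlP[] := fle z.
  rewrite EFin_Rintegral_prob// lee_fin /g.
  rewrite (RintegralD measurableT (i4 _) i3) (RintegralD measurableT (i1 _) (i2 _)).
  rewrite Rintegral_prob_cst (RintegralZl _ measurableT ipsi) (RintegralZl _ measurableT isq) -/e.
  apply: le_trans (expR_ge1Dx _).
  set V := (\int[_]_x (psi x ^+ 2)) in psiv *.
  have h1 : 0 <= lam ^+ 2 * e ^+ 2 by rewrite mulr_ge0 ?sqr_ge0.
  have h2 : 0 <= lam ^+ 2 * (v - V) by rewrite mulr_ge0 ?sqr_ge0// subr_ge0.
  lra.
have -> : [set w | t <= \sum_(i <- s) psi (Z i w) - (size s)%:R * e] =
    [set w | lam * t <= \sum_(i <- s) f (Z i w)].
  apply/seteqP; split=> w /=; rewrite -mulr_sumr ler_pM2l// big_split/= sumrN;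
  by rewrite (_ : \sum_(i <- s) e = (size s)%:R * e)// big_const_seq count_predT iter_addr_0 mulr_natl.
apply: (le_trans (chernoff_iid _ us mf fM)).
rewrite lee_fin -expRM_natl -expRD ler_expR.
by rewrite addrC !mulrA (mulrC _ 2).
Qed.

End exponential_tails.

(** * Symmetrization by a ghost sample and random signs *)

Section rademacher.
Context {R : realType}.

(** By independence of the signs the sum factors into terms 2 cosh(v_i). *)
Lemma sum_expR_signs n (v : 'I_n -> R) :
  \sum_(sg : {ffun 'I_n -> bool}) expR (\sum_i (-1) ^+ sg i * v i) <=
    2 ^+ n * expR (2 * \sum_i v i ^+ 2).
Proof.
under eq_bigr do rewrite expR_sum.
rewrite -(bigA_distr_bigA (fun i (b : bool) => expR ((-1) ^+ b * v i))).
rewrite (_ : 2 ^+ n = \prod_(i < n) 2); last by rewrite prodr_const card_ord.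
rewrite mulr_sumr expR_sum -big_split/=; apply: ler_prod => i _.
rewrite big_bool/= expr1 expr0 mulN1r mul1r addrC cosh_le_gaussian andbT.
by rewrite addr_ge0 ?expR_ge0.
Qed.

(** Hoeffding's inequality for random signs, as a count over all 2^n choices of
signs. *)
Lemma rademacher_tail n (v : 'I_n -> R) (t lam : R) : 0 <= lam ->
  #|[pred sg : {ffun 'I_n -> bool} | t < `|\sum_i (-1) ^+ sg i * v i|]|%:R <=
    2 ^+ n * (2 * expR (2 * lam ^+ 2 * \sum_i v i ^+ 2 - lam * t)).
Proof.
move=> lam0.
pose S (sg : {ffun 'I_n -> bool}) := \sum_i (-1) ^+ sg i * v i.
have sgE (c : R) sg : c * S sg = \sum_i (-1) ^+ sg i * (c * v i).
  by rewrite /S mulr_sumr; apply: eq_bigr => i _; rewrite mulrCA.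
have cE (c : R) : c ^+ 2 = lam ^+ 2 ->
    \sum_sg expR (c * S sg - lam * t) <=
    2 ^+ n * expR (2 * lam ^+ 2 * \sum_i v i ^+ 2 - lam * t).
  move=> c2; under eq_bigr do rewrite expRD sgE.
  rewrite -mulr_suml expRD mulrA ler_pM2r ?expR_gt0//.
  apply: le_trans (sum_expR_signs _) _; rewrite ler_pM2l ?exprn_gt0//.
  rewrite ler_expR -mulrA ler_pM2l// mulr_sumr.
  by apply: ler_sum => i _; rewrite exprMn c2.
have := lerD (cE lam erefl) (cE (- lam) (sqrrN _)).
rewrite -big_split/= -mulrDr -mulr2n -[expR _ *+ 2]mulr_natl.
apply: le_trans; rewrite -sum1_card natr_sum.
rewrite [leLHS]big_mkcond; apply: ler_sum => sg _; rewrite inE.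
have [tS|_] := ifPn; last by rewrite addr_ge0 ?expR_ge0.
have [S0|S0] := leP 0 (S sg).
  rewrite -[leLHS]addr0 lerD ?expR_ge0// -expR0 ler_expR subr_ge0 ler_wpM2l//.
  by rewrite -(ger0_norm S0) ltW.
rewrite -[leLHS]add0r lerD ?expR_ge0// -expR0 ler_expR subr_ge0 mulNr -mulrN ler_wpM2l//.
by rewrite -(ltr0_norm S0) ltW.
Qed.

End rademacher.

Section symmetrization.
Context d0 d {Omega : measurableType d0} {T : measurableType d} {R : realType}
  (P : probability Omega R).
Variable Z : nat -> {RV P >-> T}.
Hypothesis iidZ : iid Z.
Variables (n : nat) (s s' : n.-tuple nat).
Hypothesis uss' : uniq (s ++ s').
Variables (D : set nat) (f q : nat -> T -> R).
Hypotheses (mf : forall k, measurable_fun setT (f k))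
  (mq : forall k, measurable_fun setT (q k)).

Let us : uniq s. Proof. by have := uss'; rewrite cat_uniq => /and3P[]. Qed.
Let us' : uniq s'. Proof. by have := uss'; rewrite cat_uniq => /and3P[]. Qed.

Let measurable_sum_tnth m (g : T -> R) : measurable_fun setT g ->
  measurable_fun setT (fun x : m.-tuple T => \sum_(i < m) g (tnth x i)).
Proof.
move=> mg; apply: measurable_sum => i; apply: (measurableT_comp mg).
exact: measurable_tnth.
Qed.

Let measurable_and (d' : measure_display) (T' : measurableType d') (A : Prop) (B C : set T') :
  measurable B -> measurable C -> measurable [set x | A /\ B x /\ C x].
Proof.
move=> mB mC; have [a|na] := pselect A.
  rewrite (_ : [set _ | _] = B `&` C); first exact: measurableI.
  by apply/seteqP; split => x /=; [case|split].
rewrite (_ : [set _ | _] = set0)//.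
by apply/seteqP; split => x /= => -[].
Qed.

(** If some k deviates on the first sample, the first such k is determined by
that sample alone, so the independent second sample behaves normally for that
k with probability at least 1/2. The two samples then differ by t / 2. The
function q is carried along to keep a bound on the quadratic sums. *)
Lemma ghost_sample (e : nat -> R) (u u' t : R) :
  (forall k, D k -> (2^-1%:E <= P [set w |
     ((\sum_(i <- s') q k (Z i w) <= u') /\
     (`|\sum_(i <- s') f k (Z i w) - n%:R * e k| <= t / 2))%R])%E) ->
  (P [set w | exists k, D k /\ ((\sum_(i <- s) q k (Z i w) <= u) /\
      (t < `|\sum_(i <- s) f k (Z i w) - n%:R * e k|))%R] <=
   2%:E * P [set w | exists k, D k /\
     ((\sum_(i <- s) q k (Z i w) + \sum_(i <- s') q k (Z i w) <= u + u') /\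
     (t / 2 < `|\sum_(i <- s) f k (Z i w) - \sum_(i <- s') f k (Z i w)|))%R])%E.
Proof.
move=> hB.
pose a k : set (n.-tuple T) := [set x | D k /\ (\sum_(i < n) q k (tnth x i) <= u /\
  t < `|\sum_(i < n) f k (tnth x i) - n%:R * e k|)].
pose b k : set (n.-tuple T) := [set x | \sum_(i < n) q k (tnth x i) <= u' /\
  `|\sum_(i < n) f k (tnth x i) - n%:R * e k| <= t / 2].
have sumE (g : T -> R) (r : n.-tuple nat) w :
    \sum_(i < n) g (tnth (sample Z r w) i) = \sum_(i <- r) g (Z i w).
  by rewrite big_tuple; apply: eq_bigr => i _; rewrite tnth_mktuple.
have mdev k : measurable_fun setT (fun x : n.-tuple T =>
    `|\sum_(i < n) f k (tnth x i) - n%:R * e k|).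
  by apply: measurableT_comp => //; apply: measurable_funB => //; exact: measurable_sum_tnth.
have ma k : measurable (a k).
  apply: measurable_and.
    apply: measurable_set_le => //; exact: measurable_sum_tnth.
  exact: measurable_set_lt.
have mb k : measurable (b k).
  apply: measurableI.
    apply: measurable_set_le => //; exact: measurable_sum_tnth.
  exact: measurable_set_le.
(* Splitting according to the first deviating index makes the events disjoint. *)
pose a' := seqDU a.
have ma' k : measurable (a' k).
  by apply: measurableD => //; apply: bigsetU_measurable => j _; exact: ma.
pose X := sample Z s; pose X' := sample Z s'.
have mX (A : set (n.-tuple T)) : measurable A -> measurable (X @^-1` A).
  by move=> mA; rewrite -[S in measurable S]setTI; exact: measurable_sample.
have mX' (A : set (n.-tuple T)) : measurable A -> measurable (X' @^-1` A).
  by move=> mA; rewrite -[S in measurable S]setTI; exact: measurable_sample.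
set A := [set w | _]; set C := [set w | _].
have AE : A = \bigcup_k X @^-1` a' k.
  rewrite -preimage_bigcup -seqDU_bigcup_eq; apply/seteqP; split => w /=.
    by move=> [k h]; exists k => //; rewrite /a /= !sumE.
  by move=> [k _]; rewrite /a /= !sumE => h; exists k.
have mC : measurable C.
  rewrite (_ : C = \bigcup_k [set w | D k /\
     ((\sum_(i <- s) q k (Z i w) + \sum_(i <- s') q k (Z i w) <= u + u') /\
     (t / 2 < `|\sum_(i <- s) f k (Z i w) - \sum_(i <- s') f k (Z i w)|))%R]); last first.
    by apply/seteqP; split => w /= [k]; [exists k|move=> _; exists k].
  apply: bigcupT_measurable => k; apply: measurable_and.
    apply: measurable_set_le => //.
    by apply: measurable_funD; exact: measurable_sum_sample.
  apply: measurable_set_lt => //.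
  apply: measurableT_comp => //.
  by apply: measurable_funB; exact: measurable_sum_sample.
have trivA (F : (set Omega)^nat) : (forall k, F k `<=` X @^-1` a' k) -> trivIset setT F.
  move=> Fa; apply/trivIsetP => i j _ _ ij.
  have /trivIsetP/(_ i j Logic.I Logic.I ij) := @trivIset_seqDU _ a.
  rewrite -!subset0 => h w [/Fa wi /Fa wj]; exact: (h (X w)).
rewrite AE measure_semi_bigcup//; last 3 first.
- by move=> k; exact: mX.
- by apply: (trivA (fun k => X @^-1` a' k)) => k w.
- by apply: bigcupT_measurable => k; exact: mX.
apply: (@le_trans _ _ (\sum_(k <oo) 2%:E * P (X @^-1` a' k `&` X' @^-1` b k))%E).
  apply: lee_nneseries => [k _ _//|k _].
  rewrite (sample_independent iidZ uss')//.
  have [Dk|nDk] := pselect (D k); last first.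
    rewrite (_ : X @^-1` a' k = set0) ?measure0 ?mul0e ?mule0//.
    by apply/seteqP; split => // w [[]].
  rewrite muleCA -[leLHS]mule1 lee_wpmul2l//.
  have -> : X' @^-1` b k = [set w |
     ((\sum_(i <- s') q k (Z i w) <= u') /\
     (`|\sum_(i <- s') f k (Z i w) - n%:R * e k| <= t / 2))%R].
    by apply/seteqP; split => w /=; rewrite /b /= !sumE.
  have h2 : (0 <= 2%:E :> \bar R)%E by rewrite lee_fin.
  apply: le_trans (lee_wpmul2l h2 (hB _ Dk)).
  by rewrite -EFinM mulfV.
rewrite nneseriesZl//; apply: lee_wpmul2l => //.
rewrite -(@measure_semi_bigcup _ _ _ P (fun k => X @^-1` a' k `&` X' @^-1` b k)); last 3 first.
- by move=> k; apply: measurableI; [exact: mX|exact: mX'].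
- by apply: trivA => k w [].
- by apply: bigcupT_measurable => k; apply: measurableI; [exact: mX|exact: mX'].
apply: le_measure; rewrite ?inE//.
  by apply: bigcupT_measurable => k; apply: measurableI; [exact: mX|exact: mX'].
move=> w [k _ [[+ _] +]]; rewrite /a /b /= !sumE => -[Dk [q1 f1]] [q2 f2].
exists k; split => //; split; first exact: lerD.
have := ler_normB (\sum_(i <- s) f k (Z i w) - \sum_(i <- s') f k (Z i w))
  (n%:R * e k - \sum_(i <- s') f k (Z i w)).
rewrite distrC in f2.
rewrite opprB addrA subrK; lra.
Qed.

(** A choice of signs acts on the 2n indices by exchanging i and n + i whenever
the i-th sign is negative. *)
Definition swap_index (sg : {ffun 'I_n -> bool}) (j : 'I_(n + n)) : 'I_(n + n) :=
  match fintype.split j with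
  | inl i => if sg i then rshift n i else lshift n i
  | inr i => if sg i then lshift n i else rshift n i
  end.

Lemma swap_indexK sg : involutive (swap_index sg).
Proof.
move=> j; rewrite {2}/swap_index.
case: (split_ordP j) => i ->; case: ifPn => sgi.
- by rewrite /swap_index (unsplitK (inr _)) sgi.
- by rewrite /swap_index (unsplitK (inl _)) (negbTE sgi).
- by rewrite /swap_index (unsplitK (inl _)) sgi.
- by rewrite /swap_index (unsplitK (inr _)) (negbTE sgi).
Qed.

(** The exchanged double sample has the same law for every choice of signs, so
the probability is the average over the signs, and is bounded by the proportion
of bad signs for any fixed values x, y of the two samples. *)
Lemma sign_swapping (u t beta : R) :
  (forall x y : 'I_n -> T,
    #|[pred sg : {ffun 'I_n -> bool} | `[<exists k, D k /\
       (\sum_i q k (x i) + \sum_i q k (y i) <= u /\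
       t < `|\sum_i (-1) ^+ sg i * (f k (x i) - f k (y i))|)>]]|%:R <=
    2 ^+ n * beta) ->
  (P [set w | exists k, D k /\
     ((\sum_(i <- s) q k (Z i w) + \sum_(i <- s') q k (Z i w) <= u) /\
     (t < `|\sum_(i <- s) f k (Z i w) - \sum_(i <- s') f k (Z i w)|))%R] <=
   beta%:E)%E.
Proof.
move=> hbeta.
pose c : set ((n + n).-tuple T) := [set x | exists k, D k /\
  (\sum_(i < n + n) q k (tnth x i) <= u /\
   t < `|\sum_(i < n) f k (tnth x (lshift n i)) -
         \sum_(i < n) f k (tnth x (rshift n i))|)].
have mc : measurable c.
  rewrite (_ : c = \bigcup_k [set x | D k /\ (\sum_(i < n + n) q k (tnth x i) <= u /\
   t < `|\sum_(i < n) f k (tnth x (lshift n i)) -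
         \sum_(i < n) f k (tnth x (rshift n i))|)]); last first.
    by apply/seteqP; split => w /= [k]; [exists k|move=> _; exists k].
  apply: bigcupT_measurable => k; apply: measurable_and.
    apply: measurable_set_le => //.
    exact: measurable_sum_tnth.
  apply: measurable_set_lt => //.
  apply: measurableT_comp => //.
  by apply: measurable_funB; apply: measurable_sum => i; apply: (measurableT_comp (mf k)); exact: measurable_tnth.
pose r (sg : {ffun 'I_n -> bool}) : (n + n).-tuple nat :=
  [tuple tnth [tuple of s ++ s'] (swap_index sg j) | j < n + n].
have ur sg : uniq (r sg).
  have inj := elimT (tuple_uniqP [tuple of s ++ s']) uss'.
  apply/tuple_uniqP => i j; rewrite !tnth_mktuple => /inj.
  exact: (can_inj (swap_indexK sg)).
have rl sg i w : tnth (sample Z (r sg) w) (lshift n i) =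
    if sg i then Z (tnth s' i) w else Z (tnth s i) w.
  rewrite !tnth_mktuple /swap_index (unsplitK (inl _)).
  by case: ifP => _; rewrite ?tnth_lshift ?tnth_rshift.
have rr sg i w : tnth (sample Z (r sg) w) (rshift n i) =
    if sg i then Z (tnth s i) w else Z (tnth s' i) w.
  rewrite !tnth_mktuple /swap_index (unsplitK (inr _)).
  by case: ifP => _; rewrite ?tnth_lshift ?tnth_rshift.
have cE sg w : c (sample Z (r sg) w) <-> exists k, D k /\
    (\sum_i q k (Z (tnth s i) w) + \sum_i q k (Z (tnth s' i) w) <= u /\
     t < `|\sum_i (-1) ^+ sg i * (f k (Z (tnth s i) w) - f k (Z (tnth s' i) w))|).
  have E k : (\sum_(i < n + n) q k (tnth (sample Z (r sg) w) i) =
      \sum_i q k (Z (tnth s i) w) + \sum_i q k (Z (tnth s' i) w)) /\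
      (\sum_(i < n) f k (tnth (sample Z (r sg) w) (lshift n i)) -
      \sum_(i < n) f k (tnth (sample Z (r sg) w) (rshift n i)) =
      \sum_i (-1) ^+ sg i * (f k (Z (tnth s i) w) - f k (Z (tnth s' i) w))).
    split.
      rewrite big_split_ord/= -[LHS]big_split -[RHS]big_split/=; apply: eq_bigr => i _.
      by rewrite rl rr; case: ifP => _ //=; rewrite addrC.
    rewrite -sumrB; apply: eq_bigr => i _; rewrite rl rr.
    by case: (sg i); rewrite /= ?expr1 ?expr0 ?mulN1r ?mul1r// opprB.
  by split => -[k [Dk h]]; exists k; split => //; have [E1 E2] := E k; move: h; rewrite E1 E2.
set C := [set w | _].
have PE sg : P C = P (sample Z (r sg) @^-1` c).
  rewrite (sample_law iidZ (ur sg) (ur [ffun=> false]))//; congr (P _).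
  apply/seteqP; split => w.
    move=> [k [Dk]]; rewrite !big_tuple => -[h1 h2]; apply/cE; exists k; split => //; split => //.
    by under eq_bigr do rewrite ffunE expr0 mul1r; rewrite sumrB.
  move=> /cE[k [Dk [h1 h2]]]; exists k; rewrite !big_tuple; split => //; split => //.
  by move: h2; under eq_bigr do rewrite ffunE expr0 mul1r; rewrite sumrB.
have mPc sg : measurable (sample Z (r sg) @^-1` c).
  by rewrite -[S in measurable S]setTI; exact: measurable_sample.
have key : ((2 ^+ n)%:E * P C <= (2 ^+ n * beta)%:E)%E.
  have -> : ((2 ^+ n)%:E * P C =
      \int[P]_w (\sum_(sg : {ffun 'I_n -> bool}) (\1_(sample Z (r sg) @^-1` c) w)%:E))%E.
    rewrite ge0_integral_sum//; last first.
      by move=> sg; apply/measurable_EFinP; exact: measurable_indic.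
    rewrite (eq_bigr (fun=> P C)); last first.
      by move=> sg _; rewrite integral_indic// setIT (PE sg).
    have PCfin : P C \is a fin_num.
      by rewrite (PE [ffun=> false]) fin_num_measure.
    rewrite -(fineK PCfin) sumEFin -EFinM sumr_const card_ffun card_bool card_ord.
    by rewrite -[in RHS]mulr_natl natrX.
  apply: (@le_trans _ _ (\int[P]_w (2 ^+ n * beta)%:E)%E); last first.
    rewrite integral_cst// -[leRHS]mule1; apply: lee_wpmul2l.
      rewrite lee_fin; apply: le_trans (hbeta (fun i => point) (fun i => point)).
      exact: ler0n.
    exact: probability_le1.
  apply: ge0_le_integral => //.
  - by move=> w _; apply: sume_ge0 => sg _; rewrite lee_fin.
  - by apply: emeasurable_sum => sg; apply/measurable_EFinP; exact: measurable_indic.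
  move=> w _; rewrite sumEFin lee_fin.
  apply: le_trans (hbeta (fun i => Z (tnth s i) w) (fun i => Z (tnth s' i) w)).
  rewrite -sum1_card natr_sum [leRHS]big_mkcond/=; apply: ler_sum => sg _.
  rewrite inE indicE; case: ifPn => //.
    by move=> _; case: (_ \in _).
  move=> /asboolPn h; rewrite memNset// => /cE h'; exact: h.
by move: key; rewrite EFinM lee_pmul2l// lte_fin exprn_gt0.
Qed.

End symmetrization.

(** * Empirical covering numbers *)

Section empirical_measure.
Context d {T : measurableType d} {R : realType}.
Variables (x : nat -> T) (m : nat).
Let minv_ge0 : 0 <= (m.+1%:R^-1 : R). Proof. by rewrite invr_ge0. Qed.

(** The sample has m + 1 points, so that it is never empty. *)
Definition empirical_measure : set T -> \bar R :=
  mscale (NngNum minv_ge0) (msum (fun i => dirac (x i)) m.+1).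

HB.instance Definition _ := Measure.on empirical_measure.

Let empirical_measure_setT : empirical_measure setT = 1%E.
Proof.
rewrite /empirical_measure /mscale /= /msum.
rewrite (eq_bigr (fun=> 1%E)); last by move=> i _; exact: diracT.
by rewrite sumEFin sumr_const card_ord -EFinM -mulr_natr mul1r mulVf.
Qed.

HB.instance Definition _ := Measure_isProbability.Build _ _ _ empirical_measure
  empirical_measure_setT.

Lemma integral_empirical_measure (f : T -> R) : measurable_fun setT f ->
  (forall z, 0 <= f z) ->
  (\int[empirical_measure]_z (f z)%:E = (m.+1%:R^-1 * \sum_(i < m.+1) f (x i))%:E)%E.
Proof.
move=> mf f0.
have mEf : measurable_fun setT (EFin \o f) by exact/measurable_EFinP.
have f0' z : setT z -> (0 <= (EFin \o f) z)%E by rewrite lee_fin.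
rewrite (ge0_integral_mscale _ measurableT _ mEf f0').
rewrite (ge0_integral_measure_sum _ measurableT f0' mEf).
rewrite (eq_bigr (fun i : 'I_m.+1 => (f (x i))%:E)) ?sumEFin// => i _.
by rewrite (integral_dirac _ measurableT)// diracT mul1e.
Qed.

End empirical_measure.

(** The Cauchy-Schwarz inequality, as 2 r |a_i| <= a_i^2 + r^2. *)
Lemma sum_sqr_le_L1 {R : realType} (m : nat) (a : 'I_m -> R) (r : R) :
  0 <= r -> \sum_i a i ^+ 2 <= m%:R * r ^+ 2 -> \sum_i `|a i| <= m%:R * r.
Proof.
move=> r0 ar.
case: (eqVneq r 0) r0 ar => [->|r_gt0] r0 ar.
  have -> : \sum_i `|a i| = 0; last by rewrite mulr0.
  apply: big1 => i _; apply/eqP; rewrite normr_eq0 -sqrf_eq0; apply/eqP/le_anti.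
  rewrite sqr_ge0 andbT; move: ar; rewrite expr0n mulr0; apply: le_trans.
  by rewrite (bigD1 i)//= lerDl sumr_ge0// => j _; exact: sqr_ge0.
have {r_gt0}r_gt0 : 0 < r by rewrite lt_neqAle eq_sym r_gt0.
rewrite -(@ler_pM2l _ (2 * r)) ?mulr_gt0//.
apply: (@le_trans _ _ (\sum_i (a i ^+ 2 + r ^+ 2))).
  rewrite mulr_sumr; apply: ler_sum => i _.
  have := sqr_ge0 (`|a i| - r); rewrite -[a i ^+ 2]real_normK ?num_real//; nra.
rewrite big_split/= sumr_const card_ord -mulr_natl; nra.
Qed.

Section covering.
Context {R : realType} {d : nat}.
Variable cls : set ('rV[R]_d -> R).
Hypothesis mcls : forall g, cls g -> measurable_fun setT g.

(** The uniform covering number bounds the one for the empirical measure of the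
points; N + 1 leaves the room needed to extract an actual covering from the
infimum that defines the latter. *)
Lemma empirical_covering (m : nat) (x : nat -> 'rV[R]_d) (r N : R) :
  (0 < m)%N -> 0 < r -> (uniform_covering_number cls r <= N%:E)%E ->
  exists k : nat, k%:R <= N + 1 /\
  exists c : 'I_k -> 'rV[R]_d -> R, forall g, cls g ->
    exists i, \sum_(j < m) (g (x j) - c i (x j)) ^+ 2 <= m%:R * r ^+ 2.
Proof.
move=> m0 r0 covN.
case: m m0 => // m _.
pose Q : probability 'rV[R]_d R := empirical_measure x m.
have : (covering_number Q cls r < (N + 1)%:E)%E.
  apply: (@le_lt_trans _ _ N%:E); last by rewrite lte_fin ltrDl.
  by apply: le_trans covN; apply: ereal_sup_ubound; exists Q.
move=> /ereal_inf_lt[_ [k [c mc covc] <-]]; rewrite lte_fin => kN.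
exists k; split; first exact: ltW.
exists c => g cg; have [i gci] := covc g cg; exists i.
pose h z := (g z - c i z) ^+ 2.
have mh : measurable_fun setT h.
  by apply: measurable_funX; apply: measurable_funB; [exact: mcls|exact: mc].
have h0 z : 0 <= h z by exact: sqr_ge0.
move: gci; rewrite /L2_dist unlock.
rewrite (_ : (\int[Q]_z _)%E = (\int[Q]_z (h z)%:E)%E); last first.
  apply: eq_integral => z _ /=.
  by rewrite powR_mulrn// real_normK ?num_real.
rewrite integral_empirical_measure//= lte_fin powR12_sqrt; last first.
  by rewrite mulr_ge0 ?invr_ge0// sumr_ge0.
move=> hr; rewrite -ler_pdivrMl ?ltr0n//.
rewrite -(@ler_sqrt _ _ (r ^+ 2)) ?exprn_ge0 ?ltW//.
by rewrite sqrtr_sqr ger0_norm ?ltW.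
Qed.

(** Each ball of the covering that meets E is recentered at one of its members,
so that the constraint E holds at the representatives; this costs the factor 2
in the radius. *)
Lemma empirical_representatives (g : nat -> 'rV[R]_d -> R) (E : set nat)
    (m : nat) (x : nat -> 'rV[R]_d) (r N : R) :
  (0 < m)%N -> 0 < r -> (uniform_covering_number cls r <= N%:E)%E ->
  (forall k, cls (g k)) ->
  exists K : nat, K%:R <= N + 1 /\ exists F : 'I_K -> nat,
    forall k, E k -> exists i, E (F i) /\
      \sum_(j < m) `|g k (x j) - g (F i) (x j)| <= m%:R * (2 * r).
Proof.
move=> m0 r0 covN gcls.
have [K [KN [c hc]]] := empirical_covering x m0 r0 covN.
exists K; split => //.
pose near i k := E k /\ \sum_(j < m) (g k (x j) - c i (x j)) ^+ 2 <= m%:R * r ^+ 2.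
have hF i : exists l, forall k, near i k -> near i l.
  have [[l nl]|no] := pselect (exists l, near i l); first by exists l.
  by exists 0%N => k nk; exfalso; apply: no; exists k.
have [F FP] := choice hF; exists F => k Ek.
have [i ki] := hc _ (gcls k); have [EF hFi] := FP i k (conj Ek ki).
exists i; split => //; apply: sum_sqr_le_L1; first by rewrite mulr_ge0// ltW.
apply: (@le_trans _ _ (\sum_(j < m) (2 * (g k (x j) - c i (x j)) ^+ 2 +
    2 * (g (F i) (x j) - c i (x j)) ^+ 2))).
  apply: ler_sum => j _.
  have := sqr_ge0 ((g k (x j) - c i (x j)) + (g (F i) (x j) - c i (x j))).
  nra.
rewrite big_split/= -!mulr_sumr; nra.
Qed.

End covering.

(** * Deviations over a class of functions *)

Section class_deviation.
Context d0 {Omega : measurableType d0} {R : realType} {d : nat}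
  (P : probability Omega R).
Let T := (measurableTypeR R * 'rV[R]_d)%type.
Variable Z : nat -> {RV P >-> T}.
Hypothesis iidZ : iid Z.
Let mu := distribution P (Z 0%N).
Variables (phi : R -> R) (Phi kappa : R) (cls : set ('rV[R]_d -> R))
  (g : nat -> 'rV[R]_d -> R).
Hypotheses (mphi : measurable_fun setT phi) (Phi_gt0 : 0 < Phi)
  (phi_le : forall y, `|phi y| <= Phi) (kappa_gt0 : 0 < kappa)
  (mcls : forall h, cls h -> measurable_fun setT h)
  (gcls : forall k, cls (g k)) (g_le : forall k x, `|g k x| <= kappa).

Let f k (z : T) : R := phi z.1 * g k z.2.
Let q k (z : T) : R := g k z.2 ^+ 2.

Let mf k : measurable_fun setT (f k).
Proof.
apply: measurable_funM; first exact: (measurableT_comp mphi).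
by apply: measurableT_comp => //; exact: mcls.
Qed.

Let mq k : measurable_fun setT (q k).
Proof.
by apply: measurable_funX; apply: measurableT_comp => //; exact: mcls.
Qed.

Let f_le k z : `|f k z| <= Phi * kappa.
Proof. by rewrite normrM ler_pM. Qed.

Let q_le k z : 0 <= q k z <= kappa ^+ 2.
Proof.
rewrite sqr_ge0 /q /=; have /ler_normlP[] := g_le k z.2; nra.
Qed.

Let f_sqr_le k z : f k z ^+ 2 <= Phi ^+ 2 * q k z.
Proof.
rewrite exprMn ler_wpM2r ?sqr_ge0//.
by have /ler_normlP[] := phi_le z.1; nra.
Qed.

Let iq k : mu.-integrable setT (EFin \o q k).
Proof.
apply: (@prob_bounded_integrable _ _ _ _ _ (kappa ^+ 2)) => // z.
by have /andP[q0 q1] := q_le k z; rewrite ger0_norm.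
Qed.

(** With the double sample fixed, each k satisfying the constraint is replaced by
one of at most N + 1 representatives satisfying it, at the price of half of t.
For each of these the bound on the quadratic sums is the variance proxy in
Hoeffding's inequality. *)
Lemma signed_sums_bound (n : nat) (D : set nat) (U t lam N r : R)
    (x y : 'I_n.+1 -> T) :
  0 < r -> 0 < lam -> (uniform_covering_number cls r <= N%:E)%E ->
  Phi * ((n.+1 + n.+1)%:R * (2 * r)) <= t / 2 ->
  #|[pred sg : {ffun 'I_n.+1 -> bool} | `[<exists k, D k /\
       (\sum_i q k (x i) + \sum_i q k (y i) <= U /\
       t < `|\sum_i (-1) ^+ sg i * (f k (x i) - f k (y i))|)>]]|%:R <=
    2 ^+ n.+1 * ((N + 1) * (2 * expR (4 * lam ^+ 2 * Phi ^+ 2 * U - lam * (t / 2)))).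
Proof.
move=> r0 lam0 covN rt.
(* the points of both samples, in one sequence *)
pose pts (j : nat) : 'rV[R]_d := if (j < n.+1)%N then (x (inord j)).2
  else (y (inord (j - n.+1))).2.
have ptsl i : pts (lshift n.+1 i) = (x i).2 by rewrite /pts /= ltn_ord inord_val.
have ptsr i : pts (rshift n.+1 i) = (y i).2.
  by rewrite /pts /= ltnNge leq_addr/= addKn inord_val.
pose E k := D k /\ \sum_i q k (x i) + \sum_i q k (y i) <= U.
have nn0 : (0 < n.+1 + n.+1)%N by [].
have [K [KN [F FP]]] := empirical_representatives mcls E pts nn0 r0 covN gcls.
pose V k (sg : {ffun 'I_n.+1 -> bool}) := \sum_i (-1) ^+ sg i * (f k (x i) - f k (y i)).
pose B i := [pred sg : {ffun 'I_n.+1 -> bool} | `[< E (F i) >] && (t / 2 < `|V (F i) sg|)].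
set beta := 2 * expR _.
have Bcard i : #|B i|%:R <= 2 ^+ n.+1 * beta.
  have [EF|nEF] := asboolP (E (F i)); last first.
    rewrite (eq_card0 (A := B i)); last by move=> sg; rewrite inE /= asboolF.
    by rewrite mulr_ge0 ?exprn_ge0// mulr_ge0 ?expR_ge0.
  have -> : #|B i| = #|[pred sg : {ffun 'I_n.+1 -> bool} | t / 2 < `|V (F i) sg|]|.
    by apply: eq_card => sg; rewrite !inE /= asboolT.
  apply: (le_trans (rademacher_tail (fun j => f (F i) (x j) - f (F i) (y j)) (t / 2) (ltW lam0))).
  rewrite ler_pM2l ?exprn_gt0// ler_pM2l// ler_expR lerD2r.
  have -> : 4 * lam ^+ 2 * Phi ^+ 2 * U = 2 * lam ^+ 2 * (2 * Phi ^+ 2 * U) by ring.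
  apply: ler_wpM2l; first by rewrite mulr_ge0 ?sqr_ge0.
  apply: (@le_trans _ _ (2 * Phi ^+ 2 * (\sum_j q (F i) (x j) + \sum_j q (F i) (y j)))); last first.
    by apply: ler_wpM2l; [rewrite mulr_ge0 ?sqr_ge0|case: EF].
  rewrite -big_split mulr_sumr; apply: ler_sum => j _ /=.
  have := f_sqr_le (F i) (x j); have := f_sqr_le (F i) (y j).
  have := sqr_ge0 (f (F i) (x j) + f (F i) (y j)); nra.
apply: (@le_trans _ _ (\sum_(i < K) #|B i|%:R)); last first.
  apply: (le_trans (ler_sum _ (fun i _ => Bcard i))).
  rewrite sumr_const card_ord -[leLHS]mulr_natl mulrCA.
  apply: ler_wpM2l; first by rewrite exprn_ge0.
  by apply: ler_wpM2r => //; rewrite mulr_ge0 ?expR_ge0.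
rewrite -natr_sum ler_nat -sum1_card.
under [leqRHS]eq_bigr do rewrite -sum1_card big_mkcond/=.
rewrite exchange_big big_mkcond/=; apply: leq_sum => sg _.
rewrite inE; case: ifPn => // /asboolP[k [Dk [qU tV]]].
have [i [EF hi]] := FP k (conj Dk qU).
rewrite (bigD1 i)//= inE /= asboolT//= ifT//.
have : `|V k sg| <= `|V (F i) sg| + t / 2; last by rewrite -/(V k sg) in tV; lra.
rewrite -lerBlDl; apply: le_trans (lerB_dist _ _) _.
rewrite /V -sumrB; apply: le_trans (ler_norm_sum _ _ _) _.
apply: le_trans rt; apply: le_trans (ler_wpM2l (ltW Phi_gt0) hi).
rewrite big_split_ord/= -big_split mulr_sumr/=; apply: ler_sum => j _.
rewrite ptsl ptsr -mulrBr normrM normr_sign mul1r.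
have fdiff z : `|f k z - f (F i) z| <= Phi * `|g k z.2 - g (F i) z.2|.
  by rewrite /f -mulrBr normrM ler_wpM2r.
have -> : f k (x j) - f k (y j) - (f (F i) (x j) - f (F i) (y j)) =
  (f k (x j) - f (F i) (x j)) - (f k (y j) - f (F i) (y j)) by ring.
by apply: le_trans (ler_normB _ _) _; rewrite mulrDr lerD.
Qed.

(** Symmetrization with a bound on both the variance and the quadratic sums. The
ghost sample violates its constraints with probability at most
1/4 + 1/8 + 1/8 = 1/2, which is what the conditions 2 kappa^2 <= n eta c1 and
12 <= n eta lam eps ensure; its quadratic sum is allowed to reach four times the
mean bound. *)
Lemma class_deviation (n : nat) (eta c1 c2 eps lam N : R) :
  let s := iota 1 n.+1 in
  let e k := \int[mu]_z f k z in
  0 <= N -> 0 < eta -> 0 < c1 -> 0 < c2 -> 0 < eps -> 0 < lam ->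
  4 * (Phi * kappa) * lam <= 1 ->
  lam * (32 * Phi ^+ 2 * (c2 + 4 * c1)) <= eps ->
  (uniform_covering_number cls (eps * eta / (16 * Phi)) <= N%:E)%E ->
  2 * kappa ^+ 2 <= n.+1%:R * eta * c1 -> 12 <= n.+1%:R * eta * lam * eps ->
  (P [set w | exists k, (\int[mu]_z q k z <= c1 * eta)%R /\
     ((\sum_(i <- s) q k (Z i w) <= c2 * (n.+1%:R * eta)) /\
     (eps * (n.+1%:R * eta) < `|\sum_(i <- s) f k (Z i w) - n.+1%:R * e k|))%R] <=
   (4 * (N + 1) * expR (- (lam * eps / 8) * (n.+1%:R * eta)))%:E)%E.
Proof.
move=> s e N0 eta0 c10 c20 eps0 lam0 lamB lamE covN hn1 hn2.
set D := [set k | \int[mu]_z q k z <= c1 * eta].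
set w := n.+1%:R * eta in hn1 hn2 *.
have w0 : 0 < w by rewrite mulr_gt0.
pose s1 : n.+1.-tuple nat := [tuple of iota 1 n.+1].
pose s2 : n.+1.-tuple nat := [tuple of iota n.+2 n.+1].
have uss : uniq (s1 ++ s2).
  by have := iota_uniq 1 (n.+1 + n.+1); rewrite iotaD add1n.
have us2 : uniq s2 by exact: iota_uniq.
(* exp(1) >= 2 is enough for these two numerical bounds *)
have exp2 : expR (- 2) <= (4^-1 : R).
  rewrite expRN lef_pV2 ?posrE ?expR_gt0//.
  rewrite -[X in expR X]mulr1 expRM_natl.
  have := expR_ge1Dx (1 : R); nra.
have exp3 : expR (- 3) <= (8^-1 : R).
  rewrite expRN lef_pV2 ?posrE ?expR_gt0//.
  rewrite -[X in expR X]mulr1 expRM_natl.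
  have := expR_ge1Dx (1 : R) => h; rewrite exprS expr2; nra.
apply: (@le_trans _ _ (2%:E * P [set w0 | exists k, D k /\
     ((\sum_(i <- s1) q k (Z i w0) + \sum_(i <- s2) q k (Z i w0) <= c2 * w + 4 * c1 * w) /\
     (eps * w / 2 < `|\sum_(i <- s1) f k (Z i w0) - \sum_(i <- s2) f k (Z i w0)|))%R])%E).
  apply: (ghost_sample iidZ uss mf mq) => k Dk.
  pose A1 := [set w0 | 4 * c1 * w <= \sum_(i <- s2) q k (Z i w0)].
  pose A2 := [set w0 | eps * w / 2 <= \sum_(i <- s2) f k (Z i w0) - (size s2)%:R * e k].
  pose f' z := - f k z.
  pose A3 := [set w0 | eps * w / 2 <= \sum_(i <- s2) f' (Z i w0) - (size s2)%:R * \int[mu]_z f' z].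
  have mf' : measurable_fun setT f' by exact: measurable_funN.
  have mA1 : measurable A1 by apply: measurable_set_le => //; exact: measurable_sum_sample.
  have mA2 : measurable A2.
    by apply: measurable_set_le => //; apply: measurable_funB => //; exact: measurable_sum_sample.
  have mA3 : measurable A3.
    by apply: measurable_set_le => //; apply: measurable_funB => //; exact: measurable_sum_sample.
  have PA1 : (P A1 <= (4^-1)%:E)%E.
    have := nonneg_sum_upper_tail iidZ (4 * c1 * w) us2 (mq k) (exprn_gt0 2 kappa_gt0) (q_le k) Dk.
    move=> /le_trans; apply; rewrite lee_fin; apply: le_trans exp2; rewrite ler_expR.
    rewrite size_tuple.
    have -> : n.+1%:R * (c1 * eta) / kappa ^+ 2 - 4 * c1 * w / (2 * kappa ^+ 2) =
      - ((w * c1) / kappa ^+ 2) by rewrite /w; field; rewrite gt_eqF.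
    by rewrite lerN2 ler_pdivlMr ?exprn_gt0.
  have sqD : \int[mu]_z (f k z ^+ 2) <= Phi ^+ 2 * (c1 * eta).
    apply: (@le_trans _ _ (\int[mu]_z (Phi ^+ 2 * q k z))).
      apply: le_Rintegral => //.
      - apply: (@prob_bounded_integrable _ _ _ _ _ ((Phi * kappa) ^+ 2)) => [|z].
          exact: measurable_funX.
        by rewrite normrX lerXn2r ?nnegrE// (le_trans _ (f_le k z)).
      - rewrite (_ : _ \o _ = fun z => (Phi ^+ 2)%:E * (q k z)%:E)%E; last by apply/funext.
        by apply: integrableZl => //; exact: iq.
    by rewrite RintegralZl// ler_wpM2l ?sqr_ge0.
  have expD : expR (2 * (size s2)%:R * lam ^+ 2 * (Phi ^+ 2 * (c1 * eta)) - lam * (eps * w / 2)) <= 8^-1.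
    apply: le_trans exp3; rewrite ler_expR size_tuple.
    have -> : 2 * n.+1%:R * lam ^+ 2 * (Phi ^+ 2 * (c1 * eta)) - lam * (eps * w / 2) =
      lam * w * (lam * (2 * Phi ^+ 2 * c1) - eps / 2) by rewrite /w; field.
    have h1 : lam * (2 * Phi ^+ 2 * c1) <= eps / 4.
      have : 0 <= lam * Phi ^+ 2 * c2 by rewrite !mulr_ge0 ?sqr_ge0 ?ltW.
      have : 0 <= lam * Phi ^+ 2 * c1 by rewrite !mulr_ge0 ?sqr_ge0 ?ltW.
      lra.
    have lw : 0 < lam * w by rewrite mulr_gt0.
    nra.
  have PA2 : (P A2 <= (8^-1)%:E)%E.
    apply: le_trans (sum_deviation_upper iidZ (eps * w / 2) us2 (mf k) (f_le k) sqD lam0 lamB) _.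
    by rewrite lee_fin.
  have f'_le z : `|f' z| <= Phi * kappa by rewrite /f' normrN.
  have sqD' : \int[mu]_z (f' z ^+ 2) <= Phi ^+ 2 * (c1 * eta).
    by under eq_Rintegral do rewrite /f' sqrrN.
  have PA3 : (P A3 <= (8^-1)%:E)%E.
    apply: le_trans (sum_deviation_upper iidZ (eps * w / 2) us2 mf' f'_le sqD' lam0 lamB) _.
    by rewrite lee_fin.
  have PA : (P (A1 `|` A2 `|` A3) <= (2^-1)%:E)%E.
    apply: (le_trans (measureU2 _ _ _)) => //; first exact: measurableU.
    apply: (@le_trans _ _ ((4^-1)%:E + (8^-1)%:E + (8^-1)%:E)%E).
      apply: leeD => //; apply: (le_trans (measureU2 _ _ _)) => //; exact: leeD.
    by rewrite -!EFinD lee_fin; lra.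
  have mA : measurable (A1 `|` A2 `|` A3) by apply: measurableU => //; exact: measurableU.
  apply: (@le_trans _ _ (P (~` (A1 `|` A2 `|` A3)))).
    rewrite probability_setC//.
    have PAfin : P (A1 `|` A2 `|` A3) \is a fin_num by rewrite fin_num_measure.
    by move: PA; rewrite -(fineK PAfin) -EFinB !lee_fin; lra.
  apply: le_measure; rewrite ?inE//.
    exact: measurableC.
    apply: measurableI; first by apply: measurable_set_le => //; exact: measurable_sum_sample.
    apply: measurable_set_le => //; apply: measurableT_comp => //.
    by apply: measurable_funB => //; exact: measurable_sum_sample.
  move=> w1 /= /not_orP[/not_orP[/negP + /negP +] /negP +].
  rewrite /A1 /A2 /A3 /= -!ltNge size_tuple sumrN.
  have -> : \int[mu]_z f' z = - e k.
    rewrite /f' /e -mulN1r -RintegralZl//.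
      by apply: eq_Rintegral => z _; rewrite mulN1r.
    exact: prob_bounded_integrable (f_le k).
  move=> h1 h2 h3; split; first exact: ltW.
  by rewrite ler_norml; apply/andP; split; lra.
have -> : 4 * (N + 1) * expR (- (lam * eps / 8) * w) =
  2 * ((N + 1) * (2 * expR (- (lam * eps / 8) * w))) by ring.
rewrite [leRHS]EFinM; apply: lee_wpmul2l; first by rewrite lee_fin.
apply: (@sign_swapping _ _ _ _ _ P Z iidZ n.+1 s1 s2 uss D f q mf mq) => x y.
have r0 : 0 < eps * eta / (16 * Phi) by rewrite divr_gt0 ?mulr_gt0.
apply: (le_trans (@signed_sums_bound n D (c2 * w + 4 * c1 * w) (eps * w / 2) lam N _ x y r0 lam0 covN _)).
  have -> : Phi * ((n.+1 + n.+1)%:R * (2 * (eps * eta / (16 * Phi)))) = eps * w / 2 / 2.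
    by rewrite natrD /w; field; rewrite gt_eqF.
  exact: lexx.
rewrite ler_pM2l ?exprn_gt0//.
have N1 : 0 <= N + 1 by rewrite addr_ge0.
apply: ler_wpM2l => //; rewrite ler_pM2l// ler_expR.
have lw : 0 < lam * w by rewrite mulr_gt0.
have -> : 4 * lam ^+ 2 * Phi ^+ 2 * (c2 * w + 4 * c1 * w) - lam * (eps * w / 2 / 2) =
  lam * w * (lam * (4 * Phi ^+ 2 * (c2 + 4 * c1)) - eps / 4) by field.
have h : lam * (4 * Phi ^+ 2 * (c2 + 4 * c1)) <= eps / 8 by lra.
nra.
Qed.

End class_deviation.

(** * Lebesgue measure on row vectors *)

Section row_vector_norm.
Context {R : realType} {d : nat}.
Implicit Types x : 'rV[R]_d.

Lemma norm_rV_leP x (r : R) : 0 <= r ->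
  reflect (forall i, `|x ord0 i| <= r) (`|x| <= r).
Proof.
move=> r0; have -> : `|x| = mx_norm x by [].
rewrite mx_normrE.
apply: (iffP idP) => [/bigmax_leP[_ h] i|h]; first exact: (h (ord0, i)).
by apply/bigmax_leP; split => // -[i j] _; rewrite ord1; exact: h.
Qed.

Lemma coord_norm_le x i : `|x ord0 i| <= `|x|.
Proof. by apply: (norm_rV_leP _ (normr_ge0 x)). Qed.

Lemma closed_ball_measurable_rV (c : 'rV[R]_d) r :
  measurable [set z : 'rV[R]_d | `|c - z| <= r].
Proof.
have [r0|r0] := leP 0 r; last first.
  rewrite (_ : [set _ | _] = set0)//; apply/seteqP; split => // z /= h.
  by have := le_lt_trans (le_trans (normr_ge0 _) h) r0; rewrite ltxx.
rewrite (_ : [set _ | _] = \bigcap_(i in [set: 'I_d]) [set z : 'rV[R]_d | `|c ord0 i - z ord0 i| <= r]).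
  apply: fin_bigcap_measurable; first exact: finite_finset.
  move=> i _; apply: measurable_set_le => //.
  apply: measurableT_comp => //; apply: measurable_funB => //.
  exact: measurable_coord_rV.
apply/seteqP; split => z /=.
  by move=> /(norm_rV_leP _ r0) h i _; have := h i; rewrite !mxE.
by move=> h; apply/(norm_rV_leP _ r0) => i; have := h i Logic.I; rewrite !mxE.
Qed.

Lemma lebesgue_rV_ball (c : 'rV[R]_d) r : 0 <= r ->
  (lebesgue_rV R d [set z | (`|c - z| <= r)%R] = ((2 * r) ^+ d)%:E)%E.
Proof.
move=> r0.
pose A i : set R := `[c ord0 i - r, c ord0 i + r]%classic.
rewrite (_ : [set _ | _] = [set z : 'rV[R]_d | forall i, A i (z ord0 i)]).
  rewrite lebesgue_rV_box => [|i]; last exact: measurable_itv.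
  rewrite (eq_bigr (fun=> (2 * r)%:E)) => [|i _].
    by rewrite prodEFin prodr_const card_ord.
  rewrite lebesgue_measure_itv /= lte_fin.
  case: ltP => h; rewrite -?EFinD; congr EFin; lra.
apply/seteqP; split => z /=.
  move=> /(norm_rV_leP _ r0) h i; have := h i; rewrite !mxE /A /= in_itv/=.
  by rewrite ler_distlC.
move=> h; apply/(norm_rV_leP _ r0) => i; have := h i; rewrite !mxE /A /= in_itv/=.
by rewrite ler_distlC.
Qed.

Lemma measurable_affine_rV (x : 'rV[R]_d) (a : R) :
  measurable_fun setT (fun z : 'rV[R]_d => a *: (x - z)).
Proof.
apply: measurable_fun_rVP => i; under eq_fun do rewrite !mxE.
apply: measurable_funM => //; apply: measurable_funB => //.
exact: measurable_coord_rV.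
Qed.

End row_vector_norm.

Section change_of_variables.
Context {R : realType}.
Local Open Scope ereal_scope.

(** By uniqueness of Lebesgue measure: its image by t |-> (a - t) / s, divided by
s, gives the right length to intervals. *)
Lemma lebesgue_integral_affine (F : measurableTypeR R -> \bar R) (a s : R) :
  (0 < s)%R -> measurable_fun setT F -> (forall t, 0 <= F t) ->
  \int[lebesgue_measure]_t F (s^-1 * (a - t))%R =
    s%:E * \int[lebesgue_measure]_t F t.
Proof.
move=> s0 mF F0.
pose phi (t : measurableTypeR R) : measurableTypeR R := (s^-1 * (a - t))%R.
have mphi : measurable_fun setT phi.
  by apply: measurable_funM => //; apply: measurable_funB.
have sV0 : (0 <= s^-1)%R by rewrite invr_ge0 ltW.
pose m1_ : {measure set (measurableTypeR R) -> \bar R} :=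
  pushforward (@lebesgue_measure R) phi.
pose m1 := m1_ mphi.
pose m : {measure set (measurableTypeR R) -> \bar R} := mscale (NngNum sV0) m1.
have lebE A : measurable A -> lebesgue_measure A = m A.
  apply: lebesgue_measure_unique => _ [[u v] _ <-].
  rewrite /m /= /mscale /= /pushforward /=.
  rewrite (_ : phi @^-1` _ = `[(a - s * v)%R, (a - s * u)%R[%classic); last first.
    apply/seteqP; split => t /=; rewrite !in_itv/= /phi.
      by rewrite ltr_pdivlMl// ler_pdivrMl// => /andP[? ?]; apply/andP; split; lra.
    by rewrite ltr_pdivlMl// ler_pdivrMl// => /andP[? ?]; apply/andP; split; lra.
  rewrite !lebesgue_measure_itv/= !lte_fin.
  rewrite ltrD2l ltrN2 ltr_pM2l//; case: ifP => _; last by rewrite mule0.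
  rewrite -!EFinD -EFinM; congr EFin; field; exact: lt0r_neq0.
rewrite [X in _ = s%:E * X](eq_measure_integral m); last by move=> A mA _; exact: lebE.
rewrite ge0_integral_mscale// /m1 /m1_ /=.
rewrite ge0_integral_pushforward//= preimage_setT muleA -EFinM divff ?mul1e//.
exact: lt0r_neq0.
Qed.

Lemma integral_lebesgue_rV_cons n (F : 'rV[R]_n.+1 -> \bar R) :
  measurable_fun setT F -> (forall x, 0 <= F x) ->
  \int[lebesgue_rV R n.+1]_x F x =
  \int[lebesgue_measure]_a \int[lebesgue_rV R n]_z F (cons_rV (a, z)).
Proof.
move=> mF F0.
pose m_ : {measure set 'rV[R]_n.+1 -> \bar R} :=
  pushforward (@lebesgue_measure R \x lebesgue_rV R n) (@cons_rV R n).
pose m := m_ (@measurable_cons_rV R n).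
rewrite (eq_measure_integral m)//.
rewrite /m /m_ ge0_integral_pushforward//= ?preimage_setT; last exact: measurable_cons_rV.
rewrite fubini_tonelli1//.
by apply: measurableT_comp => //; exact: measurable_cons_rV.
Qed.

(** By induction on the dimension, one coordinate at a time with Tonelli's
theorem. *)
Lemma lebesgue_rV_affine n (F : 'rV[R]_n -> \bar R) (x : 'rV[R]_n) (s : R) :
  (0 < s)%R -> measurable_fun setT F -> (forall t, 0 <= F t) ->
  \int[lebesgue_rV R n]_z F (s^-1 *: (x - z))%R =
    (s ^+ n)%:E * \int[lebesgue_rV R n]_z F z.
Proof.
move=> s0; elim: n F x => [|n ih] F x mF F0.
  rewrite expr0 mul1e; apply: eq_integral => z _; congr F.
  by apply/rowP => -[].
have mFx : measurable_fun setT (fun z : 'rV[R]_n.+1 => F (s^-1 *: (x - z))%R).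
  by apply: (measurableT_comp mF); exact: measurable_affine_rV.
rewrite !integral_lebesgue_rV_cons//.
have -> : x = cons_rV (uncons_rV x) by rewrite uncons_rVK.
case: (uncons_rV x) => x0 x' {mFx}.
have consE a z : (s^-1 *: (cons_rV (x0, x') - cons_rV (a, z)) =
    cons_rV ((s^-1 * (x0 - a)) : measurableTypeR R, s^-1 *: (x' - z)))%R.
  by apply/rowP => i; rewrite !mxE; case: unliftP => [j _|_] /=; rewrite ?mxE.
under eq_integral do under eq_integral do rewrite consE.
have mFc : measurable_fun setT (fun p => F (cons_rV p)).
  by apply: (measurableT_comp mF); exact: measurable_cons_rV.
under eq_integral.
  move=> a _; rewrite (ih (fun z => F (cons_rV ((s^-1 * (x0 - a))%R, z)))); [over| |].
    by apply: (measurableT_comp mFc); exact: measurable_pair1.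
  by move=> t.
have mG := measurable_fun_fubini_tonelli_F (m2 := lebesgue_rV R n) _ mFc (fun p => F0 _).
have G0 a : 0 <= \int[lebesgue_rV R n]_z F (cons_rV (a, z)) by exact: integral_ge0.
rewrite ge0_integralZl//; last 2 first.
- apply: (measurableT_comp mG).
  by apply: measurable_funM => //; apply: measurable_funB.
- by rewrite lee_fin exprn_ge0// ltW.
rewrite (lebesgue_integral_affine x0 s0 mG)//.
by rewrite muleA -EFinM -exprSr.
Qed.

End change_of_variables.

(** * Integration against a density and L1-continuity of its sections *)

Section density_ge0_integral.
Context d {T : measurableType d} {R : realType} (nu : probability T R)
  (M : {sigma_finite_measure set T -> \bar R}) (p : T -> R).
Hypotheses (mp : measurable_fun setT p) (p0 : forall z, 0 <= p z)
  (nuE : forall A, measurable A -> nu A = (\int[M]_(z in A) (p z)%:E)%E).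

Let mEp : measurable_fun setT (EFin \o p). Proof. exact/measurable_EFinP. Qed.

Lemma density_integrable : M.-integrable setT (EFin \o p).
Proof.
apply/integrableP; split => //.
under eq_integral do rewrite /= ger0_norm//.
by rewrite -nuE//; exact: le_lt_trans (probability_le1 _ measurableT) (ltry 1).
Qed.

(** nu is absolutely continuous with respect to M and p coincides almost
everywhere with its Radon-Nikodym derivative, for which the change of measure
holds. *)
Lemma density_ge0_integral (F : T -> \bar R) :
  measurable_fun setT F -> (forall z, 0 <= F z)%E ->
  (\int[nu]_z F z = \int[M]_z (F z * (p z)%:E))%E.
Proof.
move=> mF F0.
have numu : nu `<< M.
  apply/null_content_dominatesP => A mA A0; rewrite nuE//.
  by apply: null_set_integral => //; exact: measurable_funS mEp.
rewrite -(Radon_Nikodym_SigmaFinite.change_of_variables numu F0 measurableT mF).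
have if_ := Radon_Nikodym_SigmaFinite.f_integrable numu.
have mf_ := measurable_int _ if_.
apply: ae_eq_integral => //.
- exact: emeasurable_funM.
- exact: emeasurable_funM.
apply: ae_eqe_mul2l.
apply: integral_ae_eq => // E _ mE.
by rewrite -Radon_Nikodym_SigmaFinite.f_integral//; exact: nuE.
Qed.

Lemma density_integral (F : T -> R) : measurable_fun setT F ->
  (\int[nu]_z (F z)%:E = \int[M]_z (F z * p z)%:E)%E.
Proof.
move=> mF; have mEF : measurable_fun setT (EFin \o F) by exact/measurable_EFinP.
rewrite integralE [RHS]integralE; congr (_ - _)%E.
  rewrite density_ge0_integral//; last exact: measurable_funepos.
  apply: eq_integral => z _; rewrite !funeposE -EFin_max -EFinM -EFin_max.
  by rewrite maxr_pMl// mul0r.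
rewrite density_ge0_integral//; last exact: measurable_funeneg.
apply: eq_integral => z _; rewrite !funenegE -!EFinN -!EFin_max -EFinM.
by rewrite maxr_pMl// mul0r mulNr.
Qed.

End density_ge0_integral.

(** The product is carried to Lebesgue measure on R^(d+1) by the bijection
[cons_rV], so it is sigma-finite because the latter is. *)
Lemma sigma_finite_lebesgue_prod (R : realType) (d : nat) :
  sigma_finite setT (@lebesgue_measure R \x lebesgue_rV R d)%E.
Proof.
have [F FT Ffin] := sigma_finiteT (lebesgue_rV R d.+1).
exists (fun k => @cons_rV R d @^-1` F k).
  by rewrite -preimage_bigcup -FT preimage_setT.
move=> k; have [mF Fk] := Ffin k; split => //.
by rewrite -[X in measurable X]setTI; exact: measurable_cons_rV.
Qed.

Definition lebesgue_prod (R : realType) (d : nat) :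
    {sigma_finite_measure set (measurableTypeR R * 'rV[R]_d)%type -> \bar R} :=
  HB.pack (@lebesgue_measure R \x lebesgue_rV R d)%E
    (Measure_isSigmaFinite.Build _ _ _ _ (sigma_finite_lebesgue_prod R d)).

Section density.
Context {R : realType} {d : nat}.
Let T := (measurableTypeR R * 'rV[R]_d)%type.
Variables (nu : probability T R) (p : T -> R).
Local Notation leb := (@lebesgue_measure R).
Local Notation lebd := (lebesgue_rV R d).
Hypotheses (mp : measurable_fun setT p) (p0 : forall z, 0 <= p z)
  (nuE : forall A, measurable A ->
    nu A = (\int[(leb \x lebd)%E]_(z in A) (p z)%:E)%E).

Lemma density_product_integral (psi : R -> R) (G : 'rV[R]_d -> R) :
  measurable_fun setT psi -> measurable_fun setT G ->
  (forall y, 0 <= psi y) -> (forall x, 0 <= G x) ->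
  (\int[nu]_z (psi z.1 * G z.2)%:E =
   \int[lebd]_x ((G x)%:E * \int[leb]_y (psi y * p (y, x))%:E))%E.
Proof.
move=> mpsi mG psi0 G0.
have mF : measurable_fun setT (fun z : T => psi z.1 * G z.2).
  by apply: measurable_funM; [exact: (measurableT_comp mpsi)|exact: (measurableT_comp mG)].
rewrite (density_integral (M := lebesgue_prod R d) mp)//.
have mFp : measurable_fun setT (fun z : T => (psi z.1 * G z.2 * p z)%:E).
  by apply/measurable_EFinP; apply: measurable_funM.
rewrite fubini_tonelli2//; last by move=> z; rewrite lee_fin !mulr_ge0.
apply: eq_integral => x _; rewrite /fubini_G /=.
have mpx : measurable_fun setT (fun y => (psi y * p (y, x))%:E).
  by apply/measurable_EFinP; apply: measurable_funM => //; exact: (measurableT_comp mp).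
rewrite -ge0_integralZl//; last 2 first.
- by move=> y _; rewrite lee_fin mulr_ge0.
- by rewrite lee_fin.
by apply: eq_integral => y _; rewrite -EFinM mulrCA mulrA.
Qed.

(** The marginal density is 0 where the section has an infinite integral. *)
Lemma section_integrable x : 0 < marginal_density p x ->
  leb.-integrable setT (fun y => (p (y, x))%:E).
Proof.
move=> fx; apply/integrableP; split.
  by apply/measurable_EFinP; exact: (measurableT_comp mp).
under eq_integral do rewrite /= ger0_norm//.
move: fx; rewrite /marginal_density /Rintegral.
by rewrite ltey; apply: contraTneq => ->/=; rewrite ltxx.
Qed.

Lemma bounded_section_integrable (phi : R -> R) (Phi : R) x :
  measurable_fun setT phi -> (forall y, `|phi y| <= Phi) ->
  0 < marginal_density p x ->
  leb.-integrable setT (fun y => (phi y * p (y, x))%:E).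
Proof.
move=> mphi phiP fx; have ip := section_integrable fx.
have iPp : leb.-integrable setT (fun y => Phi%:E * (p (y, x))%:E)%E.
  exact: integrableZl.
apply: (le_integrable _ _ _ iPp) => //.
  by apply/measurable_EFinP; apply: measurable_funM => //; exact: (measurableT_comp mp).
move=> y _ /=; rewrite lee_fin !normrM ler_wpM2r//.
by apply: (le_trans (phiP y)); exact: ler_norm.
Qed.

Section L1_continuity.
Variables (S : set 'rV[R]_d) (x : 'rV[R]_d).
Hypotheses (Sx : S x) (f_cont : {within S, continuous (marginal_density p)})
  (f_pos : forall z, S z -> 0 < marginal_density p z)
  (p_cont : {ae leb, forall y, p (y, z') @[z' --> x] --> p (y, x)}).

(** Scheffe's lemma: the positive part of p(., x) - p(., z) is dominated by
p(., x), hence tends to 0 in L1, and the negative part follows because the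
difference of the two integrals is f(x) - f(z). The neighborhood statement is
reduced to sequences, for which dominated convergence applies. *)
Lemma scheffe (eta : R) : 0 < eta ->
  \forall z \near x, S z -> \int[leb]_y `|p (y, z) - p (y, x)| <= eta.
Proof.
move=> eta0; apply: contrapT => nP.
have hz (k : nat) : exists z, [/\ S z, `|x - z| < k.+1%:R^-1 &
    eta < \int[leb]_y `|p (y, z) - p (y, x)|].
  apply: contrapT => h; apply: nP.
  apply/nbhs_normP; exists k.+1%:R^-1 => /=; first by rewrite invr_gt0.
  move=> z /= xz Sz; rewrite leNgt; apply/negP => lt; apply: h.
  by exists z; split.
have [z hz'] := choice hz.
have Sz k : S (z k) by have [] := hz' k.
have zx : z k @[k --> \oo] --> x.
  apply/cvgrPdist_lt => e e0; near=> k.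
  have [_ h _] := hz' k; apply: (lt_trans h).
  near: k; exact: (near_infty_natSinv_lt (PosNum e0)).
have fz : marginal_density p (z k) @[k --> \oo] --> marginal_density p x.
  have /(_ x) cf := f_cont.
  apply: (cvg_trans _ cf) => A; rewrite /nbhs/= /nbhs/= -(nbhs_subspace_in Sx).
  by move=> /(zx _) h; exact: (filterS (fun k hk => hk (Sz k)) h).
have ipk k := section_integrable (f_pos (Sz k)).
have ip := section_integrable (f_pos Sx).
(* |u - v| = u - v + 2 max(v - u, 0) with u = p(y, z k) and v = p(y, x) *)
pose g k y := Num.max (p (y, x) - p (y, z k)) 0.
have mpx t : measurable_fun setT (fun y : measurableTypeR R => p (y, t)).
  exact: (measurableT_comp mp).
have mg k : measurable_fun setT (g k : measurableTypeR R -> R).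
  by apply: measurable_maxr => //; apply: measurable_funB.
have g0 k y : 0 <= g k y by rewrite /g le_max lexx orbT.
have gp k y : g k y <= p (y, x).
  by rewrite /g ge_max p0 andbT lerBlDr lerDl.
have ig k : leb.-integrable setT (EFin \o g k).
  apply: (le_integrable _ _ _ ip) => //; first exact/measurable_EFinP.
  by move=> y _ /=; rewrite lee_fin !ger0_norm.
have [_ _ gcvg] : [/\ leb.-integrable setT (cst 0%E),
    (\int[leb]_y (`|(g k y)%:E - cst 0 y|)%E)%E @[k --> \oo] --> 0%E &
    (\int[leb]_y (g k y)%:E)%E @[k --> \oo] --> (\int[leb]_y cst 0%E y)%E].
  apply: (@dominated_convergence _ _ _ leb setT measurableT
    (fun k y => (g k y)%:E) (cst 0%E) (fun y => (p (y, x))%:E)) => //.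
  - by move=> k; exact/measurable_EFinP.
  - apply: filterS p_cont => y py _.
    apply: cvg_EFin; first exact: nearW.
    apply/cvgr0Pnorm_lt => e e0.
    have /cvgrPdist_lt/(_ _ e0) : p (y, z k) @[k --> \oo] --> p (y, x) by exact: (@cvg_comp _ _ _ z (fun z' => p (y, z')) _ _ _ zx py).
    apply: filterS => k /=; apply: le_lt_trans; rewrite ger0_norm//.
    by rewrite /g ge_max ler_norm normr_ge0.
  - by apply: aeW => y k _ /=; rewrite lee_fin ger0_norm.
have idk k : \int[leb]_y `|p (y, z k) - p (y, x)| =
    marginal_density p (z k) - marginal_density p x + 2 * \int[leb]_y g k y.
  rewrite /marginal_density -(RintegralB measurableT (ipk k) ip).
  rewrite -(RintegralZl 2 measurableT (ig k)).
  rewrite -(RintegralD measurableT (integrableB measurableT (ipk k) ip)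
    (integrableZl measurableT 2 (ig k))).
  apply: eq_Rintegral => y _; rewrite /g.
  by case: lerP => h; case: (lerP _ 0) => h'; rewrite ?ger0_norm ?ltr0_norm; lra.
have : \int[leb]_y `|p (y, z k) - p (y, x)| @[k --> \oo] --> 0.
  have g_cvg0 : \int[leb]_y g k y @[k --> \oo] --> 0.
    by move: gcvg; rewrite integral0 => /fine_cvg.
  have := cvgD (cvgB fz (cvg_cst (marginal_density p x : R))) (cvgM (cvg_cst (2 : R)) g_cvg0).
  rewrite subrr mulr0 addr0 => h.
  rewrite (_ : (fun k => _) = fun k => marginal_density p (z k) -
    marginal_density p x + 2 * \int[leb]_y g k y); first exact: h.
  by apply/funext => k; exact: idk.
move=> /cvgr0Pnorm_lt /(_ _ eta0) [N _ /(_ N (leqnn N))] /=.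
have [_ _ h] := hz' N; rewrite ltNge; apply/negP/negPn.
by rewrite (le_trans (ltW h))// ler_norm.
Unshelve. all: end_near. Qed.

End L1_continuity.
End density.

(** * Local means of a regression function *)

Section local_regression.
Context {R : realType} {d : nat}.
Let T := (measurableTypeR R * 'rV[R]_d)%type.
Variables (nu : probability T R) (p : T -> R).
Local Notation leb := (@lebesgue_measure R).
Local Notation lebd := (lebesgue_rV R d).
Hypotheses (mp : measurable_fun setT p) (p0 : forall z, 0 <= p z)
  (nuE : forall A, measurable A ->
    nu A = (\int[(leb \x lebd)%E]_(z in A) (p z)%:E)%E).

(** The conditional mean of phi(Y) at x, times the marginal density. *)
Definition weighted_density (phi : R -> R) (x : 'rV[R]_d) : R :=
  \int[leb]_y (phi y * p (y, x)).

Lemma weighted_density_lipschitz (phi : R -> R) (Phi : R) x z :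
  measurable_fun setT phi -> (forall y, `|phi y| <= Phi) ->
  0 < marginal_density p x -> 0 < marginal_density p z ->
  `|weighted_density phi z - weighted_density phi x| <=
    Phi * \int[leb]_y `|p (y, z) - p (y, x)|.
Proof.
move=> mphi phiP fx fz.
have ix := bounded_section_integrable mp p0 mphi phiP fx.
have iz := bounded_section_integrable mp p0 mphi phiP fz.
have id := integrableB measurableT (section_integrable mp p0 fz) (section_integrable mp p0 fx).
have ia := integrable_abse id.
rewrite /weighted_density -(RintegralB measurableT iz ix).
apply: le_trans (le_normr_Rintegral measurableT (integrableB measurableT iz ix)) _.
rewrite -(RintegralZl Phi measurableT ia); apply: le_Rintegral => //.
- exact: (integrable_abse (integrableB measurableT iz ix)).
- exact: (integrableZl measurableT Phi ia).
- by move=> y _; rewrite -mulrBr normrM ler_wpM2r.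
Qed.

Lemma weighted_density_le (phi : R -> R) (Phi : R) x :
  measurable_fun setT phi -> (forall y, `|phi y| <= Phi) ->
  0 < marginal_density p x ->
  `|weighted_density phi x| <= Phi * marginal_density p x.
Proof.
move=> mphi phiP fx.
have ix := bounded_section_integrable mp p0 mphi phiP fx.
have ip := section_integrable mp p0 fx.
apply: le_trans (le_normr_Rintegral measurableT ix) _.
rewrite /marginal_density -(RintegralZl Phi measurableT ip); apply: le_Rintegral => //.
- exact: (integrable_abse ix).
- exact: (integrableZl measurableT Phi ip).
- by move=> y _; rewrite normrM (ger0_norm (p0 _)) ler_wpM2r.
Qed.

Lemma marginal_weighted x : marginal_density p x = weighted_density (fun=> 1) x.
Proof. by apply: eq_Rintegral => y _; rewrite mul1r. Qed.

Lemma marginal_lipschitz x z :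
  0 < marginal_density p x -> 0 < marginal_density p z ->
  `|marginal_density p z - marginal_density p x| <=
    \int[leb]_y `|p (y, z) - p (y, x)|.
Proof.
move=> fx fz; rewrite -[leRHS]mul1r !marginal_weighted.
by apply: weighted_density_lipschitz => // y; rewrite normr1.
Qed.

Section compact_set.
Variables (I : set 'rV[R]_d) (eps : R).
Hypotheses (cI : compact I) (eps_gt0 : 0 < eps).
Let J := closed_neighborhood eps I.
Hypotheses (f_cont : {within J, continuous (marginal_density p)})
  (f_pos : forall z, J z -> 0 < marginal_density p z)
  (p_cont : forall z, J z ->
     {ae leb, forall y : measurableTypeR R, p (y, z') @[z' --> z] --> p (y, z)}).

Let IJ x : I x -> J x.
Proof. by move=> Ix; exists x => //; rewrite subrr normr0 ltW. Qed.

Let scheffeI (x : 'rV[R]_d) (eta : R) : I x -> 0 < eta ->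
  \forall z \near x, J z -> \int[leb]_y `|p (y, z) - p (y, x)| <= eta.
Proof.
by move=> /IJ Jx eta0; exact: (scheffe mp p0 Jx f_cont f_pos (p_cont Jx) eta0).
Qed.

(** Compactness of I: around each of its points both x and z are L1-close to the
center. *)
Lemma L1_uniform_continuity (eta : R) : 0 < eta ->
  \forall delta \near 0^'+, forall x, I x -> forall z, `|x - z| <= delta ->
    J z /\ \int[leb]_y `|p (y, z) - p (y, x)| <= eta.
Proof.
move=> eta0.
have /compact_near_coveringP/near_covering_withinP cov := cI.
apply: (cov _ 0^'+ (fun delta x => forall z, `|x - z| <= delta ->
    J z /\ \int[leb]_y `|p (y, z) - p (y, x)| <= eta)) => x Ix.
have eta2 : 0 < eta / 2 by rewrite divr_gt0.
have /nbhs_normP[e /= e0 he] := scheffeI Ix eta2.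
pose e1 := Num.min (e / 2) eps.
have e10 : 0 < e1 by rewrite lt_min divr_gt0.
have near_e1 : \forall x' \near x, `|x - x'| < e1 by apply/nbhs_normP; exists e1.
near=> x' delta => Ix' z x'z.
have dele : delta <= e1 by near: delta; exact: nbhs_right_le.
have xx' : `|x - x'| < e1.
  by near: x'.
have [ee ee'] : e1 <= e / 2 /\ e1 <= eps by rewrite /e1 !ge_min !lexx !orbT.
have Jz : J z.
  by exists x' => //; rewrite distrC (le_trans x'z)// (le_trans dele).
split => //.
have hx' : \int[leb]_y `|p (y, x') - p (y, x)| <= eta / 2.
  by apply: he (IJ Ix'); rewrite /=; lra.
have hz : \int[leb]_y `|p (y, z) - p (y, x)| <= eta / 2.
  apply: he Jz; rewrite /= (_ : x - z = (x - x') + (x' - z)); last first.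
    by rewrite addrA subrK.
  apply: le_lt_trans (ler_normD _ _) _; rewrite (splitr e).
  exact: ltr_leD (lt_le_trans xx' ee) (le_trans x'z (le_trans dele ee)).
have ii t t' : J t -> J t' -> leb.-integrable setT (fun y => `|(p (y, t))%:E - (p (y, t'))%:E|%E).
  move=> Jt Jt'; apply: integrable_abse; apply: integrableB => //.
    exact: (section_integrable mp p0 (f_pos Jt)).
  exact: (section_integrable mp p0 (f_pos Jt')).
have Jx := IJ Ix; have Jx' := IJ Ix'.
rewrite (splitr eta); apply: le_trans (lerD hz hx').
rewrite -(RintegralD measurableT (ii _ _ Jz Jx) (ii _ _ Jx' Jx)).
apply: le_Rintegral => //; first exact: ii.
  exact: (integrableD measurableT (ii _ _ Jz Jx) (ii _ _ Jx' Jx)).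
move=> y _; rewrite (_ : p (y, z) - p (y, x') = (p (y, z) - p (y, x)) - (p (y, x') - p (y, x))).
  exact: ler_normB.
by rewrite opprB addrA subrK.
Unshelve. all: end_near. Qed.

Lemma marginal_bounded_above : exists2 B : R, 0 < B & forall x, I x -> marginal_density p x <= B.
Proof.
have /compact_near_coveringP/near_covering_withinP cov := cI.
have : \forall B \near +oo, I `<=` (fun x => marginal_density p x <= B).
  apply: cov => x Ix; near=> x' B => /= Ix'.
  have h : \int[leb]_y `|p (y, x') - p (y, x)| <= 1.
    have : J x' by exact: IJ.
    by near: x'; exact: scheffeI.
  have := le_trans (marginal_lipschitz (f_pos (IJ Ix)) (f_pos (IJ Ix'))) h.
  move=> /ler_normlP[_ h']; apply: (@le_trans _ _ (marginal_density p x + 1)); first lra.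
  by near: B; apply: nbhs_pinfty_ge; exact: num_real.
move=> hB; have : \forall B \near +oo, I `<=` (fun x => marginal_density p x <= B) /\ 0 < B.
  by near=> B; split; near: B => //; apply: nbhs_pinfty_gt; exact: num_real.
by move=> /filter_ex[B [h B0]]; exists B.
Unshelve. all: end_near. Qed.

Lemma marginal_bounded_below : exists2 c : R, 0 < c & forall x, I x -> c <= marginal_density p x.
Proof.
have /compact_near_coveringP/near_covering_withinP cov := cI.
have : \forall c \near 0^'+, I `<=` (fun x => c <= marginal_density p x).
  apply: cov => x Ix.
  have fx2 : 0 < marginal_density p x / 2 by rewrite divr_gt0 ?f_pos//; exact: IJ.
  near=> x' c => /= Ix'.
  have h : \int[leb]_y `|p (y, x') - p (y, x)| <= marginal_density p x / 2.
    have : J x' by exact: IJ.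
    by near: x'; exact: (scheffeI Ix fx2).
  have := le_trans (marginal_lipschitz (f_pos (IJ Ix)) (f_pos (IJ Ix'))) h.
  move=> /ler_normlP[h' _]; apply: (@le_trans _ _ (marginal_density p x / 2)); last lra.
  by near: c; exact: nbhs_right_le.
move=> hB; have : \forall c \near 0^'+, I `<=` (fun x => c <= marginal_density p x) /\ 0 < c.
  by near=> c; split; near: c => //; exact: nbhs_right_gt.
by move=> /filter_ex[c [h c0]]; exists c.
Unshelve. all: end_near. Qed.

End compact_set.

Section bias.
Variables (phi : R -> R) (Phi : R) (G : 'rV[R]_d -> R) (kappa r eta : R)
  (x : 'rV[R]_d).
Hypotheses (mphi : measurable_fun setT phi) (phi_le : forall y, `|phi y| <= Phi)
  (mG : measurable_fun setT G) (G_le : forall z, `|G z| <= kappa)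
  (r_ge0 : 0 <= r) (G_supp : forall z, G z != 0 -> `|x - z| <= r)
  (x_pos : 0 < marginal_density p x)
  (L1_near : forall z, `|x - z| <= r -> 0 < marginal_density p z /\
     \int[leb]_y `|p (y, z) - p (y, x)| <= eta).

Let B := [set z : 'rV[R]_d | `|x - z| <= r].

Let mB : measurable B. Proof. exact: closed_ball_measurable_rV. Qed.

(** The ball B has volume (2 r)^d for the maximum norm. *)
Lemma supported_integral (h : 'rV[R]_d -> R) (c : R) :
  measurable_fun setT h -> (forall z, `|h z| <= c * \1_B z) ->
  lebd.-integrable setT (EFin \o h) /\ `|\int[lebd]_z h z| <= c * (2 * r) ^+ d.
Proof.
move=> mh hle.
have vB : (\int[lebd]_z (\1_B z)%:E = ((2 * r) ^+ d)%:E)%E.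
  by rewrite integral_indic// setIT; exact: lebesgue_rV_ball.
have i1 : lebd.-integrable setT (EFin \o \1_B).
  apply/integrableP; split; first exact/measurable_EFinP.
  under eq_integral do rewrite /= ger0_norm//.
  by rewrite vB ltry.
have ic : lebd.-integrable setT (EFin \o (fun z => c * \1_B z)).
  exact: (integrableZl measurableT c i1).
have ih : lebd.-integrable setT (EFin \o h).
  apply: (le_integrable _ _ _ ic) => //; first exact/measurable_EFinP.
  by move=> z _ /=; rewrite lee_fin (le_trans (hle z))// ler_norm.
split => //; apply: le_trans (le_normr_Rintegral measurableT ih) _.
apply: (@le_trans _ _ (\int[lebd]_z (c * \1_B z))).
  apply: le_Rintegral => //; exact: (integrable_abse ih).
by rewrite (RintegralZl c measurableT i1) /Rintegral vB.
Qed.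

(** Integrating y first, the expectation is the integral of G times the weighted
density, which varies by at most Phi eta on the support of G. *)
Lemma local_expectation_bias :
  `|\int[nu]_z (phi z.1 * G z.2) - weighted_density phi x * \int[lebd]_z G z| <=
    kappa * (Phi * eta) * (2 * r) ^+ d.
Proof.
have Phi0 : 0 <= Phi by exact: le_trans (phi_le 0).
have kappa0 : 0 <= kappa by exact: le_trans (G_le x).
have GB z : G z != 0 -> \1_B z = 1 :> R.
  by move=> /G_supp Bz; rewrite indicE mem_set.
have mF : measurable_fun setT (fun z : T => phi z.1 * G z.2).
  by apply: measurable_funM; [exact: (measurableT_comp mphi)|exact: (measurableT_comp mG)].
pose H (z : T) := (phi z.1 * G z.2 * p z)%:E.
have mH : measurable_fun setT H by apply/measurable_EFinP; apply: measurable_funM.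
have iH : (leb \x lebd)%E.-integrable setT H.
  have ip := density_integrable (M := lebesgue_prod R d) mp p0 nuE.
  have iPp := integrableZl measurableT (Phi * kappa) ip.
  apply: (le_integrable _ _ _ iPp) => //.
  move=> z _; rewrite /= lee_fin !normrM ler_wpM2r//.
  by rewrite (ger0_norm Phi0) (ger0_norm kappa0) ler_pM.
have GE z : fubini_G leb H z = (G z * weighted_density phi z)%:E.
  rewrite /fubini_G /H /=; have [->|Gz] := eqVneq (G z) 0.
    by rewrite mul0r; under eq_integral do rewrite mulr0 mul0r; rewrite integral0.
  have [fz _] := L1_near (G_supp Gz).
  have iz := bounded_section_integrable mp p0 mphi phi_le fz.
  rewrite -(RintegralZl (G z) measurableT iz).
  rewrite fineK; last exact: (integrable_fin_num measurableT (integrableZl measurableT (G z) iz)).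
  by apply: eq_integral => y _; rewrite mulrCA mulrA.
have mGw : measurable_fun setT (fun z => G z * weighted_density phi z).
  apply/measurable_EFinP; rewrite (_ : _ \o _ = fubini_G leb H).
    exact: (measurable_fubini_G iH).
  by apply/funext => z; rewrite GE.
have wle z : G z != 0 -> `|weighted_density phi z - weighted_density phi x| <= Phi * eta.
  move=> Gz; have [fz hz] := L1_near (G_supp Gz).
  apply: le_trans (weighted_density_lipschitz mphi phi_le x_pos fz) _.
  exact: ler_wpM2l.
have [|iGw _] := @supported_integral (fun z => G z * weighted_density phi z)
    (kappa * (`|weighted_density phi x| + `|Phi * eta|)) mGw.
  move=> z; have [->|Gz] := eqVneq (G z) 0; first by rewrite mul0r normr0 !mulr_ge0.
  rewrite GB// mulr1 normrM ler_pM// -lerBlDl.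
  by apply: le_trans (lerB_dist _ _) _; rewrite (le_trans (wle z Gz))// ler_norm.
have [|iG _] := @supported_integral G kappa mG.
  move=> z; have [->|Gz] := eqVneq (G z) 0; first by rewrite normr0 mulr_ge0.
  by rewrite GB// mulr1.
have iGx := integrableZl measurableT (weighted_density phi x) iG.
have mGd : measurable_fun setT (fun z => G z * weighted_density phi z - weighted_density phi x * G z).
  by apply: measurable_funB => //; apply: measurable_funM.
have [|_] := @supported_integral _ (kappa * (Phi * eta)) mGd.
  move=> z; rewrite [X in _ - X]mulrC -mulrBr.
  have [->|Gz] := eqVneq (G z) 0; last by rewrite GB// mulr1 normrM ler_pM// wle.
  rewrite mul0r normr0 !mulr_ge0//.
  have [_] : 0 < marginal_density p x /\ \int[leb]_y `|p (y, x) - p (y, x)| <= eta.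
    by apply: L1_near; rewrite subrr normr0.
  by apply: le_trans; apply: Rintegral_ge0 => y _; exact: normr_ge0.
rewrite (RintegralB measurableT iGw iGx) (RintegralZl _ measurableT iG).
rewrite (_ : \int[nu]_z _ = \int[lebd]_z (G z * weighted_density phi z))//.
congr fine; rewrite (density_integral (M := lebesgue_prod R d) mp)//.
rewrite -[LHS](integral21_prod_meas1 iH).
by apply: eq_integral => z _; rewrite GE.
Qed.

End bias.
End local_regression.

(** * The rescaled kernels *)

Section local_mass.
Context {R : realType} {d : nat}.
Let T := (measurableTypeR R * 'rV[R]_d)%type.
Variables (nu : probability T R) (p : T -> R).
Local Notation leb := (@lebesgue_measure R).
Local Notation lebd := (lebesgue_rV R d).
Hypotheses (mp : measurable_fun setT p) (p0 : forall z, 0 <= p z)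
  (nuE : forall A, measurable A ->
    nu A = (\int[(leb \x lebd)%E]_(z in A) (p z)%:E)%E).

(** The conditional mass of psi is at most rho at each point of U, and the ball
has volume (2 r)^d. *)
Lemma local_mass (psi : R -> R) (U : set 'rV[R]_d) (rho r : R) (c : 'rV[R]_d) :
  measurable_fun setT psi -> (forall y, 0 <= psi y) -> measurable U ->
  0 <= rho -> 0 <= r ->
  (forall z, U z -> (\int[leb]_y (psi y * p (y, z))%:E <= rho%:E)%E) ->
  (\int[nu]_z (psi z.1 * \1_(U `&` [set z | (`|c - z| <= r)%R]) z.2)%:E <=
    (rho * (2 * r) ^+ d)%:E)%E.
Proof.
move=> mpsi psi0 mU rho0 r0 hU.
have mB : measurable [set z : 'rV[R]_d | `|c - z| <= r] by exact: closed_ball_measurable_rV.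
set V := U `&` _.
have mV : measurable V by exact: measurableI.
rewrite (density_product_integral mp p0 nuE)//.
apply: (@le_trans _ _ (\int[lebd]_x (rho%:E * (\1_[set z : 'rV[R]_d | `|c - z| <= r] x)%:E))%E).
  apply: ge0_le_integral; first exact: measurableT.
  - by move=> x _; apply: mule_ge0; rewrite ?lee_fin//; apply: integral_ge0 => y _; rewrite lee_fin mulr_ge0.
  - apply: emeasurable_funM; first exact/measurable_EFinP.
    apply: (measurable_fun_fubini_tonelli_G (m1 := leb) (fun z => (psi z.1 * p z)%:E)).
      by apply/measurable_EFinP; apply: measurable_funM => //; exact: (measurableT_comp mpsi).
    by move=> z; rewrite lee_fin mulr_ge0.
  - by apply: emeasurable_funM => //; exact/measurable_EFinP.
  move=> x _; rewrite !indicE /V in_setI.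
  have [Ux|] := boolP (x \in U); last by rewrite mul0e// => _; rewrite mule_ge0// lee_fin.
  rewrite andTb muleC; apply: lee_wpmul2r; first by rewrite lee_fin.
  by apply: hU; rewrite -inE.
rewrite ge0_integralZl//; last exact/measurable_EFinP.
rewrite integral_indic// setIT EFinM; apply: lee_wpmul2l; first by rewrite lee_fin.
by rewrite -(lebesgue_rV_ball c r0).
Qed.

End local_mass.

Section kernel_facts.
Context {R : realType} {d : nat}.
Hypothesis d_gt0 : (0 < d)%N.
Variable K : 'rV[R]_d -> R.
Hypotheses (mK : measurable_fun setT K)
  (K_int : (\int[lebesgue_rV R d]_s (K s)%:E = 1)%E)
  (K_bounded : (sup_norm setT K < +oo)%E)
  (K_support : closure [set s | K s != 0] `<=`
    [set s | forall i, - 2^-1 <= s ord0 i <= 2^-1]).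

Let kappa := fine (sup_norm setT K).

Lemma kernel_le s : `|K s| <= kappa.
Proof.
have h : (`|K s|%:E <= sup_norm setT K)%E by apply: ereal_sup_ubound; right; exists s.
have f : sup_norm setT K \is a fin_num.
  by rewrite ge0_fin_numE// (le_trans _ h).
by rewrite -lee_fin /kappa fineK.
Qed.

(** A kernel that is identically 0 does not have integral 1. *)
Lemma kernel_bound_gt0 : 0 < kappa.
Proof.
rewrite lt_neqAle (le_trans (normr_ge0 (K 0)) (kernel_le 0)) andbT.
apply/eqP => k0; move: K_int; rewrite (eq_integral (fun=> 0%E)); last first.
  by move=> s _; have := kernel_le s; rewrite -k0 normr_le0 => /eqP ->.
by rewrite integral0 => /eqP; rewrite eqe eq_sym oner_eq0.
Qed.

Lemma kernel_support s : K s != 0 -> `|s| <= 2^-1.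
Proof.
move=> Ks; have /K_support h : closure [set s | K s != 0] s by exact: subset_closure.
by apply/norm_rV_leP => // i; rewrite ler_norml.
Qed.

Lemma rescaled_kernel_measurable h (x : 'rV[R]_d) :
  measurable_fun setT (fun z : 'rV[R]_d => rescaled_kernel K h (x - z)).
Proof. by apply: (measurableT_comp mK); exact: measurable_affine_rV. Qed.

Lemma kernel_class_measurable g : kernel_class K g -> measurable_fun setT g.
Proof. by move=> [h [x [_ ->]]]; exact: rescaled_kernel_measurable. Qed.

Lemma kernel_class_le g z : kernel_class K g -> `|g z| <= kappa.
Proof. by move=> [h [x [_ ->]]]; exact: kernel_le. Qed.

Lemma bandwidth_power (h : R) : 0 < h -> (h `^ d%:R^-1) ^+ d = h.
Proof.
move=> h0; rewrite -powR_mulrn ?powR_ge0// -powRrM mulVf ?powRr1 ?ltW//.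
by rewrite pnatr_eq0 -lt0n.
Qed.

Lemma rescaled_kernel_support h (x z : 'rV[R]_d) : 0 < h ->
  rescaled_kernel K h (x - z) != 0 -> `|x - z| <= h `^ d%:R^-1.
Proof.
move=> h0 /kernel_support; have hd0 : 0 < h `^ d%:R^-1 by exact: powR_gt0.
rewrite normrZ normfV (ger0_norm (ltW hd0)) ler_pdivrMl// => /le_trans; apply.
apply: ler_piMr; first exact: ltW.
by rewrite invf_le1// ler1n.
Qed.

(** The change of variables is available for nonnegative functions, so it is
applied to the positive and the negative part of K. *)
Lemma rescaled_kernel_integral h (x : 'rV[R]_d) : 0 < h ->
  \int[lebesgue_rV R d]_z rescaled_kernel K h (x - z) = h.
Proof.
move=> h0; have hd0 : 0 < h `^ d%:R^-1 by exact: powR_gt0.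
have mEK : measurable_fun setT (EFin \o K) by exact/measurable_EFinP.
rewrite /Rintegral integralE.
have -> : (\int[lebesgue_rV R d]_z (fun z => (rescaled_kernel K h (x - z))%:E)^\+ z =
    h%:E * \int[lebesgue_rV R d]_z (EFin \o K)^\+ z)%E.
  rewrite -{2}(bandwidth_power h0) -(lebesgue_rV_affine x hd0)//; last exact: measurable_funepos.
  by apply: eq_integral => z _; rewrite !funeposE.
have -> : (\int[lebesgue_rV R d]_z (fun z => (rescaled_kernel K h (x - z))%:E)^\- z =
    h%:E * \int[lebesgue_rV R d]_z (EFin \o K)^\- z)%E.
  rewrite -{2}(bandwidth_power h0) -(lebesgue_rV_affine x hd0)//; last exact: measurable_funeneg.
  by apply: eq_integral => z _; rewrite !funenegE.
move: K_int; rewrite integralE.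
have p0 : (0 <= \int[lebesgue_rV R d]_z (EFin \o K)^\+ z)%E by exact: integral_ge0.
have n0 : (0 <= \int[lebesgue_rV R d]_z (EFin \o K)^\- z)%E by exact: integral_ge0.
case: (\int[_]_z _ z)%E p0 => [a||]//; case: (\int[_]_z _ z)%E n0 => [b||]//= _ _.
by rewrite -EFinD => -[ab]; rewrite -mulrBr ab mulr1.
Qed.

End kernel_facts.

(** * Borel-Cantelli arguments *)

Section borel_cantelli_inv_sqr.
Context d0 {Omega : measurableType d0} {R : realType} (P : probability Omega R).

(** Telescoping: the sum of the first n + 1 terms is at most 2 - 1 / (n + 1). *)
Lemma sum_inv_sqr_le (n : nat) : \sum_(0 <= i < n) (i.+1%:R ^- 2 : R) <= 2.
Proof.
suff h : \sum_(0 <= i < n.+1) (i.+1%:R ^- 2 : R) <= 2 - n.+1%:R^-1.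
  apply: (le_trans _ (le_trans h _)); last by rewrite gerBl invr_ge0.
  by rewrite big_nat_recr//= lerDl invr_ge0 exprn_ge0.
elim: n => [|n ih]; first by rewrite big_nat1 expr1n !invr1; lra.
rewrite big_nat_recr//=; apply: le_trans (lerD ih (lexx _)) _.
rewrite -subr_ge0.
have -> : 2 - n.+2%:R^-1 - (2 - n.+1%:R^-1 + n.+2%:R ^- 2) =
   (n.+1%:R * n.+2%:R ^+ 2)^-1 :> R.
  have a0 : 0 < n.+1%:R :> R by [].
  rewrite -[n.+2%:R]natr1; field.
  by rewrite !gt_eqF// ltr_wpDl// ltW.
by rewrite invr_ge0 mulr_ge0// exprn_ge0.
Qed.

Lemma borel_cantelli_ae (F : nat -> set Omega) :
  (forall n, measurable (F n)) -> (\sum_(n <oo) P (F n) < +oo)%E ->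
  {ae P, forall w, \forall n \near \oo, ~ F n w}.
Proof.
move=> mF sumF; exists (lim_sup_set F); split.
- by apply: bigcap_measurable => // k _; exact: bigcup_measurable.
- exact: lim_sup_set_cvg0.
- move=> w /= nw n _; apply: contrapT => h; apply: nw.
  by exists n => // m /= nm Fm; apply: h; exists m.
Qed.

Lemma borel_cantelli_inv_sqr (F : nat -> set Omega) :
  (forall n, measurable (F n)) ->
  (\forall n \near \oo, (P (F n) <= (n%:R ^- 2)%:E)%E) ->
  {ae P, forall w, \forall n \near \oo, ~ F n w}.
Proof.
move=> mF [N _ hN].
have : {ae P, forall w, \forall n \near \oo, ~ F (n + N.+1)%N w}.
  apply: borel_cantelli_ae => //; apply: (@le_lt_trans _ _ 2%:E); last exact: ltry.
  apply: lime_le; first by apply: is_cvg_nneseries => n _ _.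
  apply: nearW => n; apply: (@le_trans _ _ (\sum_(0 <= i < n) ((i.+1%:R ^- 2 : R)%:E))%E).
    apply: lee_sum => i _; apply: le_trans (hN (i + N.+1)%N _) _.
      by rewrite /= (leq_trans (leqnSn N))// leq_addl.
    rewrite lee_fin lef_pV2 ?posrE ?exprn_gt0 ?ltr0n ?addnS//.
    by rewrite lerXn2r ?nnegrE// ler_nat ltnS leq_addr.
  by rewrite sumEFin lee_fin sum_inv_sqr_le.
apply: filterS => w [m _ hm]; exists (m + N.+1)%N => // n /= mn.
have Nn : (N.+1 <= n)%N by rewrite (leq_trans _ mn)// leq_addl.
by rewrite -(subnK Nn); apply: hm; rewrite /= leq_subRL// addnC.
Qed.

Lemma measure_bigsetU_le (J : Type) (r : seq J) (Q : pred J) (F : J -> set Omega) :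
  (forall j, measurable (F j)) ->
  (P (\big[setU/set0]_(j <- r | Q j) F j) <= \sum_(j <- r | Q j) P (F j))%E.
Proof.
move=> mF; elim: r => [|j r ih]; first by rewrite !big_nil measure0.
rewrite !big_cons; case: ifP => _ //.
apply: le_trans (measureU2 _ _ _) _ => //; first exact: bigsetU_measurable.
exact: leeD.
Qed.

Lemma measure_finite_union_le (J : finType) (Q : pred J) (F : J -> set Omega) (beta : R) :
  (forall j, measurable (F j)) -> 0 <= beta ->
  (forall j, Q j -> (P (F j) <= beta%:E)%E) ->
  (P (\big[setU/set0]_(j | Q j) F j) <= (#|J|%:R * beta)%:E)%E.
Proof.
move=> mF b0 hF; apply: le_trans (measure_bigsetU_le _ _ mF) _.
apply: (@le_trans _ _ (\sum_(j : J) beta%:E)%E).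
  by rewrite big_mkcond; apply: lee_sum => j _; case: ifPn => [/hF//|_]; rewrite lee_fin.
by rewrite sumEFin lee_fin sumr_const mulr_natl.
Qed.

End borel_cantelli_inv_sqr.

Section polynomial_times_exponential.
Context {R : realType}.

(** Eventually c v n >= (k + 3) ln n, so the exponential is at most
n^-(k + 3), and n absorbs C. *)
Lemma poly_expR_le_inv_sqr (C c : R) (k : nat) (v : nat -> R) : 0 < c ->
  v n / ln n%:R @[n --> \oo] --> +oo ->
  \forall n \near \oo, C * n%:R ^+ k * expR (- (c * v n)) <= n%:R ^- 2.
Proof.
move=> c0 /cvgryPge vn.
near=> n.
have n2 : (2 <= n)%N by near: n; exact: nbhs_infty_ge.
have n0 : 0 < n%:R :> R by rewrite ltr0n (leq_trans _ n2).
have ln0 : 0 < ln n%:R :> R by rewrite ln_gt0// ltr1n.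
have Cn : C <= n%:R by near: n; exact: nbhs_infty_ger.
have vl : (k.+3)%:R / c <= v n / ln n%:R by near: n; exact: vn.
have e : expR (- (c * v n)) <= n%:R ^- k.+3.
  rewrite -[X in _ <= X^-1](lnK (x := n%:R ^+ k.+3)) ?posrE ?exprn_gt0//.
  rewrite -expRN ler_expR lerN2 lnXn// -[leLHS]mulr_natl.
  have := vl; rewrite ler_pdivlMr// => h.
  have -> : k.+3%:R * ln n%:R = c * (k.+3%:R / c * ln n%:R) by field; rewrite gt_eqF.
  by rewrite ler_pM2l.
apply: (@le_trans _ _ (n%:R * n%:R ^+ k * n%:R ^- k.+3)).
  apply: (@le_trans _ _ (n%:R * n%:R ^+ k * expR (- (c * v n)))).
    by rewrite ler_wpM2r ?expR_ge0// ler_wpM2r ?exprn_ge0// ltW.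
  by rewrite ler_wpM2l// mulr_ge0// ?exprn_ge0// ltW.
rewrite -exprS -[k.+3]addn2 exprD invfM mulrA divff ?mul1r//.
by rewrite expf_eq0 gt_eqF.
Unshelve. all: end_near. Qed.

End polynomial_times_exponential.

(** * Uniform bounds on local sums *)

Section bandwidth_blocks.
Context {R : realType}.

(** The levels 2 (j + 1) / n, for j < n. An arithmetic progression is enough, as
each h >= 1 / n then lies within a factor 2 below some level, and the n blocks
cost only one power of n in the union bound. *)
Definition block n (j : 'I_n) : R := 2 * j.+1%:R / n%:R.

Lemma block_gt0 n (j : 'I_n) : 0 < block j.
Proof. by rewrite /block divr_gt0 ?mulr_gt0 ?ltr0n// (leq_ltn_trans (leq0n j)). Qed.

Lemma block_le2 n (j : 'I_n) : block j <= 2.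
Proof.
have n0 : 0 < n%:R :> R by rewrite ltr0n (leq_ltn_trans (leq0n j)).
by rewrite /block ler_pdivrMr// ler_pM2l// ler_nat.
Qed.

Lemma block_geV n (j : 'I_n) : n%:R^-1 <= block j.
Proof.
have n0 : 0 < n%:R :> R by rewrite ltr0n (leq_ltn_trans (leq0n j)).
by rewrite /block -[leLHS]mul1r ler_pM2r ?invr_gt0// -natrM ler1n mulnS.
Qed.

Lemma bandwidth_in_block (n : nat) (h : R) : 1 <= n%:R * h -> h <= 1 ->
  exists j : 'I_n, h <= block j <= 2 * h.
Proof.
move=> nh1 h1; have nh0 : 0 <= n%:R * h by exact: le_trans nh1.
have n0 : (0 < n)%N by rewrite lt0n; apply: contraTneq nh1 => ->; rewrite mul0r ler10.
have n0' : 0 < n%:R :> R by rewrite ltr0n.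
have /andP[l1 l2] := truncn_itv nh0.
case: (Num.truncn (n%:R * h)) l1 l2 => [_|l l1 l2].
  by rewrite ltNge nh1.
have ln : (l < n)%N.
  by rewrite -(ler_nat R) (le_trans l1)// ger_pMr.
exists (Ordinal ln); rewrite /block /= ler_pdivlMr// ler_pdivrMr//.
move: l1 l2; rewrite -!natr1; have : 0 <= l%:R :> R by []; move=> *; apply/andP; split; nra.
Qed.

End bandwidth_blocks.

Section grid.
Context {R : realType} {d : nat}.

(** A grid of mesh 1 / n in the cube [-A, A]^d. *)
Definition grid_point (A n : nat) (k : {ffun 'I_d -> 'I_(2 * A * n).+1}) : 'rV[R]_d :=
  \row_i ((k i)%:R / n%:R - A%:R).

Lemma grid_approximation (A n : nat) (x : 'rV[R]_d) : (0 < n)%N ->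
  (forall i, `|x ord0 i| <= A%:R) ->
  exists k : {ffun 'I_d -> 'I_(2 * A * n).+1}, `|x - grid_point k| <= n%:R^-1.
Proof.
move=> n0 xA; have n0' : 0 < n%:R :> R by rewrite ltr0n.
pose t i := (x ord0 i + A%:R) * n%:R.
have t0 i : 0 <= t i.
  by rewrite mulr_ge0// -lerBlDr sub0r; have /ler_normlP[] := xA i; lra.
exists [ffun i => inord (Num.truncn (t i))].
apply/norm_rV_leP => [|i]; first by rewrite invr_ge0 ltW.
rewrite !mxE ffunE.
have /andP[l1 l2] := truncn_itv (t0 i).
have lA : (Num.truncn (t i) < (2 * A * n).+1)%N.
  rewrite ltnS -(ler_nat R) (le_trans l1)// /t natrM ler_wpM2r//.
  by rewrite natrM; have /ler_normlP[] := xA i; lra.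
rewrite inordK//.
have -> : x ord0 i - ((Num.truncn (t i))%:R / n%:R - A%:R) =
  (t i - (Num.truncn (t i))%:R) / n%:R by rewrite /t; field; rewrite gt_eqF.
rewrite normrM [`|_^-1|]ger0_norm ?invr_ge0 ?(ltW n0')// ler_piMl ?invr_ge0 ?(ltW n0')//.
by move: l2; rewrite -natr1 ger0_norm ?subr_ge0// lerBlDl => /ltW.
Qed.

Lemma card_grid (A n : nat) : (0 < d)%N -> (0 < n)%N ->
  (#|{ffun 'I_d -> 'I_(2 * A * n).+1}| <= (2 * A + 1) ^ d * n ^ d)%N.
Proof.
move=> d0 n0; rewrite card_ffun !card_ord -expnMn leq_exp2r//.
by rewrite mulnDl mul1n -addn1 leq_add2l.
Qed.

End grid.

Section local_sums.
Context d0 {Omega : measurableType d0} {R : realType} {d : nat}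
  (P : probability Omega R).
Hypothesis d_gt0 : (0 < d)%N.
Let T := (measurableTypeR R * 'rV[R]_d)%type.
Variable Z : nat -> {RV P >-> T}.
Hypothesis iidZ : iid Z.
Local Notation leb := (@lebesgue_measure R).
Local Notation lebd := (lebesgue_rV R d).
Let nu := distribution P (Z 0%N).
Variable p : T -> R.
Hypotheses (mp : measurable_fun setT p) (p0 : forall z, 0 <= p z)
  (nuE : forall A, measurable A ->
    nu A = (\int[(leb \x lebd)%E]_(z in A) (p z)%:E)%E).

(** The balls of radius h^(1/d) around the points of I are covered by O(n^(d+1))
balls, centered on a grid and with radii given by the blocks. On each of them
the sum has mean at most n rho 4^d eta, and exceeds four times this value with
probability at most exp(- n rho a_n / B_n). The growth of B_n is what limits the
truncation level of unbounded responses. *)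
Lemma local_sums_bound (I U : set 'rV[R]_d) (A : nat) (rho : R)
    (psi : nat -> R -> R) (B a : nat -> R) :
  (forall x, I x -> forall i, `|x ord0 i| <= A%:R) -> measurable U -> 0 < rho ->
  (forall n, measurable_fun setT (psi n)) ->
  (forall n y, 0 <= psi n y <= B n) -> (forall n, 0 < B n) ->
  (forall n z, U z -> (\int[leb]_y (psi n y * p (y, z))%:E <= rho%:E)%E) ->
  n%:R * a n / B n / ln n%:R @[n --> \oo] --> +oo ->
  {ae P, forall w, \forall n \near \oo, forall h, a n <= h <= 1 -> 1 <= n%:R * h ->
    forall x, I x ->
      \sum_(i <- iota 1 n) psi n (Z i w).1 *
        \1_(U `&` [set z | `|x - z| <= h `^ d%:R^-1]) (Z i w).2 <=
      8 * 4 ^+ d * rho * (n%:R * h)}.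
Proof.
move=> IA mU rho0 mpsi psiB B0 psirho lim.
have psi0 n y : 0 <= psi n y by have /andP[] := psiB n y.
pose s n (j : 'I_n) : R := block j `^ d%:R^-1.
have s_pow n (j : 'I_n) : s n j ^+ d = block j by apply: bandwidth_power => //; exact: block_gt0.
have s0 n (j : 'I_n) : 0 <= s n j by exact: powR_ge0.
pose v n (j : 'I_n) : R := rho * 4 ^+ d * block j.
pose gr n := {ffun 'I_d -> 'I_(2 * A * n).+1}.
pose psiV n (jk : 'I_n * gr n) (z : T) : R := psi n z.1 *
  \1_(U `&` [set z | `|grid_point jk.2 - z| <= 2 * s n jk.1]) z.2.
have mV n (jk : 'I_n * gr n) : measurable (U `&` [set z | `|grid_point jk.2 - z| <= 2 * s n jk.1]).
  by apply: measurableI => //; exact: closed_ball_measurable_rV.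
have mpsiV n jk : measurable_fun setT (psiV n jk).
  apply: measurable_funM; first exact: (measurableT_comp (mpsi n)).
  by apply: measurableT_comp => //; exact: measurable_indic.
pose E n jk := [set w | 4 * (n%:R * v n jk.1) <= \sum_(i <- iota 1 n) psiV n jk (Z i w)].
have mE n jk : measurable (E n jk).
  by apply: measurable_set_le => //; exact: measurable_sum_sample.
pose F n := \big[setU/set0]_(jk : 'I_n * gr n | a n <= block jk.1) E n jk.
have mF n : measurable (F n) by apply: bigsetU_measurable => jk _; exact: mE.
have PE n jk : a n <= block jk.1 -> (P (E n jk) <= (expR (- (rho * (n%:R * a n / B n))))%:E)%E.
  move=> an.
  have vle : \int[nu]_z psiV n jk z <= v n jk.1.
    have := @local_mass _ _ nu p mp p0 nuE (psi n) U rho (2 * s n jk.1) (grid_point jk.2)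
      (mpsi n) (psi0 n) mU (ltW rho0) (mulr_ge0 (ler0n R 2) (s0 n jk.1)) (psirho n).
    have -> : rho * (2 * (2 * s n jk.1)) ^+ d = v n jk.1.
      by rewrite mulrA -natrM exprMn s_pow /v mulrA.
    move=> h; rewrite -lee_fin; apply: le_trans h; rewrite EFin_Rintegral_prob//.
    apply: (@prob_bounded_integrable _ _ _ _ _ (B n) (mpsiV n jk)) => z.
    have /andP[p1 p2] := psiB n z.1; rewrite /psiV indicE.
    by case: (_ \in _); rewrite ?mulr1 ?mulr0 ?normr0 ?ger0_norm// ltW.
  have psiVB z : 0 <= psiV n jk z <= B n.
    have /andP[p1 p2] := psiB n z.1; rewrite /psiV indicE.
    by case: (_ \in _); rewrite ?mulr1 ?mulr0 ?p1 ?p2 ?lexx ?ltW.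
  apply: le_trans (nonneg_sum_upper_tail iidZ _ (iota_uniq 1 n) (mpsiV n jk) (B0 n) psiVB vle) _.
  rewrite lee_fin ler_expR size_iota.
  have -> : n%:R * v n jk.1 / B n - 4 * (n%:R * v n jk.1) / (2 * B n) = - (n%:R * v n jk.1 / B n).
    by field; rewrite gt_eqF.
  rewrite lerN2 mulrA ler_pM2r ?invr_gt0// mulrCA; apply: ler_wpM2l => //.
  rewrite /v -mulrA ler_pM2l//; apply: (le_trans an).
  by rewrite ler_peMl ?(ltW (block_gt0 _))// exprn_ege1// ler1n.
have cardJ n : (0 < n)%N -> #|{: 'I_n * gr n}|%:R <= ((2 * A + 1) ^ d)%:R * n%:R ^+ d.+1 :> R.
  move=> n0; rewrite card_prod card_ord natrM exprS mulrCA ler_wpM2l//.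
  by rewrite -natrX -natrM ler_nat; exact: card_grid.
have PF : \forall n \near \oo, (P (F n) <= (n%:R ^- 2)%:E)%E.
  near=> n.
  have n0 : (0 < n)%N by near: n; exact: nbhs_infty_gt.
  apply: le_trans (measure_finite_union_le (mE n) (expR_ge0 _) (PE n)) _.
  rewrite lee_fin; apply: (@le_trans _ _ (((2 * A + 1) ^ d)%:R * n%:R ^+ d.+1 * expR (- (rho * (n%:R * a n / B n))))).
    by rewrite ler_wpM2r ?expR_ge0// cardJ.
  by near: n; exact: poly_expR_le_inv_sqr.
have := borel_cantelli_inv_sqr mF PF; apply: filterS => w hw.
near=> n => h /andP[ah h1] nh x Ix.
have n0 : (0 < n)%N by near: n; exact: nbhs_infty_gt.
have n0' : 0 < n%:R :> R by rewrite ltr0n.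
have nFw : ~ F n w by near: n.
have [j /andP[hj jh]] := bandwidth_in_block nh h1.
have [k xk] := grid_approximation n0 (IA x Ix).
have nE : ~ E n (j, k) w.
  move=> Ew; apply: nFw; rewrite /F -bigcup_seq_cond; exists (j, k) => //=.
  by rewrite mem_index_enum (le_trans ah).
(* The mesh of the grid is below the radius of the ball, so doubling the radius
   makes up for moving the center to the grid. *)
have ns : n%:R^-1 <= s n j.
  rewrite -(ler_pXn2r d_gt0) ?nnegrE ?invr_ge0 ?(ltW n0')// s_pow.
  apply: le_trans (block_geV j); rewrite -(prednK d_gt0) exprS ler_piMr ?invr_ge0 ?(ltW n0')//.
  by rewrite exprn_ile1 ?invr_ge0 ?(ltW n0')// invf_le1// ler1n.
have h0 : 0 < h by have := lt_le_trans ltr01 nh; rewrite pmulr_rgt0.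
have hs : h `^ d%:R^-1 <= s n j.
  by apply: ge0_ler_powR; rewrite ?nnegrE ?invr_ge0 ?(ltW h0) ?(ltW (block_gt0 _)).
move/negP : nE; rewrite /E /= -ltNge => /ltW nE.
apply: (@le_trans _ _ (4 * (n%:R * v n j))).
  apply: le_trans nE; apply: ler_sum => i _; rewrite /psiV /= ler_wpM2l// !indicE.
  have [|] := boolP (_ \in _); last by [].
  rewrite inE => -[Uz /= xz]; rewrite mem_set//; split => //=.
  rewrite (_ : grid_point k - _ = (grid_point k - x) + (x - (Z i w).2)); last by rewrite addrA subrK.
  apply: le_trans (ler_normD _ _) _; rewrite distrC mulr_natl mulr2n lerD//.
    exact: le_trans ns.
  exact: le_trans hs.
rewrite /v.
have -> : 8 * 4 ^+ d * rho * (n%:R * h) = 4 * (n%:R * (rho * 4 ^+ d * (2 * h))) by ring.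
by rewrite ler_pM2l// ler_pM2l// ler_wpM2l// mulr_ge0 ?exprn_ge0// ltW.
Unshelve. all: end_near. Qed.

End local_sums.

(** * Limits along bandwidths and under bounded integrals *)

Section bounded_convergence.
Context d {T : measurableType d} {R : realType} (Q : probability T R).

Lemma bounded_Rintegral_cvg (f_ : nat -> T -> R) (f : T -> R) (B : R) :
  (forall m, measurable_fun setT (f_ m)) -> measurable_fun setT f ->
  (forall m x, `|f_ m x| <= B) -> (forall x, f_ m x @[m --> \oo] --> f x) ->
  \int[Q]_x f_ m x @[m --> \oo] --> \int[Q]_x f x.
Proof.
move=> mf_ mf fB cf.
have [i0 _ h] : [/\ Q.-integrable setT (EFin \o f),
    (\int[Q]_x (`|(f_ m x)%:E - (f x)%:E|)%E)%E @[m --> \oo] --> 0%E &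
    (\int[Q]_x (f_ m x)%:E)%E @[m --> \oo] --> (\int[Q]_x (EFin \o f) x)%E].
  apply: (@dominated_convergence _ _ _ Q setT measurableT
    (fun m x => (f_ m x)%:E) (EFin \o f) (fun=> B%:E)) => //.
  - by move=> m; exact/measurable_EFinP.
  - exact/measurable_EFinP.
  - apply: aeW => x _; apply: cvg_EFin; [exact: nearW|exact: cf].
  - exact: (@prob_bounded_integrable _ _ _ Q (fun=> B) `|B|).
  - by apply: aeW => x m _; rewrite /= lee_fin.
apply: fine_cvg; rewrite fineK//; exact: (integrable_fin_num measurableT i0).
Qed.

End bounded_convergence.

Section divergence.
Context {R : realType}.

Lemma diverge_over_ln (v : nat -> R) (M : R) :
  v n / ln n%:R @[n --> \oo] --> +oo -> \forall n \near \oo, M <= v n.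
Proof.
move=> /cvgryPge vn.
have ln3 : 0 < ln (2%:R : R) by rewrite ln_gt0// ltr1n.
near=> n.
have n2 : (2 <= n)%N by near: n; exact: nbhs_infty_ge.
have lnn : ln (2%:R : R) <= ln n%:R.
  by rewrite ler_ln ?posrE ?ltr0n ?ler_nat// (leq_trans _ n2).
have h : `|M| / ln 2%:R <= v n / ln n%:R by near: n; exact: vn.
have ln0 := lt_le_trans ln3 lnn.
apply: le_trans (ler_norm M) _.
move: h; rewrite ler_pdivlMr// => /(le_trans _); apply.
rewrite -mulrA ler_peMr// mulrC ler_pdivlMr// mul1r//.
Unshelve. all: end_near. Qed.

End divergence.

(** * Uniform deviations over bandwidths and points *)

Lemma cvg_finite_sum {R : realType} {J : Type} (s : seq J) (u : nat -> J -> R) (l : J -> R) :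
  (forall j, u m j @[m --> \oo] --> l j) ->
  \sum_(j <- s) u m j @[m --> \oo] --> \sum_(j <- s) l j.
Proof.
move=> ul; elim: s => [|j s ih].
  by rewrite big_nil; under eq_fun do rewrite big_nil; exact: cvg_cst.
rewrite big_cons; under eq_fun do rewrite big_cons.
by apply: cvgD => //; exact: ul.
Qed.

(** A point of A is repeated so that a finite A can also be enumerated. *)
Lemma countable_enumeration {T : pointedType} (A : set T) (t0 : T) :
  countable A -> A t0 ->
  exists e : nat -> T, (forall k, A (e k)) /\ (forall t, A t -> exists k, e k = t).
Proof.
move=> /pcard_surjP[g gA] At0.
pose e k := if pselect (A (g k)) then g k else t0.
exists e; split => [k|t At]; first by rewrite /e; case: pselect.
by have [k _ gk] := gA t At; exists k; rewrite /e gk; case: pselect.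
Qed.

Section uniform_deviation.
Context d0 {Omega : measurableType d0} {R : realType} {d : nat}
  (P : probability Omega R).
Hypothesis d_gt0 : (0 < d)%N.
Let T := (measurableTypeR R * 'rV[R]_d)%type.
Variable Z : nat -> {RV P >-> T}.
Hypothesis iidZ : iid Z.
Local Notation leb := (@lebesgue_measure R).
Local Notation lebd := (lebesgue_rV R d).
Let nu := distribution P (Z 0%N).
Variable p : T -> R.
Hypotheses (mp : measurable_fun setT p) (p0 : forall z, 0 <= p z)
  (nuE : forall A, measurable A ->
    nu A = (\int[(leb \x lebd)%E]_(z in A) (p z)%:E)%E).
Variable K : 'rV[R]_d -> R.
Hypotheses (mK : measurable_fun setT K)
  (K_int : (\int[lebesgue_rV R d]_s (K s)%:E = 1)%E)
  (K_bounded : (sup_norm setT K < +oo)%E)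
  (K_entropy : polynomial_uniform_entropy K)
  (K_pointwise : pointwise_measurable_class (kernel_class K))
  (K_support : closure [set s | K s != 0] `<=`
    [set s | forall i, - 2^-1 <= s ord0 i <= 2^-1]).
Let kappa := fine (sup_norm setT K).
Let kappa_gt0 : 0 < kappa. Proof. exact: kernel_bound_gt0. Qed.

Variables (I U : set 'rV[R]_d) (A : nat) (rho delta : R).
Hypotheses (IA : forall x, I x -> forall i, `|x ord0 i| <= A%:R)
  (mU : measurable U) (rho_gt0 : 0 < rho) (delta_gt0 : 0 < delta)
  (IU : forall x z, I x -> `|x - z| <= delta -> U z)
  (U_le : forall z, U z -> (\int[leb]_y (p (y, z))%:E <= rho%:E)%E).

(** As eta >= 1 / n, the radius is at least of order 1 / n, so the number of balls
is at most polynomial in n. *)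
Lemma uniform_entropy_bound (phi_bd eps : R) :
  0 < phi_bd -> 0 < eps -> eps <= phi_bd * kappa ->
  exists C : R, exists k : nat, 0 <= C /\
    forall n (eta : R), (0 < n)%N -> n%:R^-1 <= eta -> eta <= 2 ->
    (uniform_covering_number (kernel_class K) (eps * eta / (16 * phi_bd)) <=
      (C * n%:R ^+ k)%:E)%E.
Proof.
move=> Phi0 eps0 eps_le; have [C [nu0 [C0 nu00 hC]]] := K_entropy.
pose c0 := eps / (16 * phi_bd * kappa).
have c00 : 0 < c0 by rewrite divr_gt0 ?mulr_gt0.
exists (C * c0 `^ (- nu0)), (Num.truncn nu0).+1; split.
  by rewrite mulr_ge0 ?powR_ge0// ltW.
move=> n eta n0 eta1 eta2.
have n0' : 0 < n%:R :> R by rewrite ltr0n.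
have n1 : 1 <= n%:R :> R by rewrite ler1n.
have eta0 : 0 < eta by apply: lt_le_trans eta1; rewrite invr_gt0.
have -> : eps * eta / (16 * phi_bd) = kappa * (c0 * eta).
  by rewrite /c0; field; rewrite !gt_eqF.
have ce1 : c0 * eta < 1.
  rewrite /c0 mulrAC ltr_pdivrMr ?mulr_gt0// mul1r.
  have : eps * eta <= phi_bd * kappa * 2 by rewrite ler_pM// ltW.
  have := mulr_gt0 Phi0 kappa_gt0; lra.
apply: (le_trans (hC (c0 * eta) _)); first by rewrite mulr_gt0.
rewrite lee_fin -mulrA ler_pM2l//.
apply: (@le_trans _ _ ((c0 / n%:R) `^ (- nu0))).
  have cn0 : 0 < c0 / n%:R by rewrite divr_gt0.
  have ce0 : 0 < c0 * eta by rewrite mulr_gt0.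
  rewrite !powRN lef_pV2 ?posrE ?powR_gt0//.
  apply: ge0_ler_powR; rewrite ?nnegrE ?ler_pM2l ?(ltW cn0) ?(ltW ce0)//; exact: ltW.
rewrite powRM ?invr_ge0 ?(ltW c00) ?(ltW n0')// ler_pM2l ?powR_gt0//.
rewrite -powR_inv1 ?(ltW n0')// -powRrM mulrN mulN1r opprK -powR_mulrn ?(ltW n0')//.
by apply: ler_powR => //; rewrite ltW// truncnS_gt.
Qed.

Section deviation.
Variables (phi : R -> R) (Phi eps : R) (a b : nat -> R).
Hypotheses (mphi : measurable_fun setT phi) (Phi_gt0 : 0 < Phi)
  (phi_le : forall y, `|phi y| <= Phi) (eps_gt0 : 0 < eps)
  (b_cvg : b n @[n --> \oo] --> 0)
  (a_lim : n%:R * a n / ln n%:R @[n --> \oo] --> +oo).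

(** The Borel-Cantelli lemma applies to [class_deviation] on each block, for a
sequence dense in the class. If h and x violated the conclusion while the local
sums are under control, the function K_h(x - .) would satisfy the three strict
inequalities defining the bad event of its block, and so would some function of
the sequence, all three quantities being continuous under bounded pointwise
convergence. *)
Lemma uniform_deviation :
  {ae P, forall w, \forall n \near \oo, forall h, a n <= h <= b n ->
    forall x, I x ->
      `|\sum_(i <- iota 1 n) phi (Z i w).1 * rescaled_kernel K h (x - (Z i w).2) -
        n%:R * \int[nu]_z (phi z.1 * rescaled_kernel K h (x - z.2))| <=
      eps * (n%:R * h)}.
Proof.
(* The level of the block of h can be as large as 2 h, hence eps / 2. The other
   bound keeps the radius of the covering in the range of the entropy condition. *)
pose e := Num.min (eps / 2) (Phi * kappa).
have e0 : 0 < e by rewrite lt_min divr_gt0//= mulr_gt0.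
have e_le : e <= Phi * kappa by rewrite ge_min lexx orbT.
have e_le2 : e <= eps / 2 by rewrite ge_min lexx.
have [C [k0 [C0 hC]]] := uniform_entropy_bound Phi_gt0 e0 e_le.
have [cls0 [cls0K cls0c cls0d]] := K_pointwise.
have clsK : kernel_class K (fun z => rescaled_kernel K 1 (0 - z)).
  by exists 1, 0; split.
have [g0_ g0_cls _] := cls0d _ clsK.
have [g [gcls0 genum]] := countable_enumeration cls0c (g0_cls 0%N).
have gcls k : kernel_class K (g k) by exact/cls0K/gcls0.
have g_le k z : `|g k z| <= kappa by exact: (kernel_class_le K_bounded).
have mcls := kernel_class_measurable mK.
(* The summands 1 turn the bounds on the mean and on the sum of squares into
   strict inequalities, which survive approximation. *)
pose c1 := 2 ^+ d * kappa ^+ 2 * rho + 1.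
pose c2 := kappa ^+ 2 * (8 * 4 ^+ d * rho) + 1.
have c10 : 0 < c1 by rewrite addr_gt0// !mulr_gt0 ?exprn_gt0.
have c20 : 0 < c2 by rewrite addr_gt0// !mulr_gt0 ?exprn_gt0.
pose lam := Num.min (e / (32 * Phi ^+ 2 * (c2 + 4 * c1))) (4 * (Phi * kappa))^-1.
have den0 : 0 < 32 * Phi ^+ 2 * (c2 + 4 * c1).
  by rewrite !mulr_gt0 ?exprn_gt0// addr_gt0// mulr_gt0.
have lam0 : 0 < lam by rewrite lt_min divr_gt0//= invr_gt0 !mulr_gt0.
have lam1 : 4 * (Phi * kappa) * lam <= 1.
  by rewrite -ler_pdivlMl ?mulr_gt0// mulr1 ge_min lexx orbT.
have lam2 : lam * (32 * Phi ^+ 2 * (c2 + 4 * c1)) <= e.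
  by rewrite -ler_pdivlMr// ge_min lexx.
pose ef k := \int[nu]_z (phi z.1 * g k z.2).
pose Q n (j : 'I_n) k := [set w | \sum_(i <- iota 1 n) g k (Z i w).2 ^+ 2 <= c2 * (n%:R * block j)].
pose D n (j : 'I_n) k := [set w | e * (n%:R * block j) <
  `|\sum_(i <- iota 1 n) phi (Z i w).1 * g k (Z i w).2 - n%:R * ef k|].
pose E n (j : 'I_n) := [set w | exists k, \int[nu]_z (g k z.2 ^+ 2) <= c1 * block j /\
  (Q n j k w /\ D n j k w)].
have mq k : measurable_fun setT (fun z : T => g k z.2 ^+ 2).
  by apply: measurable_funX; apply: measurableT_comp => //; exact: mcls.
have mf k : measurable_fun setT (fun z : T => phi z.1 * g k z.2).
  apply: measurable_funM; first exact: (measurableT_comp mphi).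
  by apply: measurableT_comp => //; exact: mcls.
have mE n j : measurable (@E n j).
  rewrite (_ : E n j = \bigcup_(k in [set k | \int[nu]_z (g k z.2 ^+ 2) <= c1 * block j])
      (Q n j k `&` D n j k)); last first.
    by apply/seteqP; split => w /= [k]; [case; exists k|move=> *; exists k].
  apply: bigcup_measurable => k _; apply: measurableI.
    by apply: measurable_set_le => //; exact: (measurable_sum_sample Z (iota 1 n) (mq k)).
  apply: measurable_set_lt => //; apply: measurableT_comp => //.
  by apply: measurable_funB => //; exact: (measurable_sum_sample Z (iota 1 n) (mf k)).
pose F n := \big[setU/set0]_(j : 'I_n | a n <= block j) E n j.
have mF n : measurable (F n) by apply: bigsetU_measurable => j _; exact: mE.
have PF : \forall n \near \oo, (P (F n) <= (n%:R ^- 2)%:E)%E.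
  have hp := poly_expR_le_inv_sqr (4 * (C + 1)) k0.+1 (divr_gt0 (mulr_gt0 lam0 e0) (ltr0n R 8)) a_lim.
  have h1 := diverge_over_ln (2 * kappa ^+ 2 / c1) a_lim.
  have h2 := diverge_over_ln (12 / (lam * e)) a_lim.
  near=> n.
  have n0 : (0 < n)%N by near: n; exact: nbhs_infty_gt.
  have n1 : 1 <= n%:R :> R by rewrite ler1n.
  have PE (j : 'I_n) : a n <= block j ->
    (P (E n j) <= (4 * (C * n%:R ^+ k0 + 1) * expR (- (lam * e / 8 * (n%:R * a n))))%:E)%E.
    move=> aj.
    have naj : n%:R * a n <= n%:R * block j by rewrite ler_wpM2l.
    have q1 : 2 * kappa ^+ 2 / c1 <= n%:R * block j by apply: le_trans naj; near: n.
    have q2 : 12 / (lam * e) <= n%:R * block j by apply: le_trans naj; near: n.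
    have covN := hC n (block j) n0 (block_geV j) (block_le2 j).
    have N0 : 0 <= C * n%:R ^+ k0 by rewrite mulr_ge0// exprn_ge0.
    have := class_deviation iidZ mphi Phi_gt0 phi_le kappa_gt0 mcls gcls g_le (n := n.-1)
      N0 (block_gt0 j) c10 c20 e0 lam0 lam1 lam2 covN.
    rewrite (prednK n0) => h; apply: le_trans (h _ _) _.
    - by rewrite -ler_pdivrMr.
    - by rewrite -mulrA -ler_pdivrMr// mulr_gt0.
    rewrite lee_fin ler_wpM2l//; first by rewrite mulr_ge0// addr_ge0.
    by rewrite ler_expR mulNr lerN2 ler_wpM2l// divr_ge0// ltW// mulr_gt0.
  apply: le_trans (measure_finite_union_le (mE n) _ PE) _.
    by rewrite mulr_ge0 ?expR_ge0// mulr_ge0// addr_ge0// mulr_ge0// exprn_ge0.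
  rewrite lee_fin card_ord.
  apply: (@le_trans _ _ (4 * (C + 1) * n%:R ^+ k0.+1 * expR (- (lam * e / 8 * (n%:R * a n))))); last by near: n.
  rewrite mulrA ler_wpM2r ?expR_ge0// exprS.
  have : 1 <= n%:R ^+ k0 :> R by rewrite exprn_ege1.
  have -> : n%:R * (4 * (C * n%:R ^+ k0 + 1)) = 4 * n%:R * (C * n%:R ^+ k0 + 1) by ring.
  have -> : 4 * (C + 1) * (n%:R * n%:R ^+ k0) = 4 * n%:R * (C * n%:R ^+ k0 + n%:R ^+ k0) by ring.
  by move=> hk; rewrite ler_wpM2l ?mulr_ge0// lerD2l.
have BC := borel_cantelli_inv_sqr mF PF.
have LS : {ae P, forall w, \forall n \near \oo, forall h, a n <= h <= 1 -> 1 <= n%:R * h ->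
    forall x, I x ->
      \sum_(i <- iota 1 n) 1 *
        \1_(U `&` [set z | `|x - z| <= h `^ d%:R^-1]) (Z i w).2 <=
      8 * 4 ^+ d * rho * (n%:R * h)}.
  apply: (local_sums_bound d_gt0 iidZ mp p0 nuE (psi := fun _ _ => 1) (B := fun=> 1) IA mU rho_gt0) => //.
  - by move=> _ _; rewrite ler01 lexx.
  - by move=> _ z Uz; under eq_integral do rewrite mul1r; exact: U_le.
  - by under eq_fun do rewrite divr1.
apply: filterS2 BC LS => w hF hLS.
have hna := diverge_over_ln 1 a_lim.
have hb1 : \forall n \near \oo, b n <= 1.
  by near=> n; rewrite ltW//; near: n; exact: (cvgr_lt 0).
have hbd : \forall n \near \oo, b n <= delta ^+ d.
  by near=> n; rewrite ltW//; near: n; apply: (cvgr_lt 0) => //; exact: exprn_gt0.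
near=> n => h /andP[ah hb] x Ix.
have n0 : (0 < n)%N by near: n; exact: nbhs_infty_gt.
have n0' : 0 < n%:R :> R by rewrite ltr0n.
have nF : ~ F n w by near: n.
have h1 : h <= 1 by apply: (le_trans hb); near: n.
have nh1 : 1 <= n%:R * h.
  by apply: (@le_trans _ _ (n%:R * a n)); [near: n|rewrite ler_pM2l].
have h0 : 0 < h by have := lt_le_trans ltr01 nh1; rewrite pmulr_rgt0.
have hd : h `^ d%:R^-1 <= delta.
  rewrite -(ler_pXn2r d_gt0) ?nnegrE ?powR_ge0 ?(ltW delta_gt0)// bandwidth_power//.
  by apply: (le_trans hb); near: n.
have ahh : a n <= h <= 1 by rewrite ah.
have cnt : \sum_(i <- iota 1 n) 1 * \1_(U `&` [set z | `|x - z| <= h `^ d%:R^-1]) (Z i w).2 <=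
      8 * 4 ^+ d * rho * (n%:R * h).
  by move: h ahh nh1 x Ix {ah hb h1 h0 hd}; near: n.
have [j /andP[hj jh]] := bandwidth_in_block nh1 h1.
have nE : ~ E n j w.
  move=> Ew; apply: nF; rewrite /F -bigcup_seq_cond; exists j => //=.
  by rewrite mem_index_enum (le_trans ah).
rewrite leNgt; apply/negP => dev; apply: nE.
pose V := U `&` [set z | `|x - z| <= h `^ d%:R^-1].
have mV : measurable V by apply: measurableI => //; exact: closed_ball_measurable_rV.
pose g0 z := rescaled_kernel K h (x - z).
have g0K : kernel_class K g0 by exists h, x.
have g0sq z : g0 z ^+ 2 <= kappa ^+ 2 * \1_V z.
  have [->|gz] := eqVneq (g0 z) 0; first by rewrite expr0n/= mulr_ge0// exprn_ge0// ltW.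
  have xz := rescaled_kernel_support K_support h0 gz.
  rewrite indicE mem_set ?mulr1; last first.
    by split => //; apply: (IU Ix); exact: le_trans hd.
  by have /ler_normlP[] := kernel_class_le K_bounded z g0K; rewrite -/kappa; nra.
have jh0 : 0 < block j :> R by exact: block_gt0.
have q_lt : \int[nu]_z (g0 z.2 ^+ 2) < c1 * block j.
  apply: (@le_lt_trans _ _ (kappa ^+ 2 * (2 ^+ d * rho * h))); last first.
    rewrite /c1 mulrDl mul1r (_ : kappa ^+ 2 * _ = 2 ^+ d * kappa ^+ 2 * rho * h); last by ring.
    apply: (@le_lt_trans _ _ (2 ^+ d * kappa ^+ 2 * rho * block j)); last by rewrite ltrDl.
    by apply: ler_wpM2l => //; rewrite ltW// !mulr_gt0// exprn_gt0.
  have mV2 : measurable_fun setT (fun z : T => 1 * \1_V z.2 : R).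
    by apply: measurable_funM => //; apply: measurableT_comp => //; exact: measurable_indic.
  have iV : nu.-integrable setT (EFin \o (fun z : T => 1 * \1_V z.2 : R)).
    apply: (@prob_bounded_integrable _ _ _ _ _ 1 mV2) => z.
    by rewrite mul1r indicE; case: (_ \in _); rewrite ?normr1 ?normr0.
  apply: (@le_trans _ _ (\int[nu]_z (kappa ^+ 2 * (1 * \1_V z.2)))).
    apply: le_Rintegral => //.
    - apply: (@prob_bounded_integrable _ _ _ _ _ (kappa ^+ 2)).
        apply: measurable_funX; apply: measurableT_comp => //.
        exact: (mcls _ g0K).
      move=> z; rewrite normrX lerXn2r ?nnegrE ?(ltW kappa_gt0)//.
      exact: (kernel_class_le K_bounded).
    - exact: (integrableZl measurableT (kappa ^+ 2) iV).
    by move=> z _; rewrite mul1r; exact: g0sq.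
  rewrite (RintegralZl _ measurableT iV) ler_wpM2l ?exprn_ge0 ?(ltW kappa_gt0)//.
  rewrite -lee_fin -EFin_Rintegral_prob//.
  have -> : 2 ^+ d * rho * h = rho * (2 * h `^ d%:R^-1) ^+ d.
    by rewrite exprMn bandwidth_power// mulrCA mulrA.
  apply: (@local_mass _ _ nu p mp p0 nuE (fun=> 1)) => //.
  - exact: ltW.
  - exact: powR_ge0.
  - by move=> z Uz; under eq_integral do rewrite mul1r; exact: U_le.
have s_lt : \sum_(i <- iota 1 n) g0 (Z i w).2 ^+ 2 < c2 * (n%:R * block j).
  apply: (@le_lt_trans _ _ (kappa ^+ 2 * (8 * 4 ^+ d * rho * (n%:R * h)))).
    apply: (@le_trans _ _ (kappa ^+ 2 * \sum_(i <- iota 1 n) 1 * \1_V (Z i w).2)).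
      by rewrite mulr_sumr; apply: ler_sum => i _; rewrite mul1r; exact: g0sq.
    by rewrite ler_wpM2l ?exprn_ge0 ?(ltW kappa_gt0).
  have -> : c2 * (n%:R * block j) = kappa ^+ 2 * (8 * 4 ^+ d * rho) * (n%:R * block j) +
    n%:R * block j by rewrite /c2; ring.
  rewrite (_ : kappa ^+ 2 * (8 * 4 ^+ d * rho * (n%:R * h)) =
    kappa ^+ 2 * (8 * 4 ^+ d * rho) * (n%:R * h)); last by ring.
  apply: (@le_lt_trans _ _ (kappa ^+ 2 * (8 * 4 ^+ d * rho) * (n%:R * block j))).
    apply: ler_wpM2l; first by rewrite ltW// !mulr_gt0// exprn_gt0.
    by rewrite ler_pM2l.
  by rewrite ltrDl mulr_gt0.
have d_lt : e * (n%:R * block j) < `|\sum_(i <- iota 1 n) phi (Z i w).1 * g0 (Z i w).2 -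
    n%:R * \int[nu]_z (phi z.1 * g0 z.2)|.
  apply: le_lt_trans dev.
  apply: (@le_trans _ _ (eps / 2 * (n%:R * (2 * h)))); last first.
    by rewrite le_eqVlt; apply/orP; left; apply/eqP; field.
  apply: ler_pM => //; first exact: ltW.
    by rewrite ltW// mulr_gt0.
  by rewrite ler_pM2l.
have [gm gm0 gm_cvg] := cls0d _ g0K.
have gmK m : kernel_class K (gm m) by exact/cls0K/gm0.
have qc : \int[nu]_z (gm m z.2 ^+ 2) @[m --> \oo] --> \int[nu]_z (g0 z.2 ^+ 2).
  apply: (@bounded_Rintegral_cvg _ _ _ nu _ _ (kappa ^+ 2)).
  - by move=> m; apply: measurable_funX; apply: measurableT_comp => //; exact: (mcls _ (gmK m)).
  - by apply: measurable_funX; apply: measurableT_comp => //; exact: (mcls _ g0K).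
  - move=> m z; rewrite normrX lerXn2r ?nnegrE ?(ltW kappa_gt0)//.
    exact: (kernel_class_le K_bounded).
  - by move=> z; apply: cvgM; exact: gm_cvg.
have fc : \int[nu]_z (phi z.1 * gm m z.2) @[m --> \oo] --> \int[nu]_z (phi z.1 * g0 z.2).
  apply: (@bounded_Rintegral_cvg _ _ _ nu _ _ (Phi * kappa)).
  - move=> m; apply: measurable_funM; first exact: (measurableT_comp mphi).
    by apply: measurableT_comp => //; exact: (mcls _ (gmK m)).
  - apply: measurable_funM; first exact: (measurableT_comp mphi).
    by apply: measurableT_comp => //; exact: (mcls _ g0K).
  - move=> m z; rewrite normrM ler_pM//.
    exact: (kernel_class_le K_bounded).
  - by move=> z; apply: cvgM; [exact: cvg_cst|exact: gm_cvg].
have sc : \sum_(i <- iota 1 n) gm m (Z i w).2 ^+ 2 @[m --> \oo] -->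
    \sum_(i <- iota 1 n) g0 (Z i w).2 ^+ 2.
  by apply: cvg_finite_sum => i; apply: cvgM; exact: gm_cvg.
have dc : `|\sum_(i <- iota 1 n) phi (Z i w).1 * gm m (Z i w).2 -
      n%:R * \int[nu]_z (phi z.1 * gm m z.2)| @[m --> \oo] -->
    `|\sum_(i <- iota 1 n) phi (Z i w).1 * g0 (Z i w).2 -
      n%:R * \int[nu]_z (phi z.1 * g0 z.2)|.
  apply: cvg_norm; apply: cvgB.
    by apply: cvg_finite_sum => i; apply: cvgM; [exact: cvg_cst|exact: gm_cvg].
  by apply: cvgM => //; exact: cvg_cst.
have [m [m1 m2 m3]] : exists m, [/\ \int[nu]_z (gm m z.2 ^+ 2) < c1 * block j,
    \sum_(i <- iota 1 n) gm m (Z i w).2 ^+ 2 < c2 * (n%:R * block j) &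
    e * (n%:R * block j) < `|\sum_(i <- iota 1 n) phi (Z i w).1 * gm m (Z i w).2 -
      n%:R * \int[nu]_z (phi z.1 * gm m z.2)|].
  have F1 : \forall m \near \oo, \int[nu]_z (gm m z.2 ^+ 2) < c1 * block j.
    exact: (cvgr_lt _ qc _ q_lt).
  have F2 : \forall m \near \oo, \sum_(i <- iota 1 n) gm m (Z i w).2 ^+ 2 < c2 * (n%:R * block j).
    exact: (cvgr_lt _ sc _ s_lt).
  have F3 : \forall m \near \oo, e * (n%:R * block j) <
      `|\sum_(i <- iota 1 n) phi (Z i w).1 * gm m (Z i w).2 -
        n%:R * \int[nu]_z (phi z.1 * gm m z.2)|.
    exact: (cvgr_gt _ dc _ d_lt).
  have [[N1 _ H1] [N2 _ H2] [N3 _ H3]] := And3 F1 F2 F3.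
  exists (maxn N1 (maxn N2 N3)); split.
  - by apply: H1; rewrite /= leq_maxl.
  - by apply: H2; rewrite /= leq_max leq_maxl orbT.
  - by apply: H3; rewrite /= !leq_max leqnn !orbT.
have [k gk] := genum _ (gm0 m).
by exists k; rewrite /Q /D /= /ef gk; split; [exact: ltW|split => //; exact: ltW].
Unshelve. all: end_near. Qed.

End deviation.
End uniform_deviation.

(** * Consistency from a control of large responses *)

Section compact_neighborhood.
Context {R : realType} {d : nat}.
Let T := (measurableTypeR R * 'rV[R]_d)%type.
Local Notation leb := (@lebesgue_measure R).
Variables (p : T -> R) (I : set 'rV[R]_d) (eps : R).
Hypotheses (mp : measurable_fun setT p) (p0 : forall z, 0 <= p z)
  (cI : compact I) (eps_gt0 : 0 < eps).
Let J := closed_neighborhood eps I.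
Hypotheses (f_cont : {within J, continuous (marginal_density p)})
  (f_pos : forall z, J z -> 0 < marginal_density p z)
  (p_cont : forall z, J z ->
     {ae leb, forall y : measurableTypeR R, p (y, z') @[z' --> z] --> p (y, z)}).

Lemma marginal_EFin z : J z ->
  (\int[leb]_y (p (y, z))%:E = (marginal_density p z)%:E)%E.
Proof.
move=> Jz; rewrite /marginal_density /Rintegral fineK//.
exact: (integrable_fin_num measurableT (section_integrable mp p0 (f_pos Jz))).
Qed.

Lemma compact_coordinates_bounded : exists A : nat, forall x, I x ->
  forall i, `|x ord0 i| <= A%:R.
Proof.
have [M [_ hM]] := compact_bounded cI.
exists (Num.truncn (`|M| + 1)).+1 => x Ix i.
apply: le_trans (coord_norm_le x i) _.
apply: le_trans (hM (`|M| + 1) _ x Ix) _.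
  by rewrite (le_lt_trans (ler_norm M))// ltrDl.
by rewrite ltW// truncnS_gt.
Qed.

(** U is the open neighborhood of I on which p(., z) is within L1-distance 1 of a
section over I: this distance turns the maximum of f on I into the bound rho. *)
Lemma density_neighborhood : exists (U : set 'rV[R]_d) (rho delta : R),
  [/\ measurable U, 0 < rho, 0 < delta,
      forall x z, I x -> `|x - z| <= delta -> U z &
      forall z, U z -> J z /\ marginal_density p z <= rho].
Proof.
have [B B0 hB] := marginal_bounded_above mp p0 cI eps_gt0 f_cont f_pos p_cont.
have := L1_uniform_continuity mp p0 cI eps_gt0 f_cont f_pos p_cont (@ltr01 R).
move=> h; have : \forall delta \near 0^'+, 0 < delta /\ (forall x, I x ->
    forall z, `|x - z| <= delta ->
    J z /\ \int[leb]_y `|p (y, z) - p (y, x)| <= 1).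
  by near=> delta; split; near: delta => //; exact: nbhs_right_gt.
move=> /filter_ex[delta [delta0 hd]].
pose U := \bigcup_(x in I) [set z : 'rV[R]_d | `|x - z| < delta].
exists U, (B + 1), (delta / 2); split.
- apply: open_measurable_rV; apply: bigcup_open => x _.
  rewrite (_ : [set _ | _] = ball x delta); first exact: ball_open.
  by apply/seteqP; split => z; rewrite -ball_normE.
- by rewrite addr_gt0.
- by rewrite divr_gt0.
- move=> x z Ix xz; exists x => //=; apply: le_lt_trans xz _.
  by rewrite ltr_pdivrMr// ltr_pMr// ltr1n.
- move=> z [x Ix /= /ltW xz]; have [Jz hz] := hd x Ix z xz; split => //.
  have Jx : J x by exists x => //; rewrite subrr normr0 ltW.
  have /ler_normlP[_ h1] := le_trans (marginal_lipschitz mp p0 (f_pos Jx) (f_pos Jz)) hz.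
  by rewrite -lerBlDl (le_trans _ h1)// lerB// hB.
Unshelve. all: end_near. Qed.

End compact_neighborhood.

Section truncation.
Context {R : realType}.

Definition truncate (tau y : R) : R := y * \1_[set t | `|t| <= tau] y.

Lemma measurable_truncate tau : measurable_fun setT (truncate tau).
Proof.
apply: measurable_funM => //; apply: measurable_indic.
by apply: measurable_set_le => //; exact: measurableT_comp.
Qed.

Lemma truncate_le tau y : 0 < tau -> `|truncate tau y| <= tau.
Proof.
move=> tau0; rewrite /truncate indicE.
have [|] := boolP (y \in _); last by rewrite mulr0 normr0 ltW.
by rewrite inE /= mulr1.
Qed.

Lemma truncate_tail tau y : y - truncate tau y = y * \1_[set t | tau < `|t|] y.
Proof.
rewrite /truncate !indicE; have [yt|yt] := leP `|y| tau.
  by rewrite mem_set// memNset/= ?mulr0 ?mulr1 ?subrr//; apply/negP; rewrite -leNgt.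
by rewrite memNset/= ?mem_set ?mulr0 ?mulr1 ?subr0//; apply/negP; rewrite -ltNge.
Qed.

Lemma measurable_tail (tau : R) :
  measurable_fun setT (\1_[set t : R | tau < `|t|] : R -> R).
Proof.
by apply: measurable_indic; apply: measurable_set_lt => //; exact: measurableT_comp.
Qed.

End truncation.

Section consistency.
Context d0 {Omega : measurableType d0} {R : realType} {d : nat}
  (P : probability Omega R).
Hypothesis d_gt0 : (0 < d)%N.
Let T := (measurableTypeR R * 'rV[R]_d)%type.
Variable Z : nat -> {RV P >-> T}.
Hypothesis iidZ : iid Z.
Local Notation leb := (@lebesgue_measure R).
Local Notation lebd := (lebesgue_rV R d).
Let nu := distribution P (Z 0%N).
Variable p : T -> R.
Hypotheses (mp : measurable_fun setT p) (p0 : forall z, 0 <= p z)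
  (nuE : forall A, measurable A ->
    nu A = (\int[(leb \x lebd)%E]_(z in A) (p z)%:E)%E).
Variable K : 'rV[R]_d -> R.
Hypotheses (mK : measurable_fun setT K)
  (K_int : (\int[lebesgue_rV R d]_s (K s)%:E = 1)%E)
  (K_bounded : (sup_norm setT K < +oo)%E)
  (K_entropy : polynomial_uniform_entropy K)
  (K_pointwise : pointwise_measurable_class (kernel_class K))
  (K_support : closure [set s | K s != 0] `<=`
    [set s | forall i, - 2^-1 <= s ord0 i <= 2^-1]).
Let kappa := fine (sup_norm setT K).
Let kappa_gt0 : 0 < kappa. Proof. exact: kernel_bound_gt0. Qed.
Variables (I : set 'rV[R]_d) (eps : R).
Hypotheses (cI : compact I) (eps_gt0 : 0 < eps).
Let J := closed_neighborhood eps I.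
Hypotheses (f_cont : {within J, continuous (marginal_density p)})
  (f_pos : forall z, J z -> 0 < marginal_density p z)
  (p_cont : forall z, J z ->
     {ae leb, forall y : measurableTypeR R, p (y, z') @[z' --> z] --> p (y, z)}).
Variables (a b : nat -> R).
Hypotheses (b_cvg : b n @[n --> \oo] --> 0)
  (a_lim : n%:R * a n / ln n%:R @[n --> \oo] --> +oo).

Let IJ x : I x -> J x.
Proof. by move=> Ix; exists x => //; rewrite subrr normr0 ltW. Qed.

(** As n a_n is eventually at least 1, a_n is positive; the upper bound is the
convergence of b_n to 0. *)
Lemma bandwidth_range (delta : R) : 0 < delta ->
  \forall n \near \oo, forall h, a n <= h <= b n -> 0 < h /\ h `^ d%:R^-1 <= delta.
Proof.
move=> delta0.
have hna := diverge_over_ln 1 a_lim.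
have hbd : \forall n \near \oo, b n <= delta ^+ d.
  by near=> n; rewrite ltW//; near: n; apply: (cvgr_lt 0) => //; exact: exprn_gt0.
near=> n => h /andP[ah hb].
have n0 : (0 < n)%N by near: n; exact: nbhs_infty_gt.
have na : 1 <= n%:R * a n by near: n.
have h0 : 0 < h.
  by apply: lt_le_trans ah; have := lt_le_trans ltr01 na; rewrite pmulr_rgt0 ?ltr0n.
split => //.
rewrite -(ler_pXn2r d_gt0) ?nnegrE ?powR_ge0 ?(ltW delta0)// bandwidth_power//.
by apply: (le_trans hb); near: n.
Unshelve. all: end_near. Qed.

(** Half of eta goes to the deviation and half to the bias; the L1-modulus eta' is
chosen so that the latter is exactly eta / 2 times h. *)
Lemma uniform_law (phi : R -> R) (Phi eta : R) :
  measurable_fun setT phi -> 0 < Phi -> (forall y, `|phi y| <= Phi) -> 0 < eta ->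
  {ae P, forall w, \forall n \near \oo, forall h, a n <= h <= b n ->
    forall x, I x ->
      `|\sum_(i <- iota 1 n) phi (Z i w).1 * rescaled_kernel K h (x - (Z i w).2) -
        n%:R * h * weighted_density p phi x| <= eta * (n%:R * h)}.
Proof.
move=> mphi Phi0 phi_le eta0.
have [U [rho [delta [mU rho0 delta0 IU hU]]]] :=
  density_neighborhood mp p0 cI eps_gt0 f_cont f_pos p_cont.
have [A IA] := compact_coordinates_bounded cI.
have U_le z : U z -> (\int[leb]_y (p (y, z))%:E <= rho%:E)%E.
  by move=> /hU[Jz fz]; rewrite (marginal_EFin mp p0 f_pos Jz) lee_fin.
have eta2 : 0 < eta / 2 by rewrite divr_gt0.
have := uniform_deviation d_gt0 iidZ mp p0 nuE mK K_int K_bounded K_entropy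
  K_pointwise K_support IA mU rho0 delta0 IU U_le mphi Phi0 phi_le eta2 b_cvg a_lim.
pose eta' := eta / 2 / (kappa * Phi * 2 ^+ d).
have eta'0 : 0 < eta' by rewrite divr_gt0// !mulr_gt0// exprn_gt0.
have L1 := L1_uniform_continuity mp p0 cI eps_gt0 f_cont f_pos p_cont eta'0.
have : \forall r \near 0^'+, 0 < r /\ (forall x, I x -> forall z, `|x - z| <= r ->
    J z /\ \int[leb]_y `|p (y, z) - p (y, x)| <= eta').
  by near=> r; split; near: r => //; exact: nbhs_right_gt.
move=> /filter_ex[r [r0 hr]].
have hrange := bandwidth_range r0.
apply: filterS => w hw; near=> n => h hab x Ix.
have n0 : (0 < n)%N by near: n; exact: nbhs_infty_gt.
have [h0 hd] : 0 < h /\ h `^ d%:R^-1 <= r by move: h hab; near: n.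
have dev : `|\sum_(i <- iota 1 n) phi (Z i w).1 * rescaled_kernel K h (x - (Z i w).2) -
        n%:R * \int[nu]_z (phi z.1 * rescaled_kernel K h (x - z.2))| <=
      eta / 2 * (n%:R * h) by move: h hab h0 hd x Ix; near: n; apply: filterS hw => n hw h hab _ _; exact: hw.
have bias : `|\int[nu]_z (phi z.1 * rescaled_kernel K h (x - z.2)) -
    weighted_density p phi x * h| <= eta / 2 * h.
  have := @local_expectation_bias _ _ nu p mp p0 nuE phi Phi
    (fun z => rescaled_kernel K h (x - z)) kappa (h `^ d%:R^-1) eta' x mphi phi_le
    (rescaled_kernel_measurable mK h x) _ (powR_ge0 _ _) _ (f_pos (IJ Ix)) _.
  rewrite (rescaled_kernel_integral d_gt0 mK K_int)// exprMn bandwidth_power//.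
  rewrite (_ : kappa * (Phi * eta') * (2 ^+ d * h) = eta / 2 * h); last first.
    by rewrite /eta'; field; rewrite !gt_eqF// exprn_gt0.
  apply.
  - by move=> z; exact: (kernel_le K_bounded).
  - by move=> z; exact: (rescaled_kernel_support K_support).
  - move=> z xz; have [Jz hz] := hr x Ix z (le_trans xz hd).
    by split => //; exact: f_pos.
rewrite (_ : _ - _ = (\sum_(i <- iota 1 n) phi (Z i w).1 * rescaled_kernel K h (x - (Z i w).2) -
        n%:R * \int[nu]_z (phi z.1 * rescaled_kernel K h (x - z.2))) +
   n%:R * (\int[nu]_z (phi z.1 * rescaled_kernel K h (x - z.2)) -
    weighted_density p phi x * h)); last by ring.
apply: le_trans (ler_normD _ _) _.
rewrite normrM ger0_norm//.
rewrite [leRHS](_ : _ = eta / 2 * (n%:R * h) + n%:R * (eta / 2 * h)); last by field.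
by rewrite lerD// ler_wpM2l.
Unshelve. all: end_near. Qed.

(** With N and D the numerator and the denominator, N / D - m = (N - m D) / D. Here
D >= n h c / 2, where c is a positive lower bound of f on I, and N - m D is small because N
and D are close to n h g and n h f, with g close to m f by hypothesis. *)
Lemma uniform_consistency (m : 'rV[R]_d -> R) (M0 : R) :
  0 <= M0 -> (forall x, I x -> `|m x| <= M0) ->
  (forall eta, 0 < eta -> exists2 tau, 0 < tau &
    (forall x, I x -> `|weighted_density p (truncate tau) x - m x * marginal_density p x| <= eta) /\
    {ae P, forall w, \forall n \near \oo, forall h, a n <= h <= b n -> forall x, I x ->
      `|\sum_(i <- iota 1 n) ((Z i w).1 - truncate tau (Z i w).1) *
          rescaled_kernel K h (x - (Z i w).2)| <= eta * (n%:R * h)}) ->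
  forall e, 0 < e ->
  {ae P, forall w, \forall n \near \oo, forall h, a n <= h <= b n -> forall x, I x ->
    `|nadaraya_watson K (fun i => (Z i w).1 : R) (fun i => (Z i w).2) n h x - m x| <= e}.
Proof.
move=> M00 mM trunc e e0.
have [c c0 hc] := marginal_bounded_below mp p0 cI eps_gt0 f_cont f_pos p_cont.
pose eta := Num.min (c / 4) (e * c / (2 * (4 + 2 * M0))).
have M1 : 0 < 2 * (4 + 2 * M0) by lra.
have eta0 : 0 < eta by rewrite lt_min !divr_gt0// mulr_gt0.
have eta1 : eta <= c / 4 by rewrite ge_min lexx.
have eta2 : (4 + 2 * M0) * eta <= e * (c / 2).
  have : eta <= e * c / (2 * (4 + 2 * M0)) by rewrite ge_min lexx orbT.
  by rewrite ler_pdivlMr//; lra.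
have [tau tau0 [hm tail]] := trunc eta eta0.
have LY := uniform_law (measurable_truncate tau) tau0 (fun y => truncate_le y tau0) eta0.
have L1 : {ae P, forall w, \forall n \near \oo, forall h, a n <= h <= b n ->
    forall x, I x ->
      `|\sum_(i <- iota 1 n) 1 * rescaled_kernel K h (x - (Z i w).2) -
        n%:R * h * weighted_density p (fun=> 1) x| <= eta * (n%:R * h)}.
  by apply: (uniform_law (phi := fun=> 1) (Phi := 1)) => // y; rewrite normr1.
have hrange := bandwidth_range (@ltr01 R).
apply: filterS3 tail LY L1 => w tail_w LY_w L1_w.
near=> n => h hab x Ix.
have n0 : (0 < n)%N by near: n; exact: nbhs_infty_gt.
have [h0 _] : 0 < h /\ h `^ d%:R^-1 <= 1 by move: h hab; near: n.
have nh0 : 0 < n%:R * h by rewrite mulr_gt0// ltr0n.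
have t1 : `|\sum_(i <- iota 1 n) ((Z i w).1 - truncate tau (Z i w).1) *
          rescaled_kernel K h (x - (Z i w).2)| <= eta * (n%:R * h).
  by move: h hab h0 nh0 x Ix; near: n; apply: filterS tail_w => n H h hab _ _; exact: H.
have t2 : `|\sum_(i <- iota 1 n) truncate tau (Z i w).1 * rescaled_kernel K h (x - (Z i w).2) -
        n%:R * h * weighted_density p (truncate tau) x| <= eta * (n%:R * h).
  by move: h hab h0 nh0 x Ix {t1}; near: n; apply: filterS LY_w => n H h hab _ _; exact: H.
have t3 : `|\sum_(i <- iota 1 n) 1 * rescaled_kernel K h (x - (Z i w).2) -
        n%:R * h * weighted_density p (fun=> 1) x| <= eta * (n%:R * h).
  by move: h hab h0 nh0 x Ix {t1 t2}; near: n; apply: filterS L1_w => n H h hab _ _; exact: H.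
have t4 := hm x Ix; have fc := hc x Ix; have mx := mM x Ix.
rewrite /nadaraya_watson /index_iota subn1 /=.
set N := \sum_(i <- iota 1 n) _; set D := \sum_(i <- iota 1 n) _.
set f := marginal_density p x in fc t4 *; set g := weighted_density p (truncate tau) x in t2 t4 *.
have {t1 t2}tN : `|N - n%:R * h * g| <= 2 * eta * (n%:R * h).
  have NE : N = \sum_(i <- iota 1 n) ((Z i w).1 - truncate tau (Z i w).1) *
      rescaled_kernel K h (x - (Z i w).2) +
      \sum_(i <- iota 1 n) truncate tau (Z i w).1 * rescaled_kernel K h (x - (Z i w).2).
    by rewrite -big_split; apply: eq_bigr => i _ /=; rewrite -mulrDl subrK.
  rewrite NE -addrA; apply: le_trans (ler_normD _ _) _.
  rewrite (_ : 2 * eta * (n%:R * h) = eta * (n%:R * h) + eta * (n%:R * h)); last by ring.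
  exact: lerD.
have {t3}tD : `|D - n%:R * h * f| <= eta * (n%:R * h).
  by move: t3; rewrite -marginal_weighted; under eq_bigr do rewrite mul1r.
have D_ge : n%:R * h * (c / 2) <= D.
  have : n%:R * h * c <= n%:R * h * f by rewrite ler_pM2l.
  have : eta * (n%:R * h) <= c / 4 * (n%:R * h) by rewrite ler_pM2r.
  by move: tD => /ler_normlP[]; nra.
have D0 : 0 < D by apply: lt_le_trans D_ge; rewrite mulr_gt0// divr_gt0.
have -> : N / D - m x = (N - m x * D) / D by field; rewrite gt_eqF.
rewrite normrM normfV (gtr0_norm D0) ler_pdivrMr//.
apply: (@le_trans _ _ ((4 + 2 * M0) * eta * (n%:R * h))); last first.
  apply: (@le_trans _ _ (e * (c / 2) * (n%:R * h))); first by rewrite ler_pM2r.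
  by rewrite -mulrA ler_pM2l// mulrC.
rewrite (_ : N - m x * D = (N - n%:R * h * g) + (n%:R * h * (g - m x * f) - m x * (D - n%:R * h * f))); last by ring.
apply: le_trans (ler_normD _ _) _.
have s1 : `|n%:R * h * (g - m x * f)| <= n%:R * h * eta.
  by rewrite normrM (gtr0_norm nh0) ler_pM2l.
have s2 : `|m x * (D - n%:R * h * f)| <= M0 * (eta * (n%:R * h)) by rewrite normrM ler_pM.
rewrite (_ : (4 + 2 * M0) * eta * (n%:R * h) = 2 * eta * (n%:R * h) +
  (n%:R * h * eta + M0 * (eta * (n%:R * h))) + (1 + M0) * (eta * (n%:R * h))); last by ring.
apply: (@le_trans _ _ (2 * eta * (n%:R * h) + (n%:R * h * eta + M0 * (eta * (n%:R * h))))).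
  by rewrite lerD// (le_trans (ler_normB _ _))// lerD.
by rewrite lerDl !mulr_ge0 ?addr_ge0 ?(ltW eta0) ?(ltW h0).
Unshelve. all: end_near. Qed.

End consistency.

Section supremum.
Context {R : realType} {d : nat}.

Lemma ereal_sup_bandwidth_cvg0 (I : set 'rV[R]_d) (F : nat -> R -> 'rV[R]_d -> R)
    (a b : nat -> R) :
  (\forall n \near \oo, a n <= b n) ->
  (forall k : nat, \forall n \near \oo, forall h, a n <= h <= b n ->
    forall x, I x -> `|F n h x| <= k.+1%:R^-1) ->
  ereal_sup [set sup_norm I (F n h) | h in `[a n, b n]] @[n --> \oo] --> 0%E.
Proof.
move=> ab hF.
pose S n := ereal_sup [set sup_norm I (F n h) | h in `[a n, b n]].
have S_le k : \forall n \near \oo, (0 <= S n <= (k.+1%:R^-1)%:E)%E.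
  near=> n; apply/andP; split.
    have abn : a n <= b n by near: n.
    apply: (@le_trans _ _ (sup_norm I (F n (a n)))).
      by apply: ereal_sup_ubound; left.
    by apply: ereal_sup_ubound; exists (a n) => //=; rewrite in_itv/= lexx.
  apply: ge_ereal_sup => _ [h /= hab <-]; apply: ge_ereal_sup => _ [->|[x Ix <-]].
    by rewrite lee_fin invr_ge0.
  rewrite lee_fin; move: h hab x Ix; near: n.
  by apply: filterS (hF k) => n H h hab x Ix; apply: H.
rewrite -/S; apply/fine_cvgP; split.
  apply: filterS (S_le 0%N) => n /andP[S0 S1].
  by rewrite ge0_fin_numE// (le_lt_trans S1)// ltry.
apply/cvgr0Pnorm_le => e e0.
near=> n; have h : (0 <= S n <= ((Num.truncn e^-1).+1%:R^-1)%:E)%E by near: n; exact: S_le.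
have /andP[S0 S1] := h.
rewrite /= ger0_norm ?fine_ge0//.
have Sfin : S n \is a fin_num by rewrite ge0_fin_numE// (le_lt_trans S1)// ltry.
rewrite -lee_fin fineK//; apply: (le_trans S1); rewrite lee_fin.
rewrite -[leRHS]invrK lef_pV2 ?posrE ?invr_gt0//.
by rewrite ltW// truncnS_gt.
Unshelve. all: end_near. Qed.

End supremum.

(** * Growth of the responses and of the bandwidths *)

Section eventual_size.
Context d0 d {Omega : measurableType d0} {T : measurableType d} {R : realType}
  (P : probability Omega R).
Variable Z : nat -> {RV P >-> T}.
Hypothesis iidZ : iid Z.
Let nu := distribution P (Z 0%N).

(** There are at most v + 1 natural numbers below v. *)
Lemma count_below_le (v : R) (n : nat) : 0 <= v ->
  \sum_(0 <= i < n) (i%:R < v)%R%:R <= v + 1.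
Proof.
move=> v0; suff [] : \sum_(0 <= i < n) (i%:R < v)%R%:R <= v + 1 /\
    \sum_(0 <= i < n) (i%:R < v)%R%:R <= n%:R :> R by [].
elim: n => [|n [ih1 ih2]]; first by rewrite big_geq// addr_ge0.
rewrite big_nat_recr//= -natr1; split; last by rewrite lerD// lern1 leq_b1.
case: ltP => h /=; last by rewrite addr0.
by rewrite lerD2r (le_trans ih2)// ltW.
Qed.

(** The first Borel-Cantelli lemma: by [count_below_le] the probabilities that
V(Z_n) exceeds n have a sum at most E V + 1. *)
Lemma iid_eventually_le (V : T -> R) :
  measurable_fun setT V -> (forall z, 0 <= V z) ->
  (\int[nu]_z (V z)%:E < +oo)%E ->
  {ae P, forall w, \forall n \near \oo, V (Z n w) <= n%:R}.
Proof.
move=> mV V0 Vfin.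
pose F n := Z n @^-1` [set z | n%:R < V z].
have mA n : measurable [set z | n%:R < V z] by exact: measurable_set_lt.
have mF n : measurable (F n) by exact: preimage_RV_measurable.
have sumF : (\sum_(n <oo) P (F n) < +oo)%E.
  have PF n : (P (F n) = \int[nu]_z (\1_[set z | n%:R < V z] z)%:E)%E.
    by rewrite integral_indic// setIT; have [_ idZ] := iidZ; exact: idZ.
  under eq_eseriesr do rewrite PF.
  rewrite -integral_nneseries//; last by move=> n; exact/measurable_EFinP.
  apply: (@le_lt_trans _ _ (\int[nu]_z (V z + 1)%:E)%E).
    apply: ge0_le_integral; first exact: measurableT.
    - by move=> z _; apply: nneseries_ge0 => n _ _; rewrite lee_fin.
    - by apply: ge0_emeasurable_sum => // n _; exact/measurable_EFinP.
    - by apply/measurable_EFinP; apply: measurable_funD.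
    move=> z _; apply: lime_le; first by apply: is_cvg_nneseries => n _ _; rewrite lee_fin.
    apply: nearW => n; rewrite sumEFin lee_fin; apply: le_trans (count_below_le n (V0 z)).
    apply: ler_sum => i _; rewrite indicE.
    by have [|] := boolP (z \in _); [rewrite inE /= => ->|].
rewrite (_ : (\int[nu]_z _)%E = \int[nu]_z ((V z)%:E + cst 1%E z))%E; last first.
  by apply: eq_integral => z _; rewrite EFinD.
rewrite ge0_integralD//; last 2 first.
- by move=> z _; rewrite lee_fin.
- exact/measurable_EFinP.
by rewrite integral_cst// mul1e lte_add_pinfty// (le_lt_trans (probability_le1 _ _))// ltry.
have := borel_cantelli_ae mF sumF; apply: filterS => w; apply: filterS => n.
by rewrite /F /= => /negP; rewrite -leNgt.
Qed.

End eventual_size.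

Section bandwidth_growth.
Context {R : realType}.

(** With L = ln n the quotient is at least (c / 2) exp((L - 2 ln L) / q), the
powers of n combining to 1 - (1 - 2 / q) - 1 / q = 1 / q, and
ln L <= L / 4 + ln 4 leaves an exponent of order L / (2 q). *)
Lemma moment_bandwidth_growth (q c : R) : 2 < q -> 0 < c ->
  n%:R * (c * (ln n%:R / n%:R) `^ (1 - 2 / q)) / (n%:R `^ q^-1 + 1) / ln n%:R
    @[n --> \oo] --> +oo.
Proof.
move=> q2 c0; have q0 : 0 < q by lra.
apply/cvgryPge => A.
pose X := 2 * (2 * q * `|A| / c + 2 * ln 4).
near=> n.
have n2 : (2 <= n)%N by near: n; exact: nbhs_infty_ge.
have n0 : 0 < n%:R :> R by rewrite ltr0n (leq_trans _ n2).
have nX : expR X <= n%:R by near: n; exact: nbhs_infty_ger.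
set L := ln n%:R.
have L0 : 0 < L by rewrite ln_gt0// ltr1n.
have LX : X <= L by rewrite /L -ler_expR lnK ?posrE.
have nL : n%:R = expR L by rewrite lnK ?posrE.
have B1 : n%:R `^ q^-1 + 1 <= 2 * expR (L / q).
  have -> : n%:R `^ q^-1 = expR (L / q) by rewrite /powR gt_eqF// mulrC.
  have : 1 <= expR (L / q) by rewrite -expR0 ler_expR divr_ge0// ltW.
  lra.
have num : n%:R * (c * (L / n%:R) `^ (1 - 2 / q)) =
    c * expR (L + (1 - 2 / q) * (ln L - L)).
  rewrite expRD -nL mulrCA; congr (_ * (_ * _)).
  by rewrite /powR gt_eqF ?divr_gt0// ln_div ?posrE.
have lnL : ln L <= L / 4 + ln 4.
  rewrite -[X in ln X <= _](@divfK _ 4)// lnM ?posrE ?divr_gt0//.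
  by rewrite lerD2r ltW// ln_sublinear// divr_gt0.
rewrite num.
have ge : c / 2 * expR (q^-1 * (L - 2 * ln L)) <=
    c * expR (L + (1 - 2 / q) * (ln L - L)) / (n%:R `^ q^-1 + 1) / L.
  rewrite !ler_pdivlMr ?addr_gt0 ?powR_gt0//.
  apply: (@le_trans _ _ (c / 2 * expR (q^-1 * (L - 2 * ln L)) * L * (2 * expR (L / q)))).
    by rewrite ler_wpM2l// !mulr_ge0 ?expR_ge0 ?invr_ge0 ?(ltW c0) ?(ltW L0).
  have EL : expR (ln L) = L by rewrite lnK ?posrE.
  have -> : c / 2 * expR (q^-1 * (L - 2 * ln L)) * L * (2 * expR (L / q)) =
      c * (expR (q^-1 * (L - 2 * ln L)) * expR (ln L) * expR (L / q)).
    by rewrite EL; field.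
  rewrite -!expRD ler_pM2l// ler_expR le_eqVlt; apply/orP; left; apply/eqP; field.
  by rewrite gt_eqF.
apply: le_trans ge.
apply: (@le_trans _ _ (c / 2 * (q^-1 * (L - 2 * ln L)))); last first.
  rewrite ler_pM2l ?divr_gt0//; apply: le_trans (expR_ge1Dx _); lra.
apply: (@le_trans _ _ (c / 2 * (q^-1 * (L / 2 - 2 * ln 4)))); last first.
  rewrite ler_pM2l ?divr_gt0// ler_pM2l ?invr_gt0//; lra.
apply: le_trans (ler_norm A) _.
have h : 2 * q * `|A| / c <= L / 2 - 2 * ln 4 by rewrite /X in LX; lra.
have -> : `|A| = c / 2 * (q^-1 * (2 * q * `|A| / c)) by field; rewrite !gt_eqF.
by rewrite ler_pM2l ?divr_gt0// ler_pM2l ?invr_gt0.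
Unshelve. all: end_near. Qed.

End bandwidth_growth.

(** * Bounded responses and responses with a finite moment *)

Section two_cases.
Context d0 {Omega : measurableType d0} {R : realType} {d : nat}
  (P : probability Omega R).
Hypothesis d_gt0 : (0 < d)%N.
Let T := (measurableTypeR R * 'rV[R]_d)%type.
Variable Z : nat -> {RV P >-> T}.
Hypothesis iidZ : iid Z.
Local Notation leb := (@lebesgue_measure R).
Local Notation lebd := (lebesgue_rV R d).
Let nu := distribution P (Z 0%N).
Variable p : T -> R.
Hypotheses (mp : measurable_fun setT p) (p0 : forall z, 0 <= p z)
  (nuE : forall A, measurable A ->
    nu A = (\int[(leb \x lebd)%E]_(z in A) (p z)%:E)%E).
Variable K : 'rV[R]_d -> R.
Hypotheses (mK : measurable_fun setT K)
  (K_int : (\int[lebesgue_rV R d]_s (K s)%:E = 1)%E)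
  (K_bounded : (sup_norm setT K < +oo)%E)
  (K_entropy : polynomial_uniform_entropy K)
  (K_pointwise : pointwise_measurable_class (kernel_class K))
  (K_support : closure [set s | K s != 0] `<=`
    [set s | forall i, - 2^-1 <= s ord0 i <= 2^-1]).
Let kappa := fine (sup_norm setT K).
Let kappa_gt0 : 0 < kappa. Proof. exact: kernel_bound_gt0. Qed.
Variables (I : set 'rV[R]_d) (eps : R).
Hypotheses (cI : compact I) (eps_gt0 : 0 < eps).
Let J := closed_neighborhood eps I.
Hypotheses (f_cont : {within J, continuous (marginal_density p)})
  (f_pos : forall z, J z -> 0 < marginal_density p z)
  (p_cont : forall z, J z ->
     {ae leb, forall y : measurableTypeR R, p (y, z') @[z' --> z] --> p (y, z)}).

Let IJ x : I x -> J x.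
Proof. by move=> Ix; exists x => //; rewrite subrr normr0 ltW. Qed.

(** The conditional density is p(., x) / f(x). *)
Lemma regression_marginal x : 0 < marginal_density p x ->
  leb.-integrable setT (fun y => (y * p (y, x))%:E) ->
  regression p x * marginal_density p x = \int[leb]_y (y * p (y, x)).
Proof.
move=> fx iy; rewrite /regression /conditional_expectation.
rewrite -[fine _]/(\int[leb]_y (y * conditional_density p x y)).
under eq_Rintegral do rewrite /conditional_density mulrA.
by rewrite (RintegralZr _ measurableT iy) divfK// gt_eqF.
Qed.

Lemma sample_ae (A : set T) : measurable A -> P (Z 0%N @^-1` A) = 0%E ->
  {ae P, forall w, forall i, ~ A (Z i w)}.
Proof.
move=> mA A0; apply: ae_foralln => i.
exists (Z i @^-1` A); split.
- exact: preimage_RV_measurable.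
- by have [_ idZ] := iidZ; have := idZ i A mA; rewrite /distribution /pushforward A0.
- by move=> w /= h; apply: contrapT => h'; apply: h.
Qed.

Section bounded_response.
Variable M : R.
Hypotheses (M_gt0 : 0 < M)
  (Y_bounded : {ae P, forall w, `|(Z 0%N w).1 : R| * \1_J (Z 0%N w).2 <= M}).

Let psi (y : R) : R := \1_[set t : R | M < `|t|] y.

Let mpsi : measurable_fun setT psi.
Proof. exact: measurable_tail. Qed.

Let psi_le y : `|psi y| <= 1.
Proof. by rewrite /psi indicE; case: (_ \in _); rewrite ?normr1 ?normr0. Qed.

Let J_bounded : {ae P, forall w, J (Z 0%N w).2 -> `|(Z 0%N w).1 : R| <= M}.
Proof.
apply: filterS Y_bounded => w; rewrite indicE => + Jw.
by rewrite mem_set// mulr1.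
Qed.

(** The conditional law of Y lives on [-M, M] at every point of I, not only at
almost every point: a positive excess mass would persist, by L1-continuity, on
a ball contained in J, where it must vanish. *)
Lemma excess_mass_eq0 x : I x -> weighted_density p psi x = 0.
Proof.
move=> Ix; have Jx := IJ Ix.
have w0 : 0 <= weighted_density p psi x.
  by apply: Rintegral_ge0 => y _; rewrite mulr_ge0// /psi.
apply/eqP; rewrite eq_le w0 andbT leNgt; apply/negP => wx.
have eta0 : 0 < weighted_density p psi x / 2 by rewrite divr_gt0.
have L1 := L1_uniform_continuity mp p0 cI eps_gt0 f_cont f_pos p_cont eta0.
have : \forall r \near 0^'+, 0 < r /\ (forall x0, I x0 -> forall z, `|x0 - z| <= r ->
    J z /\ \int[leb]_y `|p (y, z) - p (y, x0)| <= weighted_density p psi x / 2).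
  by near=> r; split; near: r => //; exact: nbhs_right_gt.
move=> /filter_ex[r [r0 hr]].
pose B := [set z : 'rV[R]_d | `|x - z| <= r].
have mB : measurable B by exact: closed_ball_measurable_rV.
have mG : measurable_fun setT (\1_B : 'rV[R]_d -> R) by exact: measurable_indic.
have := @local_expectation_bias _ _ nu p mp p0 nuE psi 1 (\1_B) 1 r
  (weighted_density p psi x / 2) x mpsi psi_le mG _ (ltW r0) _ (f_pos Jx) _.
have -> : \int[lebd]_z (\1_B z) = (2 * r) ^+ d.
  rewrite /Rintegral (_ : (\int[lebd]_z _)%E = ((2 * r) ^+ d)%:E)//.
  by rewrite integral_indic// setIT; exact: (lebesgue_rV_ball x (ltW r0)).
have -> : \int[nu]_z (psi z.1 * \1_B z.2) = 0.
  rewrite /Rintegral (_ : (\int[nu]_z _)%E = 0%E)//.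
  have mF : measurable_fun setT (fun z : T => (psi z.1 * \1_B z.2)%:E).
    apply/measurable_EFinP; apply: measurable_funM; first exact: (measurableT_comp mpsi).
    by apply: measurableT_comp.
  rewrite ge0_integral_distribution//; last first.
    by move=> z; rewrite lee_fin mulr_ge0// /psi.
  rewrite (ae_eq_integral (cst 0%E))//; first exact: integral0.
    by apply: (measurableT_comp mF).
  apply: filterS J_bounded => w hw _ /=.
  rewrite /psi !indicE; have [|] := boolP ((Z 0%N w).2 \in B); last by rewrite mulr0.
  rewrite inE /B /= => xz; have [Jz _] := hr x Ix _ xz.
  by rewrite memNset ?mul0r// /=; apply/negP; rewrite -leNgt; exact: hw.
rewrite sub0r normrN mul1r !mul1r => h.
have v0 : 0 < (2 * r) ^+ d by rewrite exprn_gt0// mulr_gt0.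
have : `|weighted_density p psi x * (2 * r) ^+ d| <= weighted_density p psi x / 2 * (2 * r) ^+ d.
  apply: h.
  - by move=> z; rewrite indicE; case: (_ \in _); rewrite ?normr1 ?normr0.
  - by move=> z; rewrite indicE; have [|] := boolP (z \in B); [rewrite inE|rewrite eqxx].
  - by move=> z xz; have [Jz hz] := hr x Ix z xz; split => //; exact: f_pos.
rewrite ger0_norm ?mulr_ge0 ?(ltW v0)// ler_pM2r// => h2.
by move: wx; rewrite ltNge; move: h2; lra.
Unshelve. all: end_near. Qed.

Lemma bounded_regression x : I x ->
  regression p x * marginal_density p x = weighted_density p (truncate M) x.
Proof.
move=> Ix; have Jx := IJ Ix; have fx := f_pos Jx.
have ipsi := bounded_section_integrable mp p0 mpsi psi_le fx.
have mpx : measurable_fun setT (fun y : measurableTypeR R => p (y, x)).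
  exact: (measurableT_comp mp).
have psi_ae : ae_eq leb setT (fun y => (psi y * p (y, x))%:E) (cst 0%E).
  apply/ae_eq_integral_abs => //.
    by apply/measurable_EFinP; apply: measurable_funM.
  under eq_integral.
    move=> y _; rewrite /= ger0_norm ?mulr_ge0//.
    over.
  rewrite -[LHS]fineK; last exact: (integrable_fin_num measurableT ipsi).
  by rewrite -[fine _]/(weighted_density p psi x) excess_mass_eq0.
have mtrunc := measurable_truncate M.
have itrunc := bounded_section_integrable mp p0 mtrunc (fun y => truncate_le y M_gt0) fx.
rewrite /regression /conditional_expectation.
rewrite (_ : (\int[leb]_y _)%E =
    (\int[leb]_y (truncate M y * p (y, x) * (marginal_density p x)^-1)%:E)%E).
  rewrite -[fine _]/(\int[leb]_y (truncate M y * p (y, x) * (marginal_density p x)^-1)).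
  by rewrite (RintegralZr _ measurableT itrunc) divfK// gt_eqF.
apply: ae_eq_integral => //.
- apply/measurable_EFinP; apply: measurable_funM => //.
  by apply: measurable_funM.
- apply/measurable_EFinP; apply: measurable_funM => //.
  by apply: measurable_funM.
apply: filterS psi_ae => y /(_ Logic.I) /= [h] _; congr EFin.
rewrite /conditional_density mulrA; congr (_ * _).
apply/eqP; rewrite -subr_eq0 -mulrBl truncate_tail -/(psi y) -mulrA.
by rewrite h mulr0.
Qed.

(** With the truncation level M the truncated conditional mean is exactly m f, and
almost surely no sample point near I has a response above M. *)
Lemma bounded_consistency (a b : nat -> R) (e : R) :
  b n @[n --> \oo] --> 0 -> n%:R * a n / ln n%:R @[n --> \oo] --> +oo -> 0 < e ->
  {ae P, forall w, \forall n \near \oo, forall h, a n <= h <= b n -> forall x, I x ->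
    `|nadaraya_watson K (fun i => (Z i w).1 : R) (fun i => (Z i w).2) n h x -
      regression p x| <= e}.
Proof.
move=> b_cvg a_lim e0.
apply: (uniform_consistency d_gt0 iidZ mp p0 nuE mK K_int K_bounded K_entropy
  K_pointwise K_support cI eps_gt0 f_cont f_pos p_cont b_cvg a_lim (ltW M_gt0)) => //.
  move=> x Ix; have fx := f_pos (IJ Ix).
  rewrite -(ler_pM2r fx) -[X in _ * X <= _](gtr0_norm fx) -normrM (bounded_regression Ix).
  exact: (weighted_density_le mp p0 (measurable_truncate M) (fun y => truncate_le y M_gt0) fx).
move=> eta eta0; exists M => //; split.
  by move=> x Ix; rewrite (bounded_regression Ix) subrr normr0 ltW.
have [U [rho [delta [mU rho0 delta0 IU hU]]]] :=
  density_neighborhood mp p0 cI eps_gt0 f_cont f_pos p_cont.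
pose A := [set z : T | M < `|z.1 : R|] `&` (snd @^-1` U).
have mA : measurable A.
  apply: measurableI.
    apply: measurable_set_lt => //; apply: measurableT_comp => //.
  by rewrite -[X in measurable X]setTI; exact: measurable_snd.
have PA : P (Z 0%N @^-1` A) = 0%E.
  have [N [mN N0 hN]] := J_bounded.
  apply/eqP; rewrite -measure_le0 -N0; apply: le_measure; rewrite ?inE//.
    exact: preimage_RV_measurable.
  move=> w [/= Mw Uw]; apply: hN => /= h.
  by have [Jz _] := hU _ Uw; have := h Jz; rewrite leNgt Mw.
have hrange := bandwidth_range d_gt0 b_cvg a_lim delta0.
apply: filterS (sample_ae mA PA) => w hw; near=> n => h hab x Ix.
have [h0 hd] : 0 < h /\ h `^ d%:R^-1 <= delta by move: h hab; near: n.
have n0 : (0 < n)%N by near: n; exact: nbhs_infty_gt.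
rewrite big1_seq ?normr0 ?mulr_ge0 ?(ltW eta0) ?(ltW h0)// => i _.
have [->|Ki] := eqVneq (rescaled_kernel K h (x - (Z i w).2)) 0; first by rewrite mulr0.
have Ui : U (Z i w).2.
  by apply: (IU x _ Ix); apply: le_trans hd; exact: (rescaled_kernel_support K_support).
rewrite truncate_tail indicE memNset ?mulr0 ?mul0r// => /= Mi.
by apply: (hw i); split.
Unshelve. all: end_near. Qed.

End bounded_response.
Section moment_response.
Variables (q S : R).
Hypotheses (q_gt2 : 2 < q) (S_ge0 : 0 <= S)
  (Y_moment : forall z, J z ->
    (conditional_expectation p (fun y => `|y| `^ q)%R z <= S%:E)%E).

Let q_gt0 : 0 < q. Proof. exact: lt_trans q_gt2. Qed.

Let mpow : measurable_fun setT (fun y : R => `|y| `^ q).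
Proof.
by apply: (measurableT_comp (measurable_powR q)).
Qed.

Lemma conditional_moment z : J z ->
  (\int[leb]_y (`|y| `^ q * p (y, z))%:E <= (S * marginal_density p z)%:E)%E.
Proof.
move=> Jz; have fz := f_pos Jz.
have mpz : measurable_fun setT (fun y : measurableTypeR R => p (y, z)).
  exact: (measurableT_comp mp).
have := Y_moment Jz; rewrite /conditional_expectation => h.
have -> : (\int[leb]_y (`|y| `^ q * p (y, z))%:E = \int[leb]_y ((marginal_density p z)%:E *
    (`|y| `^ q * conditional_density p z y)%:E))%E.
  apply: eq_integral => y _; rewrite -EFinM; congr EFin; rewrite /conditional_density.
  by field; rewrite gt_eqF.
have mcd : measurable_fun setT (fun y : measurableTypeR R => (`|y| `^ q * conditional_density p z y)%:E).
  apply/measurable_EFinP; apply: measurable_funM; first exact: mpow.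
  by apply: measurable_funM.
rewrite ge0_integralZl//; last 2 first.
- by move=> y _; rewrite lee_fin mulr_ge0 ?powR_ge0// divr_ge0// ltW.
- by rewrite lee_fin ltW.
rewrite mulrC EFinM; apply: lee_wpmul2l => //.
by rewrite lee_fin ltW.
Qed.

(** As tau >= 1 and q >= 2, tau |y| <= |y|^2 <= |y|^q. *)
Lemma norm_le_power (tau y : R) : 1 <= tau -> tau <= `|y| -> `|y| <= `|y| `^ q / tau.
Proof.
move=> tau1 ty; have tau0 : 0 < tau by exact: lt_le_trans tau1.
rewrite ler_pdivlMr//; apply: (@le_trans _ _ (`|y| ^+ 2)).
  by rewrite expr2 ler_wpM2l.
rewrite -powR_mulrn//; apply: ler_powR; last exact: ltW.
exact: le_trans ty.
Qed.

Lemma tail_moment (tau : R) z : 1 <= tau -> J z ->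
  (\int[leb]_y (`|y| * \1_[set t : R | tau < `|t|] y * p (y, z))%:E <=
    (S / tau * marginal_density p z)%:E)%E.
Proof.
move=> tau1 Jz; have tau0 : 0 < tau by exact: lt_le_trans tau1.
have mpz : measurable_fun setT (fun y : measurableTypeR R => p (y, z)).
  exact: (measurableT_comp mp).
apply: (@le_trans _ _ (\int[leb]_y ((tau^-1)%:E * (`|y| `^ q * p (y, z))%:E))%E).
  apply: ge0_le_integral; first exact: measurableT.
  - by move=> y _; rewrite lee_fin !mulr_ge0.
  - apply/measurable_EFinP; apply: measurable_funM => //; apply: measurable_funM => //.
    exact: measurable_tail.
  - apply: emeasurable_funM => //; apply/measurable_EFinP.
    by apply: measurable_funM.
  move=> y _; rewrite -EFinM lee_fin mulrA ler_wpM2r// indicE.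
  have [|] := boolP (y \in _); last by rewrite mulr0 mulr_ge0 ?invr_ge0 ?powR_ge0// ltW.
  by rewrite inE /= mulr1 [leRHS]mulrC => /ltW ty; exact: norm_le_power.
rewrite ge0_integralZl//; last 3 first.
- by apply/measurable_EFinP; apply: measurable_funM.
- by move=> y _; rewrite lee_fin mulr_ge0// powR_ge0.
- by rewrite lee_fin invr_ge0 ltW.
have -> : ((S / tau * marginal_density p z)%:E = (tau^-1)%:E * (S * marginal_density p z)%:E)%E.
  by rewrite -EFinM; congr EFin; ring.
apply: lee_wpmul2l; first by rewrite lee_fin invr_ge0 ltW.
exact: conditional_moment.
Qed.

(** The hypothesis bounds moments at every point of J, so the regression function
is an honest mean at every point of J and not only almost everywhere. *)
Lemma identity_integrable z : J z -> leb.-integrable setT (fun y => (y * p (y, z))%:E).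
Proof.
move=> Jz; have fz := f_pos Jz.
have mpz : measurable_fun setT (fun y : measurableTypeR R => p (y, z)).
  exact: (measurableT_comp mp).
have h1 := bounded_section_integrable mp p0 (measurable_truncate 1) (fun y => truncate_le y ltr01) fz.
have h2 : leb.-integrable setT (fun y => (y * \1_[set t : R | 1 < `|t|] y * p (y, z))%:E).
  apply/integrableP; split.
    apply/measurable_EFinP; apply: measurable_funM => //; apply: measurable_funM => //.
    exact: measurable_tail.
  under eq_integral do rewrite /= 2!normrM (ger0_norm (p0 _)) [`|\1__ _|]ger0_norm//.
  by apply: le_lt_trans (tail_moment (lexx 1) Jz) _; exact: ltry.
have := integrableD measurableT h1 h2; apply: eq_integrable => // y _ /=.
by rewrite -EFinD -mulrDl -truncate_tail addrC subrK.
Qed.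

Lemma truncated_mean (tau : R) x : 1 <= tau -> I x ->
  `|\int[leb]_y (y * p (y, x)) - weighted_density p (truncate tau) x| <=
    S / tau * marginal_density p x.
Proof.
move=> tau1 Ix; have Jx := IJ Ix; have fx := f_pos Jx.
have tau0 : 0 < tau by exact: lt_le_trans tau1.
have iy := identity_integrable Jx.
have ic := bounded_section_integrable mp p0 (measurable_truncate tau) (fun y => truncate_le y tau0) fx.
have id := integrableB measurableT iy ic.
rewrite /weighted_density -(RintegralB measurableT iy ic).
apply: le_trans (le_normr_Rintegral measurableT id) _.
rewrite -lee_fin.
have -> : ((\int[leb]_y `|y * p (y, x) - truncate tau y * p (y, x)|)%:E =
    \int[leb]_y (`|y| * \1_[set t : R | (tau < `|t|)%R] y * p (y, x))%:E)%E.
  rewrite /Rintegral fineK; last exact: (integrable_fin_num measurableT (integrable_abse id)).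
  apply: eq_integral => y _; congr EFin.
  by rewrite -mulrBl truncate_tail 2!normrM (ger0_norm (p0 _)) [`|\1__ _|]ger0_norm.
exact: tail_moment.
Qed.

Lemma regression_le x : I x -> `|regression p x| <= 1 + S.
Proof.
move=> Ix; have Jx := IJ Ix; have fx := f_pos Jx.
rewrite -(ler_pM2r fx) -[X in _ * X <= _](gtr0_norm fx) -normrM.
rewrite (regression_marginal fx (identity_integrable Jx)).
have h1 := truncated_mean (lexx 1) Ix; rewrite divr1 in h1.
have h2 := weighted_density_le mp p0 (measurable_truncate 1) (fun y => truncate_le y ltr01) fx.
rewrite mulrDl addrC -(subrK (weighted_density p (truncate 1) x) (\int[leb]_y _)).
by apply: le_trans (ler_normD _ _) _; exact: lerD.
Qed.

Lemma neighborhood_moment (U : set 'rV[R]_d) : measurable U -> U `<=` J ->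
  (\int[nu]_z (`|z.1| `^ q * \1_U z.2)%:E < +oo)%E.
Proof.
move=> mU UJ.
rewrite (density_product_integral mp p0 nuE mpow)//.
have m1 : measurable_fun setT (fun _ : R => 1 : R) by [].
apply: (@le_lt_trans _ _ (S%:E * \int[nu]_z (1 * \1_U z.2)%:E)%E).
  rewrite (density_product_integral mp p0 nuE m1)//.
  have mI : measurable_fun setT (fun x => \int[leb]_y (1 * p (y, x))%:E)%E.
    apply: (measurable_fun_fubini_tonelli_G (m1 := leb) (fun z => (1 * p z)%:E)).
      by apply/measurable_EFinP; apply: measurable_funM.
    by move=> z; rewrite lee_fin mulr_ge0.
  have mIq : measurable_fun setT (fun x => \int[leb]_y (`|y| `^ q * p (y, x))%:E)%E.
    apply: (measurable_fun_fubini_tonelli_G (m1 := leb) (fun z => (`|z.1| `^ q * p z)%:E)).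
      apply/measurable_EFinP; apply: measurable_funM => //.
      exact: (measurableT_comp mpow).
    by move=> z; rewrite lee_fin mulr_ge0 ?powR_ge0.
  have mU1 : measurable_fun setT (fun x : 'rV[R]_d => (\1_U x)%:E : \bar R).
    exact/measurable_EFinP.
  have I0 x : (0 <= \int[leb]_y (1 * p (y, x))%:E)%E.
    by apply: integral_ge0 => y _; rewrite lee_fin mulr_ge0.
  have mh := emeasurable_funM mU1 mI.
  have h0 x : setT x -> (0 <= (\1_U x)%:E * \int[leb]_y (1 * p (y, x))%:E)%E.
    by move=> _; rewrite mule_ge0// lee_fin.
  rewrite -(ge0_integralZl _ measurableT mh h0) ?lee_fin//.
  apply: ge0_le_integral; first exact: measurableT.
  - move=> x _; apply: mule_ge0; first by rewrite lee_fin.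
    by apply: integral_ge0 => y _; rewrite lee_fin mulr_ge0 ?powR_ge0.
  - exact: emeasurable_funM.
  - by apply: emeasurable_funM => //; exact: emeasurable_funM.
  move=> x _; rewrite muleCA indicE; have [|] := boolP (x \in U); last by rewrite !mul0e.
  rewrite inE => /UJ Jx; rewrite !mul1e; apply: (le_trans (conditional_moment Jx)).
  under eq_integral do rewrite mul1r.
  by rewrite (marginal_EFin mp p0 f_pos Jx) -EFinM.
rewrite EFin_Rintegral_prob ?ltry//.
apply: (@prob_bounded_integrable _ _ _ _ (fun z : T => 1 * \1_U z.2 : R) 1).
  by apply: measurable_funM => //; apply: measurableT_comp => //; exact: measurable_indic.
by move=> z; rewrite mul1r indicE; case: (_ \in _); rewrite ?normr1 ?normr0.
Qed.

(** Since E |Y|^q 1_U(X) is finite, |Y_i| <= i^(1/q) <= n^(1/q) for the i >= N with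
X_i in U. The finitely many responses before N have a sum that n^(1/q) eventually
exceeds. *)
Lemma sample_growth (U : set 'rV[R]_d) : measurable U -> U `<=` J ->
  {ae P, forall w, \forall n \near \oo, forall i, i \in iota 1 n ->
    U (Z i w).2 -> `|(Z i w).1 : R| <= n%:R `^ q^-1}.
Proof.
move=> mU UJ.
have mV : measurable_fun setT (fun z : T => `|z.1 : R| `^ q * \1_U z.2).
  apply: measurable_funM; first exact: (measurableT_comp mpow).
  by apply: measurableT_comp => //; exact: measurable_indic.
have V0 (z : T) : 0 <= `|z.1 : R| `^ q * \1_U z.2 by rewrite mulr_ge0 ?powR_ge0.
have := iid_eventually_le iidZ mV V0 (neighborhood_moment mU UJ).
apply: filterS => w [N _ hN].
pose s := \sum_(i <- iota 0 N) `|(Z i w).1 : R|.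
have s0 : 0 <= s by exact: sumr_ge0.
near=> n => i; rewrite mem_iota => /andP[i1 iltn] Ui.
have n0 : (0 < n)%N by near: n; exact: nbhs_infty_gt.
have sn : s `^ q <= n%:R by near: n; exact: nbhs_infty_ger.
have toroot (y : R) : 0 <= y -> y `^ q <= n%:R -> y <= n%:R `^ q^-1.
  move=> y0 yn; have <- : (y `^ q) `^ q^-1 = y by rewrite -powRrM mulfV ?gt_eqF// powRr1.
  by apply: ge0_ler_powR => //; rewrite ?nnegrE ?invr_ge0 ?(ltW q_gt0) ?powR_ge0.
have [iN|Ni] := ltnP i N.
  apply: (@le_trans _ _ s); last exact: toroot.
  rewrite /s (big_rem i) ?mem_iota//= lerDl.
  exact: sumr_ge0.
apply: toroot => //; have := hN i Ni; rewrite indicE mem_set// mulr1 => /le_trans; apply.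
by rewrite ler_nat; move: iltn; rewrite add1n ltnS.
Unshelve. all: end_near. Qed.

Section moment_bandwidths.
Variables (c : R) (b : nat -> R).
Hypotheses (c_gt0 : 0 < c) (b_cvg : b n @[n --> \oo] --> 0).
Let a n := c * (ln n%:R / n%:R) `^ (1 - 2 / q).

Let a_lim : n%:R * a n / ln n%:R @[n --> \oo] --> +oo.
Proof.
apply/cvgryPge => A.
have /cvgryPge h := moment_bandwidth_growth q_gt2 c_gt0.
near=> n; have n2 : (2 <= n)%N by near: n; exact: nbhs_infty_ge.
have ln0 : 0 < ln n%:R :> R by rewrite ln_gt0// ltr1n.
apply: (@le_trans _ _ (n%:R * a n / (n%:R `^ q^-1 + 1) / ln n%:R)); first by near: n; exact: h.
rewrite ler_pM2r ?invr_gt0// ler_pdivrMr ?ltr_wpDl ?powR_ge0//.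
by rewrite ler_peMr ?lerDr ?powR_ge0// !mulr_ge0 ?powR_ge0 ?(ltW c_gt0).
Unshelve. all: end_near. Qed.

(** Eventually the tail of Y_i coincides with its truncation at n^(1/q) for all
sample points near I, and [local_sums_bound] applies to the latter, with local
masses at most S rho / tau. *)
Lemma truncated_tail_sums (eta : R) : 0 < eta -> exists2 tau0 : R, 1 <= tau0 &
  forall tau, tau0 <= tau ->
  {ae P, forall w, \forall n \near \oo, forall h, a n <= h <= b n -> forall x, I x ->
    `|\sum_(i <- iota 1 n) ((Z i w).1 - truncate tau (Z i w).1) *
      rescaled_kernel K h (x - (Z i w).2)| <= eta * (n%:R * h)}.
Proof.
move=> eta0.
have [U [rho [delta [mU rho0 delta0 IU hU]]]] :=
  density_neighborhood mp p0 cI eps_gt0 f_cont f_pos p_cont.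
have [A IA] := compact_coordinates_bounded cI.
have UJ : U `<=` J by move=> z /hU[].
have S1 : 0 < S + 1 by rewrite ltr_wpDl.
(* S + 1 in place of S keeps the bound on the local masses positive. *)
pose C := kappa * (8 * 4 ^+ d * ((S + 1) * rho)).
have C0 : 0 < C by rewrite !mulr_gt0// exprn_gt0.
exists (1 + C / eta); first by rewrite lerDl divr_ge0// ltW.
move=> tau htau.
have tau1 : 1 <= tau by apply: le_trans htau; rewrite lerDl divr_ge0// ltW.
have tau0 : 0 < tau by exact: lt_le_trans tau1.
have Ctau : C / tau <= eta.
  rewrite ler_pdivrMr// mulrC -ler_pdivrMr//; apply: le_trans htau.
  by rewrite lerDr.
pose B n : R := n%:R `^ q^-1 + 1.
have B0 n : 0 < B n by rewrite ltr_wpDl ?powR_ge0.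
pose psi n (y : R) : R := `|truncate (n%:R `^ q^-1) y| * \1_[set t | tau < `|t|] y.
have mtail := measurable_tail tau.
have mpsi n : measurable_fun setT (psi n).
  apply: measurable_funM => //; apply: measurableT_comp => //; exact: measurable_truncate.
have psi_abs n y : psi n y <= `|y| * \1_[set t : R | tau < `|t|] y.
  rewrite ler_wpM2r// /truncate normrM indicE.
  by case: (_ \in _); rewrite ?normr1 ?normr0 ?mulr1 ?mulr0.
have psi_range n y : 0 <= psi n y <= B n.
  rewrite /psi mulr_ge0//=; apply: (@le_trans _ _ `|truncate (n%:R `^ q^-1) y|).
    by rewrite ler_piMr// indicE; case: (_ \in _).
  rewrite /truncate indicE; have [|] := boolP (y \in _); last by rewrite mulr0 normr0 ltW.
  by rewrite inE/= mulr1 => /le_trans; apply; rewrite lerDl.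
have psi_mean n z : U z ->
    (\int[leb]_y (psi n y * p (y, z))%:E <= ((S + 1) * rho / tau)%:E)%E.
  move=> Uz; have [Jz fz] := hU z Uz.
  have mpz : measurable_fun setT (fun y : measurableTypeR R => p (y, z)).
    exact: (measurableT_comp mp).
  apply: (@le_trans _ _ (\int[leb]_y (`|y| * \1_[set t : R | (tau < `|t|)%R] y * p (y, z))%:E)%E).
    apply: ge0_le_integral; first exact: measurableT.
    - by move=> y _; rewrite lee_fin mulr_ge0//; case/andP: (psi_range n y).
    - by apply/measurable_EFinP; apply: measurable_funM; [exact: (mpsi n)|exact: mpz].
    - apply/measurable_EFinP; apply: measurable_funM => //; apply: measurable_funM => //.
    by move=> y _; rewrite lee_fin ler_wpM2r.
  apply: le_trans (tail_moment tau1 Jz) _; rewrite lee_fin.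
  rewrite mulrAC ler_pM2r ?invr_gt0//; apply: ler_pM => //; last by rewrite lerDl.
  exact/ltW/f_pos.
have local := local_sums_bound d_gt0 iidZ mp p0 nuE IA mU
  (divr_gt0 (mulr_gt0 S1 rho0) tau0) mpsi psi_range B0 psi_mean
  (moment_bandwidth_growth q_gt2 c_gt0).
have hna := diverge_over_ln 1 a_lim.
have hb : \forall n \near \oo, b n <= 1.
  by near=> n; rewrite ltW//; near: n; exact: (cvgr_lt 0).
have hrange := bandwidth_range d_gt0 b_cvg a_lim delta0.
apply: filterS2 local (sample_growth mU UJ) => w local_w growth_w.
near=> n => h hab x Ix; have /andP[ah hbn] := hab.
have n0 : (0 < n)%N by near: n; exact: nbhs_infty_gt.
have [h0 hd] : 0 < h /\ h `^ d%:R^-1 <= delta by move: h hab ah hbn; near: n; apply: filterS hrange => n H h hab _ _; exact: H.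
have h1 : h <= 1 by apply: (le_trans hbn); near: n.
have nh1 : 1 <= n%:R * h.
  apply: (@le_trans _ _ (n%:R * a n)); first by near: n.
  by rewrite ler_wpM2l.
have growth i : i \in iota 1 n -> U (Z i w).2 -> `|(Z i w).1 : R| <= n%:R `^ q^-1.
  by move: i {h hab ah hbn h0 hd h1 nh1 x Ix}; near: n.
have loc : \sum_(i <- iota 1 n) psi n (Z i w).1 *
        \1_(U `&` [set z | `|x - z| <= h `^ d%:R^-1]) (Z i w).2 <=
      8 * 4 ^+ d * ((S + 1) * rho / tau) * (n%:R * h).
  have ah1 : a n <= h <= 1 by rewrite ah h1.
  move: h ah1 nh1 x Ix {hab ah hbn h0 hd h1}; near: n.
  by apply: filterS local_w => n H h ah1 nh1 x Ix; exact: H.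
apply: le_trans (ler_norm_sum _ _ _) _.
apply: (@le_trans _ _ (\sum_(i <- iota 1 n) kappa * (psi n (Z i w).1 *
        \1_(U `&` [set z | `|x - z| <= h `^ d%:R^-1]) (Z i w).2))).
  rewrite [leLHS]big_seq [leRHS]big_seq; apply: ler_sum => i i_n.
  have [k0|k0] := eqVneq (rescaled_kernel K h (x - (Z i w).2)) 0.
    rewrite k0 mulr0 normr0 mulr_ge0 ?(ltW kappa_gt0)// mulr_ge0//.
    by case/andP: (psi_range n (Z i w).1).
  have xz := rescaled_kernel_support K_support h0 k0.
  have Ui : U (Z i w).2 by apply: (IU x _ Ix); exact: le_trans hd.
  rewrite indicE mem_set ?mulr1; last by split.
  have untruncated : truncate (n%:R `^ q^-1) (Z i w).1 = (Z i w).1.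
    by rewrite /truncate indicE mem_set ?mulr1//; exact: growth.
  rewrite truncate_tail /psi untruncated !normrM mulrC [`|\1__ _|]ger0_norm//.
  by apply: ler_wpM2r => //; exact: (kernel_le K_bounded).
rewrite -big_distrr/=.
apply: (@le_trans _ _ (kappa * (8 * 4 ^+ d * ((S + 1) * rho / tau) * (n%:R * h)))).
  by rewrite ler_pM2l.
have -> : kappa * (8 * 4 ^+ d * ((S + 1) * rho / tau) * (n%:R * h)) = C / tau * (n%:R * h).
  by rewrite /C; field; rewrite gt_eqF.
by apply: ler_wpM2r => //; rewrite mulr_ge0// ltW.
Unshelve. all: end_near. Qed.

(** The truncation level is the sum of the level required by the tail sums and of
S rho / eta, which makes the mean of the tail at most eta. *)
Lemma moment_consistency (e : R) : 0 < e ->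
  {ae P, forall w, \forall n \near \oo, forall h, a n <= h <= b n -> forall x, I x ->
    `|nadaraya_watson K (fun i => (Z i w).1 : R) (fun i => (Z i w).2) n h x -
      regression p x| <= e}.
Proof.
move=> e0.
apply: (uniform_consistency d_gt0 iidZ mp p0 nuE mK K_int K_bounded K_entropy
  K_pointwise K_support cI eps_gt0 f_cont f_pos p_cont b_cvg a_lim (addr_ge0 ler01 S_ge0)
  regression_le) => //.
move=> eta eta0.
have [rho rho0 hrho] := marginal_bounded_above mp p0 cI eps_gt0 f_cont f_pos p_cont.
have [tau0 tau01 tail] := truncated_tail_sums eta0.
have tau0_gt0 : 0 < tau0 by exact: lt_le_trans tau01.
have Srho : 0 <= S * rho / eta by rewrite divr_ge0 ?(ltW eta0)// mulr_ge0// ltW.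
exists (tau0 + S * rho / eta); first by rewrite ltr_pwDl.
split; last by apply: tail; rewrite lerDl.
move=> x Ix.
have tau1 : 1 <= tau0 + S * rho / eta by rewrite (le_trans tau01)// lerDl.
rewrite (regression_marginal (f_pos (IJ Ix)) (identity_integrable (IJ Ix))) distrC.
apply: le_trans (truncated_mean tau1 Ix) _.
apply: (@le_trans _ _ (S / (tau0 + S * rho / eta) * rho)).
  by apply: ler_wpM2l; [rewrite divr_ge0// ltW// ltr_pwDl|exact: hrho].
rewrite mulrAC ler_pdivrMr; last by rewrite ltr_pwDl.
by rewrite mulrDr [eta * (_ / _)]mulrC divfK ?gt_eqF// lerDr mulr_ge0// ltW.
Qed.

End moment_bandwidths.

End moment_response.
End two_cases.

(** * Uniform in bandwidth consistency *)

(* (Y, X) is Z 0 and (Y_i, X_i) is Z i for i >= 1. *)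
Theorem corollary2 (R : realType) (d : nat) (hd : (0 < d)%N)
  (disp : measure_display) (Omega : measurableType disp)
  (P : probability Omega R)
  (Z : nat -> {RV P >-> (measurableTypeR R * 'rV[R]_d)%type})
  (hZ : iid Z)
  (I : set 'rV[R]_d) (hI : compact I)
  (K : 'rV[R]_d -> R) (mK : measurable_fun setT K)
  (hK_int : (\int[lebesgue_rV R d]_s (K s)%:E = 1)%E)
  (hK_bounded : (sup_norm setT K < +oo)%E)
  (hK_entropy : polynomial_uniform_entropy K)
  (hK_pointwise : pointwise_measurable_class (kernel_class K))
  (hK_support : closure [set s | K s != 0] `<=`
    [set s | forall i, - 2^-1 <= s ord0 i <= 2^-1])
  (p : measurableTypeR R * 'rV[R]_d -> R)
  (hp : has_density (lebesgue_measure \x lebesgue_rV R d)%E (Z 0%N) p)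
  (hm : regression_exists p)
  (eps : R) (heps : 0 < eps)
  (hf_continuous :
    {within closed_neighborhood eps I, continuous (marginal_density p)})
  (hf_positive : forall z, closed_neighborhood eps I z ->
    0 < marginal_density p z)
  (hp_continuous : forall z, closed_neighborhood eps I z ->
    {ae lebesgue_measure, forall y : measurableTypeR R,
      p (y, z') @[z' --> z] --> p (y, z)}) :
  let J := closed_neighborhood eps I in
  let Y := fun w i => (Z i w).1 : R in
  let X := fun w i => (Z i w).2 : 'rV[R]_d in
  let m := regression p in
  let mhat := fun w n h => nadaraya_watson K (Y w) (X w) n h in
  ((exists2 M : R, 0 < M &
      {ae P, forall w, `|Y w 0%N| * \1_J (X w 0%N) <= M}) ->
    forall a b : nat -> R,
      (forall n, (0 < n)%N -> [/\ 0 < a n, a n < b n & b n < 1]) ->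
      b n @[n --> \oo] --> 0 ->
      n%:R * a n / ln n%:R @[n --> \oo] --> +oo ->
      {ae P, forall w,
        ereal_sup [set sup_norm I (fun x => mhat w n h x - m x)
                  | h in `[a n, b n]] @[n --> \oo] --> 0%E})
  /\
  (forall q : R, 2 < q ->
    (ereal_sup [set conditional_expectation p (fun y => `|y| `^ q)%R z
               | z in J] < +oo)%E ->
    let gamma := 1 - 2 / q in
    forall (c : R) (b : nat -> R), 0 < c ->
      (\forall n \near \oo,
        0 < c * (ln n%:R / n%:R) `^ gamma /\
        c * (ln n%:R / n%:R) `^ gamma < b n /\ b n < 1) ->
      b n @[n --> \oo] --> 0 ->
      {ae P, forall w,
        ereal_sup [set sup_norm I (fun x => mhat w n h x - m x)
                  | h in `[c * (ln n%:R / n%:R) `^ gamma, b n]]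
          @[n --> \oo] --> 0%E}).
Proof.
have [mp p0 nuE] := hp.
have sup_cvg w (a b : nat -> R) : (\forall n \near \oo, a n <= b n) ->
    (forall k : nat, \forall n \near \oo, forall h, a n <= h <= b n -> forall x, I x ->
      `|nadaraya_watson K (fun i => (Z i w).1 : R) (fun i => (Z i w).2) n h x -
        regression p x| <= k.+1%:R^-1) ->
    ereal_sup [set sup_norm I (fun x =>
        nadaraya_watson K (fun i => (Z i w).1 : R) (fun i => (Z i w).2) n h x -
        regression p x) | h in `[a n, b n]] @[n --> \oo] --> 0%E.
  by move=> ab H; exact: (ereal_sup_bandwidth_cvg0 ab H).
move=> J Y X m mhat; split.
  move=> [M M0 YM] a b hab b_cvg a_lim.
  have ab : \forall n \near \oo, a n <= b n.
    by exists 1%N => // n /= /hab[_ /ltW].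
  have : forall k : nat, {ae P, forall w, \forall n \near \oo, forall h, a n <= h <= b n ->
      forall x, I x -> `|mhat w n h x - m x| <= k.+1%:R^-1}.
    move=> k; have k0 : 0 < k.+1%:R^-1 :> R by rewrite invr_gt0.
    exact: (bounded_consistency hd hZ mp p0 nuE mK hK_int hK_bounded hK_entropy
      hK_pointwise hK_support hI heps hf_continuous hf_positive hp_continuous M0 YM
      b_cvg a_lim k0).
  move=> /ae_foralln; apply: filterS => w; exact: sup_cvg.
move=> q q2 sup_lt gamma c b c0 hab b_cvg.
(* The supremum is -oo when J is empty, hence the absolute value of its finite
   part. *)
have [S S0 hS] : exists2 S : R, 0 <= S & forall z, J z ->
    (conditional_expectation p (fun y => `|y| `^ q)%R z <= S%:E)%E.
  move: sup_lt; set s := ereal_sup _ => s_lt.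
  exists `|fine s| => // z Jz.
  have zs : (conditional_expectation p (fun y => `|y| `^ q)%R z <= s)%E.
    by apply: ereal_sup_ubound; exists z.
  case: s s_lt zs => [r _ h||] //=; last by rewrite leeNy_eq => _ /eqP ->; rewrite leNye.
  by apply: (le_trans h); rewrite lee_fin ler_norm.
have ab : \forall n \near \oo, c * (ln n%:R / n%:R) `^ gamma <= b n.
  by apply: filterS hab => n [_ [/ltW]].
have : forall k : nat, {ae P, forall w, \forall n \near \oo, forall h,
    c * (ln n%:R / n%:R) `^ gamma <= h <= b n ->
    forall x, I x -> `|mhat w n h x - m x| <= k.+1%:R^-1}.
  move=> k; have k0 : 0 < k.+1%:R^-1 :> R by rewrite invr_gt0.
  exact: (moment_consistency hd hZ mp p0 nuE mK hK_int hK_bounded hK_entropy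
    hK_pointwise hK_support hI heps hf_continuous hf_positive hp_continuous q2 S0 hS
    c0 b_cvg k0).
move=> /ae_foralln; apply: filterS => w; exact: sup_cvg.
Qed.
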